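(* There exists a polynomial time randomized algorithm such that, given a positive semidefinite matrix $L\in\mathbb{R}^{m\times m}$, a partition $\mathcal{P}=\{M_1,\ldots,M_t\}$ of $[m]$ into nonempty pairwise disjoint sets, and a sequence of positive integers $b=(b_1,\ldots,b_t)$ with $\sum_{i=1}^t b_i=r$, it outputs a set $S$ in the partition family $\mathcal{B}:=\{S\subseteq[m]: |S\cap M_i|=b_i \text{ for all } i=1,\ldots,t\}$ such that, with high probability, $$\det(L_{S,S})\geq \mathrm{OPT}\cdot (2e)^{-2r}\cdot\prod_{i=1}^t\left(\frac{1}{p_i}\right)^{b_i},$$ where $\mathrm{OPT}:=\max_{S\in\mathcal{B}}\det(L_{S,S})$ and $p_i:=|M_i|$ for $i=1,\ldots,t$.
   Context: $[m]=\{1,\ldots,m\}$. For $S\subseteq[m]$, $L_{S,S}$ denotes the principal submatrix of $L$ with rows and columns indexed by $S$. *)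

(* Defs.v *)
From HB Require Import structures.
From mathcomp Require Export all_boot all_order all_algebra.
From mathcomp Require Export reals.
From mathcomp Require Export sequences exp.

Set Implicit Arguments.
Unset Strict Implicit.
Unset Printing Implicit Defensive.

Import Order.TTheory GRing.Theory Num.Theory.
Local Open Scope ring_scope.

(* Algorithms on real inputs are programs of a randomized real RAM: exact real
   arithmetic and comparisons at unit cost, index arithmetic on natural
   numbers, and fair coin flips.  Memory consists of two-dimensional arrays of
   naturals and of reals, named by natural numbers.  Programs contain no real
   constants except natural numbers (so no advice can be hidden in them);
   there is no rounding of reals to integers, and indices are not multiplied
   (so after T steps they have O(T) bits). *)

Inductive iexp : Type :=
  | IConst of nat
  | ICell of nat & iexp & iexp
  | IAdd of iexp & iexp
  | ISub of iexp & iexp.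

Inductive rexp : Type :=
  | RConst of nat
  | RCell of nat & iexp & iexp
  | RAdd of rexp & rexp
  | RSub of rexp & rexp
  | RMul of rexp & rexp
  | RDiv of rexp & rexp.

Inductive test : Type :=
  | ILe of iexp & iexp
  | RLe of rexp & rexp.

Inductive prog : Type :=
  | Skip
  | IAssign of nat & iexp & iexp & iexp
  | RAssign of nat & iexp & iexp & rexp
  | Flip of nat & iexp & iexp
  | Seq of prog & prog
  | If of test & prog & prog
  | While of test & prog.

Section Semantics.

Variable R : realType.

Record state : Type := State {
  imem : nat -> nat -> nat -> nat;
  rmem : nat -> nat -> nat -> R;
  coins : seq bool
}.

Definition update (T : Type) (f : nat -> nat -> nat -> T) (a i j : nat) (v : T)
    : nat -> nat -> nat -> T :=
  fun a' i' j' => if [&& a' == a, i' == i & j' == j] then v else f a' i' j'.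

(* Subtraction of naturals is truncated. *)
Fixpoint ieval (s : state) (e : iexp) : nat :=
  match e with
  | IConst n => n
  | ICell a i j => imem s a (ieval s i) (ieval s j)
  | IAdd e1 e2 => (ieval s e1 + ieval s e2)%N
  | ISub e1 e2 => (ieval s e1 - ieval s e2)%N
  end.

(* Division by zero returns zero. *)
Fixpoint reval (s : state) (e : rexp) : R :=
  match e with
  | RConst n => n%:R
  | RCell a i j => rmem s a (ieval s i) (ieval s j)
  | RAdd e1 e2 => reval s e1 + reval s e2
  | RSub e1 e2 => reval s e1 - reval s e2
  | RMul e1 e2 => reval s e1 * reval s e2
  | RDiv e1 e2 => reval s e1 / reval s e2
  end.

Definition teval (s : state) (b : test) : bool :=
  match b with
  | ILe e1 e2 => (ieval s e1 <= ieval s e2)%N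
  | RLe e1 e2 => reval s e1 <= reval s e2
  end.

(* A configuration is a stack of programs still to be executed, and a state;
   the machine has halted when the stack is empty.  One step evaluates boundedly
   many operations, the bound depending only on the program, so counting steps
   is counting unit-cost operations up to a constant factor.  A Flip consumes
   one coin of the random tape; the default of [head] is irrelevant when the
   tape is at least as long as the running time. *)
Definition config : Type := (seq prog * state)%type.

Definition step (c : config) : config :=
  let: (k, s) := c in
  match k with
  | [::] => c
  | p :: k' =>
    match p with
    | Skip => (k', s)
    | IAssign a i j e =>
        (k', State (update (imem s) a (ieval s i) (ieval s j) (ieval s e))
                   (rmem s) (coins s))
    | RAssign a i j e =>
        (k', State (imem s)
                   (update (rmem s) a (ieval s i) (ieval s j) (reval s e))
                   (coins s))
    | Flip a i j =>
        (k', State (update (imem s) a (ieval s i) (ieval s j)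
                           (nat_of_bool (head false (coins s))))
                   (rmem s) (behead (coins s)))
    | Seq p1 p2 => (p1 :: p2 :: k', s)
    | If b p1 p2 => ((if teval s b then p1 else p2) :: k', s)
    | While b p1 => if teval s b then (p1 :: p :: k', s) else (k', s)
    end
  end.

Definition run (n : nat) (p : prog) (s : state) : config :=
  iter n step ([:: p], s).

Definition halted (c : config) : bool := nilp c.1.

(* The probability of the event E under n independent fair coins. *)
Definition coin_prob (n : nat) (E : pred (n.-tuple bool)) : R :=
  #|[set w : n.-tuple bool | E w]|%:R / (2 ^ n)%:R.

Definition psd (m : nat) (L : 'M[R]_m) : Prop :=
  L^T = L /\ forall x : 'cV[R]_m, 0 <= (x^T *m L *m x) 0 0.

Definition principal_submx (m : nat) (L : 'M[R]_m) (S : {set 'I_m}) : 'M[R]_#|S| :=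
  mxsub (@enum_val 'I_m (mem S)) (@enum_val 'I_m (mem S)) L.

Definition is_partition (m t : nat) (M : 'I_t -> {set 'I_m}) : Prop :=
  [/\ forall i, M i != set0,
      forall i j, i != j -> [disjoint M i & M j]
    & \bigcup_(i < t) M i = [set: 'I_m]].

Definition partition_family (m t : nat) (M : 'I_t -> {set 'I_m}) (b : 'I_t -> nat)
    : {set {set 'I_m}} :=
  [set S : {set 'I_m} | [forall i, #|S :&: M i| == b i]].

(* The default value 0 plays no role when L is positive semidefinite, since
   then all its principal minors are nonnegative, and the family is nonempty. *)
Definition opt (m : nat) (L : 'M[R]_m) (B : {set {set 'I_m}}) : R :=
  \big[Num.max/0]_(S in B) \det (principal_submx L S).

Definition extend (T : Type) (x0 : T) (m n : nat) (F : 'I_m -> 'I_n -> T) (i j : nat)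
    : T :=
  match insub i, insub j with
  | Some i', Some j' => F i' j'
  | _, _ => x0
  end.

(* Initial memory: integer array 0 holds m and t, integer array 1 the incidence
   matrix of the partition, integer array 2 the numbers b_i, and real array 0
   the matrix L; all other cells are 0. *)
Definition input_ints (m t : nat) (M : 'I_t -> {set 'I_m}) (b : 'I_t -> nat)
    (a i j : nat) : nat :=
  match a with
  | 0 => extend 0%N (fun (_ : 'I_1) (k : 'I_2) => if k == 0 then m else t) i j
  | 1 => extend 0%N (fun (i' : 'I_t) (j' : 'I_m) => nat_of_bool (j' \in M i')) i j
  | 2 => extend 0%N (fun (i' : 'I_t) (_ : 'I_1) => b i') i j
  | _ => 0%N
  end.

Definition input_reals (m : nat) (L : 'M[R]_m) (a i j : nat) : R :=
  if a is 0 then extend 0 (fun i' j' : 'I_m => L i' j') i j else 0.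

Definition input (m t : nat) (L : 'M[R]_m) (M : 'I_t -> {set 'I_m}) (b : 'I_t -> nat)
    (w : seq bool) : state :=
  State (input_ints M b) (input_reals L) w.

(* The output set is read off row 0 of integer array 3. *)
Definition output (m : nat) (c : config) : {set 'I_m} :=
  [set j : 'I_m | imem c.2 3 0 j != 0%N].

End Semantics.

(* Main.v *)
Require Import Defs.
From mathcomp Require Import lra ring zify.
Set Implicit Arguments.
Unset Strict Implicit.
Unset Printing Implicit Defensive.
Import Order.TTheory GRing.Theory Num.Theory.

(* Write L as a Gram matrix, and let G(u_1, ..., u_r) be the Gram determinant of
   vectors indexed by r slots, b_i of them for the part M_i; it is a positive
   semidefinite quadratic form in each u_k.  The algorithm draws u_k = x_k with
   independent coordinates on M_i, uniform on a fine symmetric grid of integers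
   bounded by Q, and then replaces x_1, x_2, ... in turn by a basis vector e_j,
   where j is sampled with probability about proportional to the value of the
   k-th quadratic form at e_j.  The best of many trials is kept.

   Anti-concentration: completing the square in the coordinate of x_k that belongs
   to an optimal solution gives G(x) >= OPT * prod t_k^2, where each t_k is a grid
   variable shifted by something independent of it.  Apart from the unlikely event
   that some |t_k| < 1, the mean of |t_k|^(-1/2) is at most 2 / sqrt Q, so that of
   (OPT / G(x))^(1/4) is at most (2 / sqrt Q)^r.

   Rounding: the output S is chosen with probability at most
   3^r * det(L_S) * prod rho_k / G(x), where rho_k is the value at x_k of the k-th
   form divided by its trace on M_i.  For a fixed S the mean of prod rho_k over x
   is at most (Q^2/3)^r, because rho_k does not involve x_1, ..., x_(k-1); hence
   the mean of G(x) / det(L_S) is at most Q^(2r) * prod p_i^(b_i).  Sampling j,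
   rather than taking the best j, is what makes p_i appear with exponent b_i
   instead of 2 b_i.

   Weighted AM-GM combines both: with constant probability
   OPT <= 1.1^5 * 16^r * prod p_i^(b_i) * det(L_S), and 1.1^5 * 16 < (2e)^2. *)

(** * Schur complements and Gram determinants *)

Section SchurElimination.
Local Open Scope ring_scope.
Variables (R : realType) (m : nat).
Implicit Types (W : 'M[R]_m) (u v w x : 'cV[R]_m) (us D xs : seq 'cV[R]_m).

(** Averaging the lower bound OPT * prod t_k^2 directly would fail: over grid points with |t| >= 1
    the mean of t^-2 is of order 1/Q, dominated by the smallest t, whereas 1/Q^2 is required to
    cancel the Q^2 lost per slot in rounding. The mean of |t|^(-1/2) has the right order, and its
    fourth power is t^-2; hence the weights 4 and 1 in AM-GM. Per slot the grid then cancels: (2 /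
    sqrt Q)^4 * Q^2 = 16, where Q^2 bounds the sampler's factor 3 times the second moment (Q^2 - 1)
    / 3. The slack 1.1^5 buys a failure probability at most 23/25 for one trial. As outcomes are
    evaluated exactly, the best of 9 c m independent trials fails with probability at most m^-c.
    Gram determinants are treated as products of pivots of successive Schur complements: the program
    computes just these, and each pivot displays the quadratic form of one slot. Zero pivots need no
    special code, since 0^-1 = 0 makes elimination along an isotropic vector do nothing, in the
    proof as on the machine. *)

Definition bil W u v : R := (u^T *m W *m v) 0 0.

(** The form left after projecting [W]-orthogonally off [u]. For isotropic [u] the inverse is 0 and
    [W] stays as it is, in agreement with the machine's division by zero. *)
Definition elim W u : 'M[R]_m :=
  W - (bil W u u)^-1 *: ((W *m u) *m (W *m u)^T).

(** The Gram determinant of [us] under [W] as a product of pivots; [vol_gram] identifies the two for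
    psd [W]. *)
Fixpoint vol W us : R :=
  if us is u :: us' then bil W u u * vol (elim W u) us' else 1.

Definition basis_vec (j : 'I_m) : 'cV[R]_m := delta_mx j 0.

Lemma bilDl W u v w : bil W (u + v) w = bil W u w + bil W v w.
Proof. by rewrite /bil linearD /= !mulmxDl mxE. Qed.

Lemma bilDr W u v w : bil W w (u + v) = bil W w u + bil W w v.
Proof. by rewrite /bil mulmxDr mxE. Qed.

Lemma bilZl W (a : R) u v : bil W (a *: u) v = a * bil W u v.
Proof. by rewrite /bil linearZ /= -!scalemxAl mxE. Qed.

Lemma bilZr W (a : R) u v : bil W u (a *: v) = a * bil W u v.
Proof. by rewrite /bil -scalemxAr mxE. Qed.

Lemma bil0l W v : bil W 0 v = 0.
Proof. by rewrite /bil trmx0 !mul0mx mxE. Qed.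

Lemma bil_col W j u : bil W (basis_vec j) u = (W *m u) j 0.
Proof.
rewrite /bil /basis_vec trmx_delta -mulmxA mxE (bigD1 j) //= big1 => [|i ij].
  by rewrite mxE !eqxx mul1r addr0.
by rewrite mxE (negPf ij) andbF mul0r.
Qed.

Lemma bil_basis W i j : bil W (basis_vec i) (basis_vec j) = W i j.
Proof. by rewrite bil_col /basis_vec -colE mxE. Qed.

Lemma bilC W u v : W^T = W -> bil W u v = bil W v u.
Proof.
move=> sW; rewrite /bil -[in LHS](trmxK (u^T *m W *m v)) mxE.
by rewrite !trmx_mul trmxK sW mulmxA.
Qed.

Lemma bil_elim W u v w : W^T = W ->
  bil (elim W u) v w = bil W v w - bil W v u * bil W u w / bil W u u.
Proof.
move=> sW; rewrite {1}/bil /elim mulmxBr mulmxBl mxE [X in _ + X]mxE.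
congr (_ - _); rewrite -scalemxAr -scalemxAl mxE mulrC; congr (_ / _).
rewrite trmx_mul sW.
have -> : v^T *m (W *m u *m (u^T *m W)) *m w = (v^T *m W *m u) *m (u^T *m W *m w).
  by rewrite !mulmxA.
by rewrite mxE big_ord1.
Qed.

Lemma sym_elim W u : W^T = W -> (elim W u)^T = elim W u.
Proof. by move=> sW; rewrite /elim linearB linearZ /= trmx_mul trmxK sW. Qed.

Lemma psd_bil_ge0 W u : psd W -> 0 <= bil W u u.
Proof. by move=> [_ h]; exact: h. Qed.

Lemma psd_bil_ker W u v : psd W -> bil W u u = 0 -> bil W v u = 0.
Proof.
move=> pW u0; have sW := pW.1.
case: (eqVneq (bil W v u) 0) => // b0; exfalso.
(* With [u] isotropic the form at v + s u is linear in s, namely [bil W v v] + 2 s [bil W v u]; this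
   s makes it -1. *)
have := psd_bil_ge0 (v + (- ((bil W v v + 1) / (2 * bil W v u))) *: u) pW.
rewrite !(bilDl, bilDr, bilZl, bilZr) u0 (bilC u v) //.
set a := bil W v v; set b := bil W v u.
have -> : a + - ((a + 1) / (2 * b)) * b
   + (- ((a + 1) / (2 * b)) * b + - ((a + 1) / (2 * b)) * (- ((a + 1) / (2 * b)) * 0))
   = -1 by field.
by rewrite ler0N1.
Qed.

(** For a nonzero pivot the eliminated form at [v] is the minimum of [W] over the line v + s u,
    hence nonnegative. *)
Lemma psd_elim W u : psd W -> psd (elim W u).
Proof.
move=> pW; have sW := pW.1; split; first exact: sym_elim.
move=> v; rewrite -/(bil _ v v) bil_elim // (bilC u v) //.
case: (eqVneq (bil W u u) 0) => [u0|u0].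
  by rewrite u0 invr0 mulr0 subr0 psd_bil_ge0.
have := psd_bil_ge0 (v + (- (bil W v u / bil W u u)) *: u) pW.
rewrite !(bilDl, bilDr, bilZl, bilZr) (bilC u v) //.
congr (_ <= _); field; exact: u0.
Qed.

Lemma psd_CS W u v : psd W -> bil W v u ^+ 2 <= bil W v v * bil W u u.
Proof.
move=> pW; have sW := pW.1.
case: (eqVneq (bil W u u) 0) => [u0|u0].
  by rewrite u0 mulr0 psd_bil_ker // expr0n.
have := psd_bil_ge0 v (psd_elim u pW).
rewrite bil_elim // (bilC u v) // subr_ge0 -expr2 ler_pdivrMr //.
by rewrite lt0r u0 psd_bil_ge0.
Qed.

Lemma eq_bil W W' : (forall u v, bil W u v = bil W' u v) -> W = W'.
Proof. by move=> h; apply/matrixP => i j; rewrite -!bil_basis h. Qed.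

(** Both sides are the Schur complement of the 2 by 2 Gram block of [u] and [v]. A nonzero block
    determinant forces both single pivots to be nonzero, so the claim becomes an identity of
    rational functions. *)
Lemma elimC W u v : psd W ->
  bil W u u * bil W v v - bil W u v ^+ 2 != 0 ->
  elim (elim W u) v = elim (elim W v) u.
Proof.
move=> pW d0; have sW := pW.1; apply: eq_bil => x y.
have u0 : bil W u u != 0.
  apply: contraNneq d0 => u0.
  by rewrite u0 mul0r (bilC u v) // psd_bil_ker // expr0n subr0.
have v0 : bil W v v != 0.
  by apply: contraNneq d0 => v0; rewrite v0 mulr0 psd_bil_ker // expr0n subr0.
rewrite !bil_elim ?sym_elim // (bilC v u) // (bilC u y) // (bilC v y) //.
by field; rewrite u0 v0 -expr2 d0.
Qed.

Lemma psd_foldl W us : psd W -> psd (foldl elim W us).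
Proof. by elim: us W => //= u us IH W /(psd_elim u) /IH. Qed.

Lemma vol_ge0 W us : psd W -> 0 <= vol W us.
Proof.
elim: us W => [|u us IH] W pW; first exact: ler01.
by rewrite mulr_ge0 ?psd_bil_ge0 // IH //; apply: psd_elim.
Qed.

Lemma vol_cat W us xs : vol W (us ++ xs) = vol W us * vol (foldl elim W us) xs.
Proof. by elim: us W => [|u us IH] W /=; rewrite ?mul1r // IH mulrA. Qed.

(** The first two pivots multiply to the 2 by 2 Gram minor, which is symmetric in [u] and [v]. If it
    vanishes both sides are 0, and otherwise the remaining forms agree by [elimC]. *)
Lemma vol_swap W u v us : psd W -> vol W [:: u, v & us] = vol W [:: v, u & us].
Proof.
move=> pW; have sW := pW.1; rewrite /= !mulrA.
have minor (x y : 'cV_m) : bil W x x * bil (elim W x) y y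
    = bil W x x * bil W y y - bil W x y ^+ 2.
  rewrite bil_elim // (bilC y x) //; case: (eqVneq (bil W x x) 0) => [x0|x0].
    by rewrite x0 (bilC x y) // (psd_bil_ker _ pW x0) expr0n !mul0r subr0.
  by field.
rewrite !minor (bilC v u) // [bil W v v * _]mulrC.
case: (eqVneq (bil W u u * bil W v v - bil W u v ^+ 2) 0) => [->|d0].
  by rewrite !mul0r.
by rewrite elimC.
Qed.

Lemma vol_cons_rcons W x us : psd W -> vol W (x :: us) = vol W (rcons us x).
Proof.
elim: us W => // u us IH W pW.
by rewrite vol_swap //= -IH //; apply: psd_elim.
Qed.

(** Exhibits the Gram determinant as a psd quadratic form in one slot vector, the others being
    fixed. Every argument that replaces one vector at a time rests on this. *)
Lemma vol_mid W D x xs : psd W ->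
  vol W (D ++ x :: xs) = vol W (D ++ xs) * bil (foldl elim W (D ++ xs)) x x.
Proof.
move=> pW; rewrite vol_cat vol_cons_rcons; last exact: psd_foldl.
by rewrite -cats1 vol_cat mulrA -vol_cat /= mulr1 -foldl_cat.
Qed.

Lemma vol_perm W us xs : psd W -> perm_eq us xs -> vol W us = vol W xs.
Proof.
elim: us W xs => [|u us IH] W xs pW.
  by rewrite perm_sym => /perm_nilP ->.
move=> pe; have /path.splitPr E : u \in xs by rewrite -(perm_mem pe) mem_head.
case: E pe => s1 s2; rewrite perm_sym perm_catC /= perm_cons perm_catC perm_sym.
move=> pe; rewrite vol_mid // -(vol_mid [::]) //=.
by rewrite (IH _ _ (psd_elim u pW) pe).
Qed.

(** A vector is isotropic once its own copy has been eliminated. Thus a trial with a repeated pick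
    has value 0 and never beats the best value, and distinctness need not be enforced while
    sampling. *)
Lemma vol_nuniq W us : psd W -> ~~ uniq us -> vol W us = 0.
Proof.
move=> pW; elim: us W pW => //= u us IH W pW.
rewrite negb_and negbK => /orP [uu|nu]; last by rewrite (IH _ (psd_elim u pW) nu) mulr0.
rewrite (vol_perm (psd_elim u pW) (perm_to_rem uu)) /= bil_elim ?pW.1 //.
case: (eqVneq (bil W u u) 0) => [->|u0]; first by rewrite mul0r.
by rewrite mulfK // subrr mul0r mulr0.
Qed.

(** Block elimination A = P B with P unitriangular. With a zero pivot the first row has to vanish,
    which [psd_bil_ker] provides for Gram matrices of psd forms. *)
Lemma det_schur n (A : 'M[R]_n.+1) :
  (A 0 0 = 0 -> forall i, A 0 i = 0) ->
  \det A = A 0 0 * \det (\matrix_(i < n, j < n)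
      (A (lift 0 i) (lift 0 j) - A (lift 0 i) 0 * A 0 (lift 0 j) / A 0 0)).
Proof.
move=> A0; case: (eqVneq (A 0 0) 0) => [a0|a0].
  rewrite a0 mul0r (expand_det_row _ 0) big1 // => i _.
  by rewrite A0 // mul0r.
pose P : 'M[R]_(1 + n) := block_mx 1%:M 0 (\matrix_(i < n, j < 1) (A (lift 0 i) 0 / A 0 0)) 1%:M.
pose B : 'M[R]_(1 + n) := block_mx (A 0 0)%:M (\matrix_(i < 1, j < n) A 0 (lift 0 j)) 0
  (\matrix_(i < n, j < n)
      (A (lift 0 i) (lift 0 j) - A (lift 0 i) 0 * A 0 (lift 0 j) / A 0 0)).
have AE : @eq 'M[R]_(1 + n, 1 + n) A (P *m B).
  rewrite /P /B mulmx_block !mul1mx !mul0mx !addr0.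
  have l0 (i : 'I_1) : lshift n i = 0 :> 'I_(1 + n) by apply/val_inj; rewrite ord1.
  have r0 (i : 'I_n) : rshift 1 i = lift 0 i :> 'I_(1 + n) by apply/val_inj.
  rewrite -[LHS](@submxK _ 1 n 1 n).
  congr (@block_mx R 1 n 1 n _ _ _ _); apply/matrixP => i j; rewrite !mxE ?l0 ?r0 ?(ord1 i) ?(ord1 j)
    ?big_ord1 ?mxE ?eqxx ?mulr1n //.
    by rewrite divfK.
  by rewrite mulrAC addrC subrK.
transitivity (\det (P *m B)); first by rewrite -AE.
by rewrite det_mulmx /P /B det_lblock det_ublock !det1 !mul1r det_scalar expr1.
Qed.

Lemma vol_gram W us : psd W ->
  vol W us = \det (\matrix_(i < size us, j < size us) bil W us`_i us`_j).
Proof.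
elim: us W => [|u us IH] W pW; first by rewrite det_mx00.
rewrite /= det_schur; last first.
  by rewrite mxE /= => u0 i; rewrite mxE /= (bilC u) ?pW.1 // psd_bil_ker.
rewrite IH; last exact: psd_elim.
rewrite mxE /=; congr (_ * \det _); apply/matrixP => i j.
by rewrite !mxE /= bil_elim ?pW.1.
Qed.

Lemma vol_principal W (S : {set 'I_m}) : psd W ->
  vol W [seq basis_vec j | j <- enum S] = \det (principal_submx W S).
Proof.
move=> pW; rewrite vol_gram //.
have sz : size [seq basis_vec j | j <- enum S] = #|S| by rewrite size_map -cardE.
set n := size _ in sz *; move: sz; rewrite /n => sz.
have castdet k k' (e : k = k') (A : 'M[R]_k) : \det (castmx (e, e) A) = \det A.
  by case: k' / e; rewrite castmx_id.
rewrite -(castdet _ _ sz); congr (\det _); apply/matrixP => i j.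
rewrite castmxE !mxE /=.
have nthE (k : 'I_#|S|) : [seq basis_vec j | j <- enum S]`_k = basis_vec (enum_val k).
  by rewrite (nth_map (enum_val k)) -?cardE // [in RHS](enum_val_nth (enum_val k)).
by rewrite !nthE bil_basis.
Qed.

End SchurElimination.

(** * Coin expectations and the random grid *)

Section CoinExpectation.
Local Open Scope ring_scope.
Variable R : realType.
Implicit Types (f g : seq bool -> R) (n : nat).

(** Expectation over [n] coins, by recursion on the coins and on plain lists: conditioning on a
    prefix and exchanging independent blocks become short inductions, and blocks of the tape are
    simply [take] and [drop]. *)
Fixpoint EE n f : R :=
  if n is n'.+1 then (EE n' (fun w => f (true :: w)) + EE n' (fun w => f (false :: w))) / 2
  else f [::].

Lemma eq_EE n f g : (forall w, size w = n -> f w = g w) -> EE n f = EE n g.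
Proof.
elim: n f g => [|n IH] f g fg /=; first exact: fg.
by congr ((_ + _) / 2); apply: IH => w sw; rewrite fg //= sw.
Qed.

Lemma le_EE n f g : (forall w, size w = n -> f w <= g w) -> EE n f <= EE n g.
Proof.
elim: n f g => [|n IH] f g fg /=; first exact: fg.
by rewrite ler_pM2r ?invr_gt0 // lerD //; apply: IH => w sw; rewrite fg //= sw.
Qed.

Lemma EE_cst n (a : R) : EE n (fun=> a) = a.
Proof. by elim: n => //= n ->; field. Qed.

Lemma EE_ge0 n f : (forall w, size w = n -> 0 <= f w) -> 0 <= EE n f.
Proof. by move=> f0; rewrite -(EE_cst n 0); apply: le_EE. Qed.

Lemma EED n f g : EE n (fun w => f w + g w) = EE n f + EE n g.
Proof. by elim: n f g => //= n IH f g; rewrite !IH; field. Qed.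

Lemma EEZ n (a : R) f : EE n (fun w => a * f w) = a * EE n f.
Proof. by elim: n f => //= n IH f; rewrite !IH; field. Qed.

Lemma EEZr n (a : R) f : EE n (fun w => f w * a) = EE n f * a.
Proof. by rewrite mulrC -EEZ; apply: eq_EE => w _; rewrite mulrC. Qed.

Lemma EE_sum (I : Type) (r : seq I) (P : pred I) n (F : I -> seq bool -> R) :
  EE n (fun w => \sum_(i <- r | P i) F i w) = \sum_(i <- r | P i) EE n (F i).
Proof.
elim: r => [|i r IH]; first by rewrite big_nil -[RHS](EE_cst n 0); apply: eq_EE => w _; rewrite big_nil.
rewrite big_cons -IH; case: ifP => Pi.
  by rewrite -EED; apply: eq_EE => w _; rewrite big_cons Pi.
by apply: eq_EE => w _; rewrite big_cons Pi.
Qed.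

Lemma EE_cat n1 n2 f :
  EE (n1 + n2) f = EE n1 (fun w1 => EE n2 (fun w2 => f (w1 ++ w2))).
Proof. by elim: n1 f => //= n IH f; rewrite !IH. Qed.

Lemma EE_exchange n1 n2 (f : seq bool -> seq bool -> R) :
  EE n1 (fun w1 => EE n2 (f w1)) = EE n2 (fun w2 => EE n1 (f^~ w2)).
Proof.
elim: n1 f => //= n IH f; rewrite !IH.
by rewrite -EED mulrC -EEZ; apply: eq_EE => w _; rewrite mulrC.
Qed.

Lemma EE_tuple n f : EE n f = (\sum_(w : n.-tuple bool) f w) / (2 ^ n)%:R.
Proof.
elim: n f => [|n IH] f /=.
  by rewrite (big_pred1 [tuple]) ?divr1 // => w; apply/esym/eqP; exact: tuple0.
rewrite !IH.
pose h (p : bool * n.-tuple bool) := [tuple of p.1 :: p.2].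
have hb : bijective h.
  exists (fun w : n.+1.-tuple bool => (thead w, [tuple of behead w])).
    by case=> b w; congr (_, _); apply/val_inj.
  by move=> w; rewrite [RHS]tuple_eta; apply/val_inj.
have -> : \sum_(w : n.+1.-tuple bool) f w
    = \sum_(b : bool) \sum_(w : n.-tuple bool) f (b :: w).
  rewrite pair_bigA /= (reindex h) //=; exact: onW_bij.
rewrite big_bool /= expnS natrM; field.
by rewrite pnatr_eq0 expn_eq0.
Qed.

Lemma coin_probE n (E : pred (n.-tuple bool)) :
  coin_prob R E = (\sum_(w : n.-tuple bool) (E w)%:R) / (2 ^ n)%:R.
Proof.
rewrite /coin_prob -sum1_card natr_sum; congr (_ / _).
rewrite big_mkcond /=; apply: eq_bigr => w _; rewrite inE.
by case: (E w).
Qed.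

End CoinExpectation.

(** * The grid variable: moments, atoms and negative moments *)

Section Grid.
Local Open Scope ring_scope.
Variable R : realType.

(** Horner's rule with binary digits 1 and -1. For [l] coins the value is uniform on the points 2u -
    (2^l - 1), u < 2^l: two apart, exactly symmetric, and obtained with no constant but 1. *)
Definition draw (w : seq bool) : R :=
  foldl (fun x (c : bool) => if c then x + x + 1 else x + x - 1) 0 w.

Lemma draw_cons c w : draw (c :: w) = (if c then 1 else -1) * 2 ^+ size w + draw w.
Proof.
rewrite /draw /=.
have foldE x v : foldl (fun x (c : bool) => if c then x + x + 1 else x + x - 1) x v
   = x * 2 ^+ size v + draw v.
  rewrite /draw; elim: v x => [|b v IH] x /=; first by rewrite mulr1 addr0.
  rewrite IH [in RHS]IH exprS; case: b; ring.
by rewrite foldE; congr (_ * _ + _); case: c; ring.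
Qed.

Lemma EE_draw l (h : R -> R) :
  EE l (fun w => h (draw w)) = (\sum_(u < 2 ^ l) h (2 * u%:R - ((2 ^ l)%:R - 1))) / (2 ^ l)%:R.
Proof.
elim: l h => [|l IH] h /=.
  by rewrite big_ord1 divr1; congr (h _); rewrite /draw /=; ring.
have E b : EE l (fun w => h (draw (b :: w)))
    = (\sum_(u < 2 ^ l) h ((if b then 1 else -1) * 2 ^+ l + (2 * u%:R - ((2 ^ l)%:R - 1)))) / (2 ^ l)%:R.
  rewrite -(IH (fun x => h ((if b then 1 else -1) * 2 ^+ l + x))).
  by apply: eq_EE => w sw; rewrite draw_cons sw.
rewrite !E expnS mul2n -addnn big_split_ord /= natrD.
have -> : \sum_(i < 2 ^ l) h (2 * i%:R - ((2 ^ l)%:R + (2 ^ l)%:R - 1))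
  = \sum_(u < 2 ^ l) h (-1 * 2 ^+ l + (2 * u%:R - ((2 ^ l)%:R - 1))).
  by apply: eq_bigr => i _; congr (h _); rewrite natrX; ring.
have -> : \sum_(i < 2 ^ l) h (2 * (2 ^ l + i)%:R - ((2 ^ l)%:R + (2 ^ l)%:R - 1))
  = \sum_(u < 2 ^ l) h (1 * 2 ^+ l + (2 * u%:R - ((2 ^ l)%:R - 1))).
  by apply: eq_bigr => i _; congr (h _); rewrite natrD natrX; ring.
by field; rewrite -natrD !pnatr_eq0 addn_eq0 expn_eq0.
Qed.

(** Mean 0 and second moment (4^l - 1) / 3. A general quadratic is needed for the induction, since
    the shift by the leading digit changes its lower coefficients. *)
Lemma draw_moments l (a b c : R) :
  EE l (fun w => a * draw w ^+ 2 + b * draw w + c) = a * ((4 ^+ l - 1) / 3) + c.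
Proof.
elim: l a b c => [|l IH] a b c /=; first by rewrite /draw /= !mulr0 subrr; ring.
have E d : EE l (fun w => a * draw (d :: w) ^+ 2 + b * draw (d :: w) + c)
   = a * ((4 ^+ l - 1) / 3) + (a * 4 ^+ l + (if d then 1 else -1) * b * 2 ^+ l + c).
  rewrite -(IH a (b + 2 * a * ((if d then 1 else -1) * 2 ^+ l))).
  apply: eq_EE => w sw; rewrite draw_cons sw.
  have -> : 4 = 2 ^+ 2 :> R by ring.
  rewrite -exprM mulnC exprM; case: d; ring.
by rewrite !E exprS; field.
Qed.

Lemma count_ge n (a : R) : a <= n%:R -> \sum_(u < n) (a <= u%:R)%R%:R <= n%:R - a.
Proof.
elim: n => [|n IH] an; first by rewrite big_ord0; lra.
case: (leP a n%:R) => an'.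
  rewrite big_ord_recr /= an'; have := IH an'; rewrite -natr1 /=; lra.
rewrite big1 => [|u _]; first by lra.
rewrite leNgt (le_lt_trans _ an') // ler_nat -ltnS; exact: ltn_ord.
Qed.

Lemma count_itv n (a b : R) : 0 <= b ->
  \sum_(u < n) (a <= u%:R < a + b)%R%:R <= b + 1.
Proof.
move=> b0; elim: n => [|n IH]; first by rewrite big_ord0; lra.
rewrite big_ord_recr /=; case: andP => [[an nb]|_]; last by rewrite addr0.
(* When n itself lies in the interval, the smaller points are counted by their lower end alone: at
   most n - a < b of them. *)
apply: (@le_trans _ _ (\sum_(u < n) (a <= u%:R)%R%:R + 1)).
  by rewrite lerD2r ler_sum // => u _; case: (a <= _) => //=; case: (_ < _).
by have := count_ge an; lra.
Qed.

Lemma count_near n (c : R) : \sum_(u < n) (`|2 * u%:R - c| < 1)%R%:R <= 1 :> R.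
Proof.
elim: n => [|n IH]; first by rewrite big_ord0.
rewrite big_ord_recr /=; case: (ltP `|_| 1) => [nc|_]; last by rewrite addr0.
rewrite big1 ?add0r // => u _; case: ltP => // uc; exfalso.
have : (u.+1%:R : R) <= n%:R by rewrite ler_nat.
move: nc uc; rewrite !ltr_norml -natr1 => /andP[_ ?] /andP[? _] ?; lra.
Qed.

(** The negative moment that still has a mean of order Q^(-1/2). It is cut off below 1 because the
    grid has atoms, which may sit at the singularity; that event is charged to [bads]. *)
Definition kappa (t : R) : R := if 1 <= `|t| then (Num.sqrt `|t|)^-1 else 0.

Lemma kappa_ge0 t : 0 <= kappa t.
Proof. by rewrite /kappa; case: ifP => // _; rewrite invr_ge0 sqrtr_ge0. Qed.

Lemma kappa4 t : 1 <= `|t| -> kappa t ^+ 4 * t ^+ 2 = 1.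
Proof.
move=> t1; rewrite /kappa t1 (exprM _ 2 2) !exprVn sqr_sqrtr // real_normK ?num_real //.
rewrite mulVf // expf_neq0 // -normr_gt0; exact: lt_le_trans t1.
Qed.

Definition kappa_pos (t : R) : R := if 1 <= t then (Num.sqrt t)^-1 else 0.

(** Discrete form of integrating t^(-1/2): the i-th of the points that are at least 1 is at least 2i
    - 1, and the sum of the first a values (2i - 1)^(-1/2) is at most sqrt (2a). *)
Lemma sum_kappa_pos n (c : R) :
  \sum_(u < n) kappa_pos (2 * u%:R - c)
    <= Num.sqrt (2 * \sum_(u < n) (1 <= 2 * u%:R - c)%R%:R).
Proof.
elim: n => [|n IH]; first by rewrite !big_ord0 mulr0 sqrtr0.
rewrite !big_ord_recr [kappa_pos (2 * (ord_max : 'I_n.+1)%:R - c)]/kappa_pos /=.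
case: (leP 1 (2 * n%:R - c)) => nc; last by rewrite !addr0.
set a := \sum_(i < n) _ in IH *.
have a0 : 0 <= a by rewrite sumr_ge0.
(* The [a] points counted so far are at least 1, two apart and below the new one. *)
have ha : 2 * a + 1 <= 2 * n%:R - c.
  have /count_ge : (c + 1) / 2 <= n%:R by lra.
  have -> : \sum_(u < n) ((c + 1) / 2 <= u%:R)%R%:R = a.
    by apply: eq_bigr => u _; congr (nat_of_bool _)%:R; apply/idP/idP => ?; lra.
  lra.
apply: (le_trans (lerD IH (lexx _))).
have s0 : 0 < Num.sqrt (2 * a + 1) by rewrite sqrtr_gt0; lra.
apply: (@le_trans _ _ (Num.sqrt (2 * a) + (Num.sqrt (2 * a + 1))^-1)).
  rewrite lerD2l lef_pV2 ?posrE ?sqrtr_gt0; last 2 first; [lra|lra|].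
  by rewrite ler_sqrt //; lra.
rewrite -(@ler_pXn2r _ 2) ?nnegrE ?sqrtr_ge0 //; last first.
  by rewrite addr_ge0 ?sqrtr_ge0 // invr_ge0 sqrtr_ge0.
rewrite [X in _ <= X]sqr_sqrtr; last by rewrite /=; lra.
set p := Num.sqrt (2 * a); set s := Num.sqrt (2 * a + 1) in s0 *.
have p2 : p ^+ 2 = 2 * a by rewrite sqr_sqrtr //; lra.
have s2 : s ^+ 2 = 2 * a + 1 by rewrite sqr_sqrtr //; lra.
have p0 : 0 <= p by rewrite sqrtr_ge0.
have -> : 2 * (a + 1%:R) = p ^+ 2 + 2 by rewrite p2 /=; ring.
have E : (p + s^-1) ^+ 2 = p ^+ 2 + (2 * p * s + 1) / s ^+ 2 by field; rewrite gt_eqF.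
rewrite E lerD2l ler_pdivrMr ?exprn_gt0 //.
(* As s^2 = p^2 + 1, the claim is 2 p s <= p^2 + s^2. *)
nra.
Qed.

(** Reversing the index maps the negative side to a grid of the same shape, so the one-sided bound
    covers both. With [a] and [b] points on the two sides, sqrt (2a) + sqrt (2b) <= 2 sqrt (a + b)
    by concavity. *)
Lemma sum_kappa n (c : R) : \sum_(u < n) kappa (2 * u%:R - c) <= 2 * Num.sqrt n%:R.
Proof.
have -> : \sum_(u < n) kappa (2 * u%:R - c)
  = \sum_(u < n) kappa_pos (2 * u%:R - c) + \sum_(u < n) kappa_pos (- (2 * u%:R - c)).
  rewrite -big_split /=; apply: eq_bigr => u _.
  rewrite /kappa /kappa_pos; set t := 2 * u%:R - c.
  case: ger0P => t0.
    by have -> : (1 <= - t) = false; [apply/negbTE; rewrite -ltNge; lra | rewrite addr0].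
  by have -> : (1 <= t) = false; [apply/negbTE; rewrite -ltNge; lra | rewrite add0r].
have rev (F : R -> R) : \sum_(u < n) F (- (2 * u%:R - c))
   = \sum_(u < n) F (2 * u%:R - (2 * n%:R - 2 - c)).
  rewrite (reindex_inj rev_ord_inj) /=; apply: eq_bigr => u _; congr F.
  by rewrite natrB ?ltn_ord // -natr1; ring.
rewrite (rev kappa_pos).
apply: (le_trans (lerD (sum_kappa_pos _ _) (sum_kappa_pos _ _))).
rewrite -(rev (fun t => (1 <= t)%R%:R)).
set a := \sum_(u < n) _; set b := \sum_(u < n) _.
have a0 : 0 <= a by rewrite sumr_ge0.
have b0 : 0 <= b by rewrite sumr_ge0.
have ab : a + b <= n%:R.
  rewrite /a /b -big_split /= -[X in _ <= X%:R]card_ord -sum1_card natr_sum ler_sum // => u _.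
  by case: (lerP 1 (2 * u%:R - c)) => h1; case: (lerP 1 (- (2 * u%:R - c))) => h2 /=; lra.
have := sqr_sqrtr (ler0n R n); have := sqrtr_ge0 (n%:R : R).
have := @sqr_sqrtr R (2 * a); have := sqrtr_ge0 (2 * a).
have := @sqr_sqrtr R (2 * b); have := sqrtr_ge0 (2 * b).
set p := Num.sqrt _; set q := Num.sqrt _; set z := Num.sqrt _.
move=> p0 /(_ ltac:(lra)) p2 q0 /(_ ltac:(lra)) q2 z0 z2.
rewrite -(@ler_pXn2r _ 2) ?nnegrE //; last 2 first; [lra|lra|].
by have := sqr_ge0 (q - p); rewrite exprMn z2 sqrrB sqrrD p2 q2; lra.
Qed.

Lemma EE_kappa l (c : R) : EE l (fun w => kappa (draw w - c)) <= 2 / Num.sqrt (2 ^ l)%:R.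
Proof.
rewrite (EE_draw l (fun x => kappa (x - c))) ler_pdivrMr ?ltr0n ?expn_gt0 //.
have s0 : 0 < Num.sqrt (2 ^ l)%:R :> R by rewrite sqrtr_gt0 ltr0n expn_gt0.
rewrite -[X in _ * X]sqr_sqrtr ?ler0n // expr2 mulrA divfK ?gt_eqF //.
under eq_bigr do rewrite -addrA -opprD.
exact: sum_kappa.
Qed.

Lemma EE_near l (c : R) : EE l (fun w => (`|draw w - c| < 1)%R%:R) <= (2 ^ l)%:R^-1 :> R.
Proof.
rewrite (EE_draw l (fun x => (`|x - c| < 1)%R%:R)) ler_pdivrMr ?ltr0n ?expn_gt0 //.
rewrite mulVf ?pnatr_eq0 ?expn_eq0 //.
under eq_bigr do rewrite -addrA -opprD.
exact: count_near.
Qed.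

End Grid.

(** * Random rounding *)

Section Rounding.
Local Open Scope ring_scope.
Variables (R : realType) (m : nat) (L : 'M[R]_m) (l : nat) (pt : 'I_m -> {set 'I_m}).
Implicit Types (W : 'M[R]_m) (P : {set 'I_m}) (D js sl ss : seq 'I_m) (xs : seq 'cV[R]_m).

Local Notation bv := (@basis_vec R m).
Local Notation Q := ((2 ^ l)%:R : R).

(** Coordinates outside [P] consume their [l] coins too, so every slot uses a block of the same
    length, whatever the partition. *)
Fixpoint rvec P js (w : seq bool) : 'cV[R]_m :=
  if js is j :: js' then
    (if j \in P then draw R (take l w) else 0) *: bv j + rvec P js' (drop l w)
  else 0.

Fixpoint xvecs sl (w : seq bool) : seq 'cV[R]_m :=
  if sl is a :: sl' then
    rvec (pt a) (enum 'I_m) (take (m * l) w) :: xvecs sl' (drop (m * l) w)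
  else [::].

Definition tot W P : R := \sum_(j in P) W j j.

(* Light indices are never picked: this makes the [l]-bit sampler below pick
   [j] with probability at most three times [W j j / tot W P]. *)
Definition heavy W P j : bool := (j \in P) && (tot W P <= Q * W j j).

Definition tot2 W P : R := \sum_(j | heavy W P j) W j j.

(** Inversion of the distribution function without rounding or division. For x = 2u - (Q - 1) the
    test says C / [tot2 W P] <= u / Q; the last heavy index passing it, [C] being the heavy weight
    before that index, is the sample. *)
Fixpoint pickf W P (x : R) js (C : R) (d : 'I_m) : 'I_m :=
  if js is j :: js' then
    if heavy W P j then
      pickf W P x js' (C + W j j) (if 2 * Q * C <= (x + Q - 1) * tot2 W P then j else d)
    else pickf W P x js' C d
  else d.

Definition pick W P (x : R) (d : 'I_m) : 'I_m := pickf W P x (enum 'I_m) 0 d.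

(** Matrix of the quadratic form of one slot, when the slots before it are already rounded to [D]
    and those after it still hold [xs]. *)
Definition residual D xs : 'M[R]_m := foldl (@elim R m) L (map bv D ++ xs).

(** A slot is named by an index [a] of its own part, which is also the fallback pick. The pick does
    not look at the vector [x] that it replaces. *)
Fixpoint rounds D sl xs (w : seq bool) : seq 'I_m :=
  match sl, xs with
  | a :: sl', x :: xs' =>
      rounds (rcons D (pick (residual D xs') (pt a) (draw R (take l w)) a)) sl' xs' (drop l w)
  | _, _ => D
  end.

Definition trial sl (w : seq bool) : seq 'I_m :=
  rounds [::] sl (xvecs sl (take (size sl * (m * l)) w)) (drop (size sl * (m * l)) w).

Definition trial_coins sl : nat := (size sl * (m * l) + size sl * l)%N.

Lemma Q_gt0 : 0 < Q. Proof. by rewrite ltr0n expn_gt0. Qed.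

Lemma draw_grid w : size w = l -> exists2 u : nat, (u < 2 ^ l)%N & draw R w = 2 * u%:R - (Q - 1).
Proof.
move=> <-; elim: w => [|c w [u ul E]]; first by exists 0%N => //; rewrite /draw /=; ring.
exists (if c then 2 ^ size w + u else u)%N.
  by rewrite /= expnS; case: c; lia.
rewrite draw_cons E /= expnS natrM; case: c; rewrite ?natrD natrX; ring.
Qed.

(** Valid for every tape and every form, degenerate ones included; this is why the output lies in
    the family with certainty and not merely with high probability. *)
Lemma pickf_mem W P x js C d : d \in P -> pickf W P x js C d \in P.
Proof.
elim: js C d => //= j js IH C d dP; case: ifP => [/andP [jP _]|_]; last exact: IH.
by apply: IH; case: ifP.
Qed.

Lemma pick_mem W P x d : d \in P -> pick W P x d \in P.
Proof. exact: pickf_mem. Qed.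

(** * Law of the sampler with finitely many coins *)

Section PickLaw.
Variables (W : 'M[R]_m) (P : {set 'I_m}).
Hypothesis W0 : forall j, 0 <= W j j.
Hypothesis T0 : 0 < tot W P.
Hypothesis PQ : (#|P| * 2 <= 2 ^ l)%N.

(** Each light index weighs less than a fraction 1/Q of the total, and there are at most Q/2 of
    them. *)
Lemma tot2_ge : tot W P / 2 <= tot2 W P.
Proof.
have E : tot W P = tot2 W P + \sum_(j in P | ~~ (tot W P <= Q * W j j)) W j j.
  by rewrite {1}/tot (bigID (fun j => tot W P <= Q * W j j)).
have : \sum_(j in P | ~~ (tot W P <= Q * W j j)) W j j <= \sum_(j in P) tot W P / Q.
  rewrite big_mkcondr /=; apply: ler_sum => j _; case: (lerP (tot W P) (Q * W j j)) => h /=.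
    by rewrite divr_ge0 // ltW // Q_gt0.
  by rewrite ler_pdivlMr ?Q_gt0 // mulrC ltW.
rewrite sumr_const -(mulr_natl _ #|P|) => H.
have h2 : #|P|%:R * (tot W P / Q) <= tot W P / 2.
  rewrite mulrA ler_pdivrMr ?Q_gt0 //.
  have : #|P|%:R * 2 <= Q by rewrite -natrM ler_nat.
  by move=> /(ler_wpM2r (ltW T0)); lra.
lra.
Qed.

Lemma pickf_done u js C d : (u < 2 ^ l)%N -> u%:R * tot2 W P < Q * C ->
  pickf W P (2 * u%:R - (Q - 1)) js C d = d.
Proof.
move=> ul; elim: js C d => //= j js IH C d uC; case: ifP => _; last exact: IH.
have -> : (2 * Q * C <= (2 * u%:R - (Q - 1) + Q - 1) * tot2 W P) = false.
  by apply/negbTE; rewrite -ltNge; nra.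
by apply: IH; have := W0 j; have := Q_gt0; nra.
Qed.

Lemma pickf_itv u js C d : (u < 2 ^ l)%N ->
  Q * C <= u%:R * tot2 W P < Q * (C + \sum_(j <- js | heavy W P j) W j j) ->
  exists j s1 s2, [/\ js = s1 ++ j :: s2, pickf W P (2 * u%:R - (Q - 1)) js C d = j,
    heavy W P j & Q * (C + \sum_(i <- s1 | heavy W P i) W i i) <= u%:R * tot2 W P
      < Q * (C + \sum_(i <- s1 | heavy W P i) W i i + W j j)].
Proof.
move=> ul; elim: js C d => [|j js IH] C d.
  by rewrite big_nil addr0 => /andP [h1 h2]; lra.
rewrite big_cons /=; case: ifP => [hj|nj] /andP [h1 h2].
  have -> : 2 * Q * C <= (2 * u%:R - (Q - 1) + Q - 1) * tot2 W P by nra.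
  case: (ltP (u%:R * tot2 W P) (Q * (C + W j j))) => h3.
    exists j, [::], js; rewrite pickf_done // big_nil addr0 h1; split => //.
  have [|i [s1 [s2 [-> -> hi hb]]]] := IH (C + W j j) j.
    by rewrite h3 /=; move: h2; rewrite addrA.
  by exists i, (j :: s1), s2; rewrite big_cons hj addrA.
have [|i [s1 [s2 [-> -> hi hb]]]] := IH C d; first by rewrite h1.
by exists i, (j :: s1), s2; rewrite big_cons nj.
Qed.

Definition before (j : 'I_m) : R :=
  \sum_(i <- take (index j (enum 'I_m)) (enum 'I_m) | heavy W P i) W i i.

Lemma pick_itv u d : (u < 2 ^ l)%N ->
  let j := pick W P (2 * u%:R - (Q - 1)) d in
  heavy W P j && (Q * before j / tot2 W P <= u%:R < Q * before j / tot2 W P + Q * W j j / tot2 W P).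
Proof.
move=> ul; have t2 : 0 < tot2 W P by apply: lt_le_trans tot2_ge; rewrite divr_gt0.
have [|j [s1 [s2 [E pE hj hb]]]] := @pickf_itv u (enum 'I_m) 0 d ul.
  rewrite mulr0 add0r big_enum_cond /= -/(tot2 W P) mulr_ge0 ?ler0n ?(ltW t2) //=.
  by rewrite ltr_pM2r // ltr_nat.
have bE : before j = \sum_(i <- s1 | heavy W P i) W i i.
  rewrite /before E index_cat.
  have : uniq (s1 ++ j :: s2) by rewrite -E enum_uniq.
  rewrite cat_uniq /= negb_or => /and3P [_ /andP [/negPf -> _] _].
  by rewrite /= eqxx addn0 take_size_cat.
rewrite /pick pE bE hj /= -mulrDl -mulrDr ler_pdivrMr // ltr_pdivlMr //.
by move: hb; rewrite !add0r.
Qed.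

(** Index j is picked on an interval of length Q W_jj / [tot2], at most 2 Q W_jj / [tot] by
    [tot2_ge]. It contains at most one grid point more than its length, and for a heavy j that extra
    1 is at most Q W_jj / [tot]. This makes the factor 3. *)
Lemma EE_pick (h : 'I_m -> R) d : (forall j, 0 <= h j) ->
  EE l (fun w => h (pick W P (draw R w) d)) <= \sum_(j in P) 3 * (W j j / tot W P) * h j.
Proof.
move=> h0; have t2 : 0 < tot2 W P by apply: lt_le_trans tot2_ge; rewrite divr_gt0.
rewrite (EE_draw l (fun x => h (pick W P x d))) ler_pdivrMr ?Q_gt0 //.
pose a j := Q * before j / tot2 W P; pose b j := Q * W j j / tot2 W P.
apply: (@le_trans _ _ (\sum_(u < 2 ^ l) \sum_(j | heavy W P j)
   (a j <= u%:R < a j + b j)%R%:R * h j)).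
  apply: ler_sum => u _; have /= := pick_itv d (ltn_ord u).
  set j := pick _ _ _ _ => /andP [hj ij].
  rewrite (bigD1 j) //= ij mul1r lerDl; apply: sumr_ge0 => i _.
  by rewrite mulr_ge0.
rewrite exchange_big /= mulr_suml.
rewrite [X in _ <= X](bigID (fun j => tot W P <= Q * W j j)) /=.
rewrite -[X in X <= _]addr0; apply: lerD; last first.
  apply: sumr_ge0 => j _; rewrite !mulr_ge0 ?ler0n // invr_ge0; exact: ltW.
apply: ler_sum => j /andP [_ hj]; rewrite -mulr_suml.
rewrite [X in _ <= X]mulrAC ler_wpM2r //.
have b0 : 0 <= b j by rewrite /b divr_ge0 ?mulr_ge0 ?ler0n // ltW.
apply: (le_trans (count_itv _ _ b0)).
have h1 : 1 <= W j j / tot W P * Q by rewrite mulrAC ler_pdivlMr // mul1r mulrC.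
have h2 : b j <= 2 * (W j j / tot W P) * Q.
  rewrite /b ler_pdivrMr //.
  have -> : 2 * (W j j / tot W P) * Q * tot2 W P = Q * W j j * (2 * tot2 W P / tot W P) by ring.
  rewrite ler_peMr ?mulr_ge0 // ler_pdivlMr // mul1r.
  by have := tot2_ge; lra.
lra.
Qed.

Lemma pick_pos w d : size w = l -> pick W P (draw R w) d \in P /\
  0 < W (pick W P (draw R w) d) (pick W P (draw R w) d).
Proof.
move=> sw; have [u ul ->] := draw_grid sw.
have /= /andP [/andP [-> hj] _] := pick_itv d ul; split=> //.
rewrite -(pmulr_rgt0 _ Q_gt0); exact: lt_le_trans hj.
Qed.

End PickLaw.

(** Independent centred coordinates: cross terms vanish and only the trace on [P] survives. The
    shift [z] collects the coordinates already drawn. *)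
Lemma EE_quad W P js z :
  EE (size js * l) (fun w => bil W (rvec P js w + z) (rvec P js w + z))
   = (4 ^+ l - 1) / 3 * (\sum_(j <- js | j \in P) W j j) + bil W z z.
Proof.
elim: js z => [|j js IH] z /=; first by rewrite big_nil add0r mulr0 add0r.
rewrite mulSn EE_cat.
rewrite (eq_EE (g := fun w1 => (4 ^+ l - 1) / 3 * (\sum_(j <- js | j \in P) W j j)
   + bil W ((if j \in P then draw R w1 else 0) *: bv j + z)
           ((if j \in P then draw R w1 else 0) *: bv j + z))); last first.
  move=> w1 sw1; rewrite -IH; apply: eq_EE => w2 _.
  rewrite take_size_cat // drop_size_cat //; congr (bil W _ _);
    by rewrite addrAC addrC.
rewrite big_cons; case: ifP => jP; last by rewrite EE_cst scale0r add0r.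
set s := \sum_(_ <- _ | _) _; set v := (4 ^+ l - 1) / 3.
have -> : v * (W j j + s) + bil W z z = W j j * v + (bil W z z + v * s) by ring.
rewrite -(draw_moments l (W j j) (bil W (bv j) z + bil W z (bv j)) (bil W z z + v * s)).
apply: eq_EE => w _; rewrite !(bilDl, bilDr, bilZl, bilZr) bil_basis; ring.
Qed.

(** Given all other coordinates, the quotient is the j-th coordinate plus a constant, so a bound on
    the mean of [F] that is uniform in the shift carries over. This is the independence behind
    completing the square. *)
Lemma EE_coord W P js z j (F : R -> R) K : j \in P -> j \in js -> W j j != 0 ->
  (forall c, EE l (fun w => F (draw R w - c)) <= K) ->
  EE (size js * l) (fun w => F (bil W (bv j) (rvec P js w + z) / W j j)) <= K.
Proof.
move=> jP + Wj FK; elim: js z => //= i js IH z; rewrite inE mulSn EE_cat.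
case: eqVneq => [<- _|ij /= jjs].
  rewrite EE_exchange -(EE_cst (size js * l) K); apply: le_EE => w2 _.
  rewrite (eq_EE (g := fun w => F (draw R w - (- (bil W (bv j) (rvec P js w2 + z) / W j j))))) //.
  move=> w1 sw1; rewrite take_size_cat // drop_size_cat // jP; congr F.
  by rewrite -addrA [in LHS]bilDr bilZr bil_basis opprK mulrDl mulfK.
rewrite -(EE_cst l K); apply: le_EE => w1 sw1.
rewrite (eq_EE (g := fun w2 => F (bil W (bv j) (rvec P js w2 +
   ((if i \in P then draw R w1 else 0) *: bv i + z)) / W j j))); first exact: IH.
move=> w2 _; rewrite take_size_cat // drop_size_cat //; congr (F (bil _ _ _ / _)).
by rewrite addrAC addrC.
Qed.

Lemma bil_rvec_eq0 W P js w : psd W -> tot W P = 0 -> forall y, bil W y (rvec P js w) = 0.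
Proof.
move=> pW T0 y.
have Wd j : 0 <= W j j by rewrite -bil_basis psd_bil_ge0.
have z j : j \in P -> W j j = 0.
  by move=> jP; have /psumr_eq0P := T0; apply.
elim: js w => [|j js IH] w /=; first by rewrite /bil mulmx0 mxE.
rewrite bilDr IH addr0 bilZr; case: ifP => jP; last by rewrite mul0r.
by rewrite psd_bil_ker ?mulr0 // bil_basis z.
Qed.

(** * Mean of the determinant ratio, and anti-concentration *)

Hypothesis pL : psd L.

Lemma psd_residual D xs : psd (residual D xs). Proof. exact: psd_foldl. Qed.

Lemma diag_residual_ge0 D xs j : 0 <= residual D xs j j.
Proof. rewrite -bil_basis; exact/psd_bil_ge0/psd_residual. Qed.

Definition mvol D xs : R := vol L (map bv D ++ xs).

Lemma mvol_ge0 D xs : 0 <= mvol D xs. Proof. exact: vol_ge0. Qed.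

Lemma mvol_cons D x xs : mvol D (x :: xs) = mvol D xs * bil (residual D xs) x x.
Proof. exact: vol_mid. Qed.

Lemma mvol_rcons D j xs : mvol (rcons D j) xs = mvol D xs * residual D xs j j.
Proof. by rewrite /mvol map_rcons cat_rcons vol_mid // bil_basis. Qed.

(** Mean over the rounding coins only, [xs] being fixed. Outcomes of value 0 contribute 0; by
    [rounds_pos] they do not occur when the starting determinant is positive. *)
Definition inv_mean D sl xs : R :=
  EE (size sl * l) (fun w => (mvol (rounds D sl xs w) [::])^-1).

Lemma inv_mean_ge0 D sl xs : 0 <= inv_mean D sl xs.
Proof. by apply: EE_ge0 => w _; rewrite invr_ge0 mvol_ge0. Qed.

Hypothesis ptQ : forall a, (#|pt a| * 2 <= 2 ^ l)%N.

(** The sampling weight W_jj is precisely the factor by which [mvol (rcons D j) xs] exceeds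
    [mvol D xs]. The weights cancel, the sum over the part becomes unweighted, and each slot costs
    the size of its part only once. *)
Lemma inv_mean_cons D a sl js w xs x W :
  x = rvec (pt a) js w -> W = residual D xs ->
  inv_mean D (a :: sl) (x :: xs) * mvol D (x :: xs) <=
  3 * (bil W x x / tot W (pt a)) * \sum_(j in pt a) (inv_mean (rcons D j) sl xs * mvol (rcons D j) xs).
Proof.
move=> xE WE; rewrite mvol_cons -WE.
have pW : psd W by rewrite WE; exact: psd_residual.
have Wd j : 0 <= W j j by rewrite WE diag_residual_ge0.
case: (eqVneq (tot W (pt a)) 0) => [T0|T0].
  by rewrite xE bil_rvec_eq0 // !mulr0 mul0r mulr0 mul0r.
have {}T0 : 0 < tot W (pt a) by rewrite lt0r T0 sumr_ge0.
rewrite {1}/inv_mean /= mulSn EE_cat.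
set h := fun j => inv_mean (rcons D j) sl xs.
rewrite (eq_EE (g := fun w1 => h (pick W (pt a) (draw R w1) a))); last first.
  move=> w1 sw1; apply: eq_EE => w2 _.
  by rewrite take_size_cat // drop_size_cat // -WE.
have h0 j : 0 <= h j by apply: inv_mean_ge0.
apply: (le_trans (ler_wpM2r _ (EE_pick Wd T0 (ptQ a) a h0))).
  by rewrite mulr_ge0 ?mvol_ge0 ?psd_bil_ge0.
rewrite mulr_suml mulr_sumr; apply: ler_sum => j _.
rewrite mvol_rcons -WE /h le_eqVlt; apply/orP; left; apply/eqP; ring.
Qed.

(** The first vector is averaged innermost, with the later ones fixed, so the form [W] of its slot
    is a constant. By [EE_quad] the mean of its value is the trace times (Q^2 - 1) / 3; the trace
    cancels the denominator of the sampling probabilities and the 3 cancels that of [EE_pick]. *)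
Lemma EE_ratio D sl :
  EE (size sl * (m * l)) (fun w => inv_mean D sl (xvecs sl w) * mvol D (xvecs sl w))
    <= \prod_(a <- sl) (Q ^+ 2 * #|pt a|%:R).
Proof.
elim: sl D => [|a sl IH] D.
  rewrite big_nil /= /inv_mean /=.
  by case: (eqVneq (mvol D [::]) 0) => [->|?]; rewrite ?mulr0 ?mulVf.
rewrite big_cons /= mulSn EE_cat EE_exchange.
set K := \prod_(a <- sl) _ in IH *.
pose v : R := (4 ^+ l - 1) / 3.
have v0 : 0 <= v by rewrite divr_ge0 ?ler0n // subr_ge0 exprn_ege1 // ler1n.
have vQ : 3 * v <= Q ^+ 2.
  have -> : Q ^+ 2 = 4 ^+ l by rewrite natrX -exprM mulnC exprM -natrX.
  by rewrite /v; lra.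
apply: (@le_trans _ _ (EE (size sl * (m * l)) (fun w2 => 3 * v *
   \sum_(j in pt a) (inv_mean (rcons D j) sl (xvecs sl w2) * mvol (rcons D j) (xvecs sl w2))))).
  apply: le_EE => w2 _; set xs := xvecs sl w2; set W := residual D xs.
  set s := \sum_(j in pt a) _.
  have s0 : 0 <= s by apply: sumr_ge0 => j _; rewrite mulr_ge0 ?inv_mean_ge0 ?mvol_ge0.
  apply: (@le_trans _ _ (EE (m * l) (fun w1 =>
      bil W (rvec (pt a) (enum 'I_m) w1) (rvec (pt a) (enum 'I_m) w1) * (3 / tot W (pt a) * s)))).
    apply: le_EE => w1 sw1; rewrite take_size_cat // drop_size_cat //.
    apply: (le_trans (@inv_mean_cons D a sl (enum 'I_m) w1 xs _ W erefl erefl)).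
    rewrite le_eqVlt; apply/orP; left; apply/eqP; rewrite /s /W /xs; ring.
  rewrite EEZr.
  have := EE_quad W (pt a) (enum 'I_m) 0.
  rewrite size_enum_ord bil0l addr0 big_enum_cond /=.
  rewrite (eq_EE (g := fun w => bil W (rvec (pt a) (enum 'I_m) w) (rvec (pt a) (enum 'I_m) w))); last first.
    by move=> w _; rewrite addr0.
  move=> ->; rewrite -/v -/(tot W (pt a)).
  case: (eqVneq (tot W (pt a)) 0) => [->|T0].
    by rewrite mulr0 mul0r; apply: mulr_ge0 => //; apply: mulr_ge0.
  by rewrite le_eqVlt; apply/orP; left; apply/eqP; field.
rewrite EEZ EE_sum.
apply: (@le_trans _ _ (3 * v * \sum_(j in pt a) K)).
  by apply: ler_wpM2l; [exact: mulr_ge0 | apply: ler_sum].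
rewrite sumr_const -(mulr_natl _ #|pt a|) -[X in _ <= X]mulrA; apply: ler_wpM2r => //.
by rewrite mulr_ge0 // prodr_ge0 // => i _; rewrite mulr_ge0 // exprn_ge0.
Qed.

(** The shifted coordinate t_k: for a positive pivot, the form at [x] equals W_ss t^2 plus the Schur
    complement at [x]. *)
Definition tval D s (x : 'cV[R]_m) xs : R := bil (residual D xs) (bv s) x / residual D xs s s.

Fixpoint kprod D ss xs : R :=
  match ss, xs with
  | s :: ss', x :: xs' => kappa (tval D s x xs') * kprod (rcons D s) ss' xs'
  | _, _ => 1
  end.

(** A zero pivot is excluded from the count, since it gives t = 0 with certainty and would spoil the
    mean. Nothing is lost: in [mvol_good] the pivots are positive. *)
Fixpoint bads D ss xs : R :=
  match ss, xs with
  | s :: ss', x :: xs' =>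
      ((residual D xs' s s != 0) && (`|tval D s x xs'| < 1))%R%:R + bads (rcons D s) ss' xs'
  | _, _ => 0
  end.

Lemma kprod_ge0 D ss xs : 0 <= kprod D ss xs.
Proof.
elim: ss D xs => [|s ss IH] D [|x xs] //=; rewrite mulr_ge0 // kappa_ge0 //.
Qed.

Lemma bads_ge0 D ss xs : 0 <= bads D ss xs.
Proof. elim: ss D xs => [|s ss IH] D [|x xs] //=; exact: addr_ge0. Qed.

(** Trading the basis vector of [s] for [x] turns the factor W_ss into the form at [x], which is at
    least W_ss t^2 by Cauchy-Schwarz, and t^2 = [kappa]^-4. Positivity is carried along from the
    optimal solution, so every pivot met is positive. *)
Lemma mvol_good D ss xs : size ss = size xs -> bads D ss xs < 1 ->
  0 < mvol (D ++ ss) [::] ->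
  0 < mvol D xs /\ mvol (D ++ ss) [::] <= kprod D ss xs ^+ 4 * mvol D xs.
Proof.
elim: ss D xs => [|s ss IH] D [|x xs] //= => [_ _ h|[sz] hb h].
  by move: h; rewrite cats0 => h; rewrite expr1n mul1r.
have b0 := bads_ge0 (rcons D s) ss xs.
have := IH (rcons D s) xs sz; rewrite cat_rcons => {}IH.
have [|h1 h2] := IH _ h.
  by move: hb; case: (_ && _); rewrite /=; lra.
move: h1 h2; rewrite mvol_rcons mvol_cons; set W := residual D xs => h1 h2.
have V0 := mvol_ge0 D xs; have W0 := diag_residual_ge0 D xs s.
have V0' : 0 < mvol D xs.
  by rewrite lt0r V0 andbT; apply: contraTneq h1 => ->; rewrite mul0r ltxx.
have W0' : 0 < W s s.
  by rewrite lt0r W0 andbT; apply: contraTneq h1 => ->; rewrite mulr0 ltxx.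
have t1 : 1 <= `|tval D s x xs|.
  rewrite leNgt; apply/negP => tn; move: hb; rewrite tn gt_eqF //=.
  by rewrite -[X in _ < X]addr0 ltrD2l ltNge b0.
have pW : psd W := psd_residual _ _.
have CS : W s s * tval D s x xs ^+ 2 <= bil W x x.
  have -> : W s s * tval D s x xs ^+ 2 = bil W (bv s) x ^+ 2 / W s s.
    by rewrite /tval -/W; field; rewrite gt_eqF.
  by rewrite ler_pdivrMr // mulrC -[W s s]bil_basis psd_CS.
have tp : 0 < tval D s x xs ^+ 2 by rewrite exprn_even_gt0 //= -normr_gt0; exact: lt_le_trans t1.
split.
  by rewrite mulr_gt0 //; apply: lt_le_trans CS; rewrite mulr_gt0.
apply: (le_trans h2); rewrite exprMn.
have k4 := kappa4 t1; set k := kappa _ in k4 *; set t := tval D s x xs in k4 CS.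
have -> : kprod (rcons D s) ss xs ^+ 4 * (mvol D xs * W s s)
   = (k ^+ 4 * kprod (rcons D s) ss xs ^+ 4 * mvol D xs) * (W s s * t ^+ 2).
  rewrite -[LHS]mulr1 -k4; ring.
rewrite [X in _ <= X]mulrA ler_wpM2l // mulr_ge0 // -exprMn exprn_ge0 //.
by rewrite mulr_ge0 ?kappa_ge0 ?kprod_ge0.
Qed.

Lemma EE_kprod D sl ss : all2 (fun a s => s \in pt a) sl ss ->
  EE (size sl * (m * l)) (fun w => kprod D ss (xvecs sl w)) <= (2 / Num.sqrt Q) ^+ size sl.
Proof.
elim: sl ss D => [|a sl IH] [|s ss] D //= /andP [sP al].
rewrite mulSn EE_cat EE_exchange exprS.
have K0 : 0 <= 2 / Num.sqrt Q by rewrite divr_ge0 // sqrtr_ge0.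
apply: (@le_trans _ _ (EE (size sl * (m * l)) (fun w2 =>
    2 / Num.sqrt Q * kprod (rcons D s) ss (xvecs sl w2)))); last first.
  by rewrite EEZ ler_wpM2l // IH.
apply: le_EE => w2 _.
rewrite (eq_EE (g := fun w1 => kappa (tval D s (rvec (pt a) (enum 'I_m) w1 + 0) (xvecs sl w2))
   * kprod (rcons D s) ss (xvecs sl w2))); last first.
  by move=> w1 sw1; rewrite take_size_cat // drop_size_cat // addr0.
rewrite EEZr ler_wpM2r ?kprod_ge0 // /tval.
(* A zero pivot makes [tval] equal to 0, where [kappa] is 0 by its cut-off. *)
case: (eqVneq (residual D (xvecs sl w2) s s) 0) => [->|W0].
  rewrite (eq_EE (g := fun=> 0)) ?EE_cst // => w _.
  by rewrite invr0 mulr0 /kappa normr0 leNgt ltr01.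
have := @EE_coord (residual D (xvecs sl w2)) (pt a) (enum 'I_m) 0 s (@kappa R) (2 / Num.sqrt Q).
rewrite size_enum_ord; apply => //; first by rewrite mem_enum.
exact: EE_kappa.
Qed.

Lemma EE_bads D sl ss : all2 (fun a s => s \in pt a) sl ss ->
  EE (size sl * (m * l)) (fun w => bads D ss (xvecs sl w)) <= (size sl)%:R / Q.
Proof.
elim: sl ss D => [|a sl IH] [|s ss] D //=; first by rewrite mul0r.
move=> /andP [sP al].
rewrite mulSn EE_cat EE_exchange.
apply: (@le_trans _ _ (EE (size sl * (m * l)) (fun w2 =>
    Q^-1 + bads (rcons D s) ss (xvecs sl w2)))); last first.
  by rewrite EED EE_cst -natr1 mulrDl mul1r addrC lerD2r IH.
apply: le_EE => w2 _.
rewrite (eq_EE (g := fun w1 => ((residual D (xvecs sl w2) s s != 0) &&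
   (`|tval D s (rvec (pt a) (enum 'I_m) w1 + 0) (xvecs sl w2)| < 1))%R%:R
   + bads (rcons D s) ss (xvecs sl w2))); last first.
  by move=> w1 sw1; rewrite take_size_cat // drop_size_cat // addr0.
rewrite EED EE_cst lerD2r /tval.
case: (eqVneq (residual D (xvecs sl w2) s s) 0) => [_|W0] /=.
  by rewrite EE_cst invr_ge0 ltW // Q_gt0.
have := @EE_coord (residual D (xvecs sl w2)) (pt a) (enum 'I_m) 0 s
  (fun t => (`|t| < 1)%R%:R) Q^-1.
rewrite size_enum_ord; apply => //; first by rewrite mem_enum.
exact: EE_near.
Qed.

Lemma size_xvecs sl w : size (xvecs sl w) = size sl.
Proof. by elim: sl w => //= a sl IH w; rewrite IH. Qed.

(** A positive determinant forces a positive trace on the part of the slot, and then the sampler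
    returns a heavy index, whose diagonal entry is positive. *)
Lemma rounds_pos D sl w1 w2 : size w2 = (size sl * l)%N ->
  0 < mvol D (xvecs sl w1) -> 0 < mvol (rounds D sl (xvecs sl w1) w2) [::].
Proof.
elim: sl D w1 w2 => [|a sl IH] D w1 w2 //=; rewrite mulSn => sw2.
rewrite mvol_cons; set xs := xvecs sl _; set W := residual D xs; set x := rvec _ _ _ => h.
have V0 := mvol_ge0 D xs; have pW : psd W := psd_residual _ _.
have Wd := diag_residual_ge0 D xs.
have V0' : 0 < mvol D xs.
  by rewrite lt0r V0 andbT; apply: contraTneq h => ->; rewrite mul0r ltxx.
have T0 : 0 < tot W (pt a).
  rewrite lt0r sumr_ge0 // andbT; apply: contraTneq h => T0.
  by rewrite /x bil_rvec_eq0 // mulr0 ltxx.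
apply: IH; first by rewrite size_drop sw2 addKn.
rewrite mvol_rcons mulr_gt0 //.
by have [] := pick_pos Wd T0 (ptQ a) (w := take l w2) a; first by rewrite size_take sw2; case: ltnP; lia.
Qed.

Lemma amgm5 (a b : R) : 0 <= a -> 0 <= b -> (4 * a + b) / 5 < 11 / 10 ->
  a ^+ 4 * b <= (11 / 10) ^+ 5.
Proof.
move=> a0 b0 s1; set s := (4 * a + b) / 5 in s1.
have s0 : 0 <= s by rewrite /s; lra.
have -> : b = 5 * s - 4 * a by rewrite /s; field.
apply: (@le_trans _ _ (s ^+ 5)); last first.
  by rewrite ler_pXn2r ?nnegrE //; [exact: ltW | lra].
rewrite -subr_ge0.
(* The difference has a double root at s = a, the case of equality, and a cofactor with nonnegative
   coefficients. *)
have -> : s ^+ 5 - a ^+ 4 * (5 * s - 4 * a) = (s - a) ^+ 2 *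
   (s ^+ 3 + 2 * a * s ^+ 2 + 3 * a ^+ 2 * s + 4 * a ^+ 3) by ring.
move: s0; move: s {s1} => s s0.
by rewrite mulr_ge0 ?sqr_ge0 // !(addr_ge0, mulr_ge0, exprn_ge0).
Qed.

(* The cost is small in expectation, and a cost below 1 forces success: then
   no [tval] is small, and weighted AM-GM turns the bound on the mean of the two
   normalised ratios into a bound on their product. *)
Definition cost sl ss (w : seq bool) : R :=
  let xs := xvecs sl (take (size sl * (m * l)) w) in
  (4 * (kprod [::] ss xs / (2 / Num.sqrt Q) ^+ size sl)
   + mvol [::] xs / mvol (trial sl w) [::] / \prod_(a <- sl) (Q ^+ 2 * #|pt a|%:R)) / 5 / (11 / 10)
  + bads [::] ss xs.

(** Both ratios are normalised to mean at most 1, so their weighted mean divided by 11/10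
    contributes 10/11, and each slot adds at most 1/Q for its atom. *)
Lemma EE_cost sl ss : all2 (fun a s => s \in pt a) sl ss ->
  EE (trial_coins sl) (cost sl ss) <= 10 / 11 + (size sl)%:R / Q.
Proof.
move=> al; have pp a : a \in sl -> (0 < #|pt a|)%N.
  elim: sl ss al => // b sl IH [|s ss] //= /andP [sb al]; rewrite inE => /orP [/eqP ->|].
    by apply/card_gt0P; exists s.
  exact: IH al.
set K1 := (2 / Num.sqrt Q) ^+ size sl; set K2 := \prod_(a <- sl) (Q ^+ 2 * #|pt a|%:R).
have K1p : 0 < K1 by rewrite exprn_gt0 // divr_gt0 // sqrtr_gt0 Q_gt0.
have K2p : 0 < K2.
  rewrite /K2 big_seq; apply: prodr_gt0 => a asl.
  by rewrite mulr_gt0 ?exprn_gt0 ?Q_gt0 // ltr0n pp.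
have h1 := EE_kprod [::] al; have h2 := EE_ratio [::] sl; have h3 := EE_bads [::] al.
rewrite -/K1 -/K2 in h1 h2.
rewrite EE_cat.
rewrite (eq_EE (g := fun w1 => 8 / 11 / K1 * kprod [::] ss (xvecs sl w1)
  + (2 / 11 / K2 * (inv_mean [::] sl (xvecs sl w1) * mvol [::] (xvecs sl w1))
     + bads [::] ss (xvecs sl w1)))); last first.
  move=> w1 sw1; rewrite /cost /trial.
  rewrite (eq_EE (g := fun w2 => (8 / 11 / K1 * kprod [::] ss (xvecs sl w1) + bads [::] ss (xvecs sl w1))
    + 2 / 11 / K2 * mvol [::] (xvecs sl w1) * (mvol (rounds [::] sl (xvecs sl w1) w2) [::])^-1)); last first.
    move=> w2 sw2; rewrite take_size_cat // drop_size_cat // -/K1 -/K2.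
    by set I := (mvol (rounds _ _ _ _) _)^-1; field; rewrite !gt_eqF.
  rewrite EED EE_cst EEZ -/(inv_mean _ _ _); ring.
rewrite !EED !EEZ.
have e1 : 8 / 11 / K1 * EE (size sl * (m * l)) (fun w => kprod [::] ss (xvecs sl w)) <= 8 / 11.
  by rewrite -[8 / 11 / K1 * _]mulrA; apply: ler_piMr; [lra | rewrite mulrC ler_pdivrMr // mul1r].
have e2 : 2 / 11 / K2 * EE (size sl * (m * l)) (fun w => inv_mean [::] sl (xvecs sl w) * mvol [::] (xvecs sl w)) <= 2 / 11.
  by rewrite -[2 / 11 / K2 * _]mulrA; apply: ler_piMr; [lra | rewrite mulrC ler_pdivrMr // mul1r].
lra.
Qed.

Lemma cost_good sl ss w : all2 (fun a s => s \in pt a) sl ss -> size w = trial_coins sl ->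
  0 < mvol ss [::] -> cost sl ss w < 1 ->
  mvol ss [::] <= (11 / 10) ^+ 5 * 16 ^+ size sl * (\prod_(a <- sl) #|pt a|%:R) * mvol (trial sl w) [::].
Proof.
move=> al sw V0; rewrite /cost; set xs := xvecs _ _.
set K1 := (2 / Num.sqrt Q) ^+ size sl; set K2 := \prod_(a <- sl) (Q ^+ 2 * #|pt a|%:R).
have pp a : a \in sl -> (0 < #|pt a|)%N.
  move: {V0 K1 K2 xs w sw} ss al; elim: sl => // b sl IH [|s ss] //= /andP [sb al]; rewrite inE => /orP [/eqP ->|].
    by apply/card_gt0P; exists s.
  exact: IH al.
have K1p : 0 < K1 by rewrite exprn_gt0 // divr_gt0 // sqrtr_gt0 Q_gt0.
have K2p : 0 < K2.
  rewrite /K2 big_seq; apply: prodr_gt0 => a asl.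
  by rewrite mulr_gt0 ?exprn_gt0 ?Q_gt0 // ltr0n pp.
have b0 := bads_ge0 [::] ss xs.
have k0 := kprod_ge0 [::] ss xs.
have g0 := mvol_ge0 [::] xs; have t0 := mvol_ge0 (trial sl w) [::].
set al1 := kprod _ _ _ / K1; set be := _ / _ / K2 => c1.
have al0 : 0 <= al1 by rewrite divr_ge0 // ltW.
have be0 : 0 <= be by rewrite !divr_ge0 // ltW.
have sz : size ss = size xs by rewrite size_xvecs; move: al; rewrite all2E => /andP [/eqP].
have [|//|G0 G1] := mvol_good sz (D := [::]).
  by have : 0 <= (4 * al1 + be) / 5 / (11 / 10); [rewrite !divr_ge0 // addr_ge0 // mulr_ge0|lra].
have tp : 0 < mvol (trial sl w) [::].
  by apply: rounds_pos => //; rewrite size_drop sw addKn.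
have am : al1 ^+ 4 * be <= (11 / 10) ^+ 5 by apply: amgm5 => //; lra.
apply: (le_trans G1).
have -> : kprod [::] ss xs ^+ 4 * mvol [::] xs
   = (al1 ^+ 4 * be) * (K1 ^+ 4 * K2) * mvol (trial sl w) [::].
  by rewrite /al1 /be; field; rewrite !gt_eqF.
rewrite ler_wpM2r // -[X in _ <= X]mulrA.
(* The grid size disappears: (2 / sqrt Q)^4 = 16 / Q^2 meets the Q^2 of each slot. *)
have -> : K1 ^+ 4 * K2 = 16 ^+ size sl * \prod_(a <- sl) #|pt a|%:R.
  rewrite /K2 big_split /= big_const_seq count_predT iter_mulr_1 mulrA; congr (_ * _).
  rewrite /K1 -exprM mulnC exprM -exprMn; congr (_ ^+ _).
  rewrite exprMn exprVn (exprM (Num.sqrt Q) 2 2) sqr_sqrtr ?(ltW Q_gt0) //.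
  rewrite divfK; first by ring.
  by rewrite expf_neq0 // gt_eqF // Q_gt0.
by rewrite ler_wpM2r // mulr_ge0 ?exprn_ge0 // prodr_ge0.
Qed.

End Rounding.

(** * A program logic with step bounds *)

Section ProgramLogic.
Local Open Scope ring_scope.
Variable R : realType.
Implicit Types (s : state R) (Q : state R -> Prop).

Definition iset s a i j v : state R := State (update (imem s) a i j v) (rmem s) (coins s).
Definition rset s a i j v : state R := State (imem s) (update (rmem s) a i j v) (coins s).

(** Total correctness within [B] steps. The continuation [k] is arbitrary, which makes the
    sequencing rule compositional. Coins belong to the state, so the logic is deterministic and
    probability enters only afterwards. *)
Definition wp p (B : nat) Q s : Prop :=
  exists s' n, [/\ (n <= B)%N,
    forall k, iter n (@step R) (p :: k, s) = (k, s') & Q s'].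

Lemma wp_mono p B B' Q Q' s : (B <= B')%N -> (forall s', Q s' -> Q' s') ->
  wp p B Q s -> wp p B' Q' s.
Proof.
move=> BB QQ [s' [n [nB st /QQ ?]]]; exists s', n; split=> //; exact: leq_trans BB.
Qed.

Lemma wp_post p B Q Q' s : wp p B Q s -> (forall s', Q s' -> Q' s') -> wp p B Q' s.
Proof. by move=> h QQ; apply: wp_mono h. Qed.

Lemma wp_skip Q s : Q s -> wp Skip 1 Q s.
Proof. by exists s, 1%N. Qed.

Lemma wp_iassign a i j e Q s :
  Q (iset s a (ieval s i) (ieval s j) (ieval s e)) -> wp (IAssign a i j e) 1 Q s.
Proof. by move=> h; eexists _, 1%N. Qed.

Lemma wp_rassign a i j e Q s :
  Q (rset s a (ieval s i) (ieval s j) (reval s e)) -> wp (RAssign a i j e) 1 Q s.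
Proof. by move=> h; eexists _, 1%N. Qed.

Lemma wp_flip a i j Q s :
  Q (State (update (imem s) a (ieval s i) (ieval s j) (head false (coins s) : nat))
       (rmem s) (behead (coins s))) -> wp (Flip a i j) 1 Q s.
Proof. by move=> h; eexists _, 1%N. Qed.

Definition seq_time (B1 B2 : nat) : nat := (B1 + B2).+1.
Definition if_time (B1 B2 : nat) : nat := (maxn B1 B2).+1.

Lemma wp_seq p1 p2 B1 B2 Q s :
  wp p1 B1 (fun s1 => wp p2 B2 Q s1) s -> wp (Seq p1 p2) (seq_time B1 B2) Q s.
Proof.
move=> [s1 [n1 [nB1 st1 [s2 [n2 [nB2 st2 q]]]]]]; exists s2, (n2 + n1).+1; split=> //.
  by rewrite ltnS addnC leq_add.
by move=> k; rewrite iterSr /= iterD st1 st2.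
Qed.

Lemma wp_if b p1 p2 B1 B2 Q s :
  (teval s b -> wp p1 B1 Q s) -> (~~ teval s b -> wp p2 B2 Q s) ->
  wp (If b p1 p2) (if_time B1 B2) Q s.
Proof.
move=> h1 h2; case: (boolP (teval s b)) => hb.
  have [s' [n [nB st q]]] := h1 hb; exists s', n.+1; split=> //.
    by rewrite ltnS leq_max nB.
  by move=> k; rewrite iterSr /= hb st.
have [s' [n [nB st q]]] := h2 hb; exists s', n.+1; split=> //.
  by rewrite ltnS leq_max nB orbT.
by move=> k; rewrite iterSr /= (negPf hb) st.
Qed.

Definition cell a : iexp := ICell a (IConst 0) (IConst 0).
Definition rcell a : rexp := RCell a (IConst 0) (IConst 0).

(** The test v + 1 <= e expresses v < e, comparison being the only test on naturals. The bound is
    evaluated anew at each round, so users show that the body preserves it. *)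
Definition For v (e : iexp) body : prog :=
  Seq (IAssign v (IConst 0) (IConst 0) (IConst 0))
    (While (ILe (IAdd (cell v) (IConst 1)) e)
      (Seq body (IAssign v (IConst 0) (IConst 0) (IAdd (cell v) (IConst 1))))).

Definition for_time n B : nat := (n * (B + 4) + 4)%N.

Lemma wp_for v e body n B (I : nat -> state R -> Prop) Q s :
  I 0%N (iset s v 0 0 0) ->
  (forall i s', I i s' -> imem s' v 0 0 = i /\ ieval s' e = n) ->
  (forall i s', (i < n)%N -> I i s' ->
     wp body B (fun s1 => imem s1 v 0 0 = i /\ I i.+1 (iset s1 v 0 0 i.+1)) s') ->
  (forall s', I n s' -> Q s') ->
  wp (For v e body) (for_time n B) Q s.
Proof.
move=> I0 Iv Ib IQ.
pose W := While (ILe (IAdd (cell v) (IConst 1)) e)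
  (Seq body (IAssign v (IConst 0) (IConst 0) (IAdd (cell v) (IConst 1)))).
have loop d i s' : (i + d = n)%N -> I i s' -> wp W (d * (B + 3) + 1) Q s'.
  elim: d i s' => [|d IH] i s' id Ii; have [iv en] := Iv _ _ Ii.
    exists s', 1%N; split=> // [k|]; last by apply: IQ; rewrite -id addn0.
    by rewrite /= iv en -id addn0 addn1 ltnn.
  have [|s1 [n1 [nB1 st1 [v1 I1]]]] := Ib i s' _ Ii; first by lia.
  have [|s2 [n2 [nB2 st2 q]]] := IH i.+1 _ _ I1; first by lia.
  exists s2, (n2 + (1 + (n1 + 2)))%N; split=> //; first by lia.
  move=> k; rewrite iterD -(st2 k); congr (iter n2 _ _).
  rewrite iterD iterD /= iv en.
  have -> : (i + 1 <= n)%N by lia.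
  by rewrite st1 /= v1 addn1.
have [s' [n1 [nB1 st1 q]]] := loop n 0%N _ (add0n n) I0.
exists s', (n1 + 2)%N; split=> //; first by rewrite /for_time; lia.
by move=> k; rewrite iterD /= st1.
Qed.

(** Only the listed arrays may change, and exactly [k] coins have been read. With literal lists the
    side conditions are decided by computation. *)
Definition frame (ia ra : seq nat) (k : nat) s s' : Prop :=
  [/\ forall a, a \notin ia -> imem s' a = imem s a,
      forall a, a \notin ra -> rmem s' a = rmem s a
    & coins s' = drop k (coins s)].

Lemma frame_refl ia ra s : frame ia ra 0 s s.
Proof. by split=> //; rewrite drop0. Qed.

Lemma frame_trans ia ra k1 ia' ra' k2 s s1 s2 :
  frame ia ra k1 s s1 -> frame ia' ra' k2 s1 s2 ->
  all [in ia] ia' -> all [in ra] ra' -> frame ia ra (k1 + k2) s s2.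
Proof.
move=> [f1 f2 f3] [g1 g2 g3] /allP hi /allP hr; split=> [a an|a an|].
- by rewrite g1 ?f1 //; apply: contra an; apply: hi.
- by rewrite g2 ?f2 //; apply: contra an; apply: hr.
- by rewrite g3 f3 drop_drop addnC.
Qed.

Lemma frame_iset ia ra k s s1 a i j v :
  frame ia ra k s s1 -> a \in ia -> frame ia ra k s (iset s1 a i j v).
Proof.
move=> [f1 f2 f3] ha; split=> // b bn; rewrite -f1 //= /update.
by have /negPf -> : b != a by apply: contraNneq bn => ->.
Qed.

Lemma frame_rset ia ra k s s1 a i j v :
  frame ia ra k s s1 -> a \in ra -> frame ia ra k s (rset s1 a i j v).
Proof.
move=> [f1 f2 f3] ha; split=> // b bn; rewrite -f2 //= /update.
by have /negPf -> : b != a by apply: contraNneq bn => ->.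
Qed.

Lemma frameI ia ra k s s' a : frame ia ra k s s' -> a \notin ia -> imem s' a = imem s a.
Proof. by case=> h _ _; apply: h. Qed.

Lemma frameR ia ra k s s' a : frame ia ra k s s' -> a \notin ra -> rmem s' a = rmem s a.
Proof. by case=> _ h _; apply: h. Qed.

Lemma frameC ia ra k s s' : frame ia ra k s s' -> coins s' = drop k (coins s).
Proof. by case. Qed.

(** Loop rule with the bookkeeping built in: [kf i] counts the coins read before round [i], and only
    [J], insensitive to the counter, remains to be supplied. *)
Lemma wp_forF v e body n B ia ra (kf : nat -> nat) (J : nat -> state R -> Prop) Q s :
  v \in ia -> kf 0%N = 0%N ->
  (forall s' k, frame ia ra k s s' -> ieval s' e = n) ->
  (forall i s' x, J i s' -> J i (iset s' v 0 0 x)) ->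
  J 0%N s ->
  (forall i s', (i < n)%N -> frame ia ra (kf i) s s' -> imem s' v 0 0 = i -> J i s' ->
     wp body B (fun s1 => [/\ frame ia ra (kf i.+1) s s1, imem s1 v 0 0 = i & J i.+1 s1]) s') ->
  (forall s', frame ia ra (kf n) s s' -> J n s' -> Q s') ->
  wp (For v e body) (for_time n B) Q s.
Proof.
move=> via kf0 en Jv J0 Jb JQ.
apply: (@wp_for v e body n B (fun i s' =>
  [/\ frame ia ra (kf i) s s', imem s' v 0 0 = i & J i s'])).
- split; [|by rewrite /= /update !eqxx|exact: Jv].
  by apply: frame_iset => //; rewrite kf0; apply: frame_refl.
- by move=> i s' [fr -> _]; split=> //; apply: en fr.
- move=> i s' lin [fr vi Ji]; apply: wp_post (Jb i s' lin fr vi Ji) _ => s1 [f1 v1 J1].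
  split=> //; split; [exact: frame_iset|by rewrite /= /update !eqxx|exact: Jv].
- by move=> s' [fr _ Jn]; apply: JQ.
Qed.

Lemma wp_sum v acc e body n B (F : nat -> R) Q s :
  (forall s' k, frame [:: v] [:: acc] k s s' -> ieval s' e = n) ->
  (forall i s', (i < n)%N -> frame [:: v] [:: acc] 0 s s' -> imem s' v 0 0 = i ->
     wp body B (fun s1 => frame [::] [:: acc] 0 s' s1 /\
       rmem s1 acc 0 0 = rmem s' acc 0 0 + F i) s') ->
  (forall s', frame [:: v] [:: acc] 0 s s' ->
     rmem s' acc 0 0 = rmem s acc 0 0 + \sum_(i < n) F i -> Q s') ->
  wp (For v e body) (for_time n B) Q s.
Proof.
move=> en hb hQ.
apply: (@wp_forF v e body n B [:: v] [:: acc] (fun=> 0%N) (fun i s' =>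
  rmem s' acc 0 0 = rmem s acc 0 0 + \sum_(k < i) F k)) => //.
- by rewrite mem_head.
- by rewrite big_ord0 addr0.
move=> i s' lin fr vi Ji; apply: wp_post (hb i s' lin fr vi) _ => s1 [f1 e1]; split.
- by rewrite -[0%N]addn0; apply: frame_trans fr f1 _ _; rewrite /= ?inE ?eqxx.
- by rewrite (frameI f1).
- by rewrite e1 Ji big_ord_recr /= addrA.
Qed.

Lemma wp_rfill v A r e body n B (F : nat -> R) Q s :
  (forall s' k, frame [:: v] [:: A] k s s' -> ieval s' e = n) ->
  (forall i s', (i < n)%N -> frame [:: v] [:: A] 0 s s' -> imem s' v 0 0 = i ->
     rmem s' A r i = rmem s A r i ->
     wp body B (fun s1 => s1 = rset s' A r i (F i)) s') ->
  (forall s', frame [:: v] [:: A] 0 s s' ->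
     (forall i j, rmem s' A i j = if (i == r) && (j < n)%N then F j else rmem s A i j) -> Q s') ->
  wp (For v e body) (for_time n B) Q s.
Proof.
move=> en hb hQ.
apply: (@wp_forF v e body n B [:: v] [:: A] (fun=> 0%N) (fun k s' =>
  forall i j, rmem s' A i j = if (i == r) && (j < k)%N then F j else rmem s A i j)) => //.
- by rewrite mem_head.
- by move=> i j; rewrite ltn0 andbF.
move=> i s' lin fr vi Ji; apply: wp_post (hb i s' lin fr vi _) _.
  by rewrite Ji ltnn andbF.
move=> s1 ->; split=> //; first by apply: frame_rset; rewrite ?mem_head.
move=> i' j'; rewrite /= /update eqxx /= Ji [in RHS]ltnS [in RHS]leq_eqVlt.
case: (eqVneq i' r) => //= _; case: (eqVneq j' i) => [->|] //=.
Qed.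

Lemma wp_rfill2 v1 v2 A e1 e2 body n1 n2 B (F : nat -> nat -> R) Q s :
  v1 != v2 ->
  (forall s' k, frame [:: v1; v2] [:: A] k s s' -> ieval s' e1 = n1) ->
  (forall s' k, frame [:: v1; v2] [:: A] k s s' -> ieval s' e2 = n2) ->
  (forall i j s', (i < n1)%N -> (j < n2)%N -> frame [:: v1; v2] [:: A] 0 s s' ->
     imem s' v1 0 0 = i -> imem s' v2 0 0 = j ->
     rmem s' A i j = rmem s A i j ->
     wp body B (fun s1 => s1 = rset s' A i j (F i j)) s') ->
  (forall s', frame [:: v1; v2] [:: A] 0 s s' ->
     (forall i j, (i < n1)%N -> (j < n2)%N -> rmem s' A i j = F i j) -> Q s') ->
  wp (For v1 e1 (For v2 e2 body)) (for_time n1 (for_time n2 B)) Q s.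
Proof.
move=> v12 en1 en2 hb hQ.
apply: (@wp_forF v1 e1 _ n1 _ [:: v1; v2] [:: A] (fun=> 0%N) (fun k s' =>
  forall i j, rmem s' A i j =
    if (i < k)%N && (j < n2)%N then F i j else rmem s A i j)) => //.
- by rewrite mem_head.
- move=> i s' lin fr vi Ji.
  have sub k s1 : frame [:: v2] [:: A] k s' s1 -> frame [:: v1; v2] [:: A] k s s1.
    move=> f1; rewrite -[k]add0n; apply: frame_trans fr f1 _ _; rewrite /= ?inE ?eqxx ?orbT //.
  have keep k s1 : frame [:: v2] [:: A] k s' s1 -> imem s1 v1 0 0 = i.
    by move=> f1; rewrite (frameI f1) // inE.
  apply: (@wp_rfill v2 A i e2 _ n2 B (F i)).
  + by move=> s1 k /sub; apply: en2.
  + move=> j s1 ljn f1 vj Aj; apply: hb => //; [exact: sub f1|exact: keep f1|].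
    by rewrite Aj Ji ltnn.
  + move=> s1 f1 A1; split; [exact: sub f1|exact: keep f1|].
    move=> i' j'; rewrite A1 Ji [in RHS]ltnS [in RHS]leq_eqVlt; case: (eqVneq i' i) => //= ->.
    by rewrite ltnn /=; case: ifP.
- by move=> s' fr Ji; apply: hQ fr _ => i j li lj; rewrite Ji li lj.
Qed.

End ProgramLogic.

(** * The program and its correctness *)

(* Memory layout.  Integer arrays: 4 slots (row 0), 5 the relation "in the same
   part", 6 picked indices (row 0), 7 the slot skipped by elimination, 8 the last
   coin, 9 a countdown, 10-15 loop counters.  Real arrays: 1 slot vectors (by rows),
   2 the eliminated matrix, 3 and 4 scratch for one elimination, 5 the product of
   the pivots, 6 the last draw, 7 the number of grid points, 8-10 the total weight,
   the heavy weight and the running weight of the sampler, 11 the best value. *)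
Definition c0 : iexp := IConst 0.
Definition em : iexp := cell 0.
Definition et : iexp := ICell 0 c0 (IConst 1).
Definition row0 a v : iexp := ICell a c0 (cell v).
Definition rrow0 a v : rexp := RCell a c0 (cell v).
Definition icell2 a v1 v2 : iexp := ICell a (cell v1) (cell v2).
Definition rcell2 a v1 v2 : rexp := RCell a (cell v1) (cell v2).
Definition rassign a (e : rexp) : prog := RAssign a c0 c0 e.
Definition IfPos (e : iexp) (p : prog) : prog := If (ILe (IConst 1) e) p Skip.

(** A draw uses m + 7 coins: then Q = 128 * 2^m, which is at least twice the size of any part and
    makes the atoms, at most m/Q in all, weigh at most 1/128. *)
Definition Draw : prog :=
  Seq (rassign 6 (RConst 0))
    (For 15 (IAdd em (IConst 7))
      (Seq (Flip 8 c0 c0)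
        (If (ILe (IConst 1) (cell 8))
          (rassign 6 (RAdd (RAdd (rcell 6) (rcell 6)) (RConst 1)))
          (rassign 6 (RSub (RAdd (rcell 6) (rcell 6)) (RConst 1)))))).

(** One application of [elim] in place: array 3 receives W u and cell 4 the pivot beforehand, so an
    entry of array 2 is needed only for its own update. *)
Definition Pivot : prog :=
  Seq (For 13 em
        (Seq (rassign 4 (RConst 0))
        (Seq (For 14 em
               (rassign 4 (RAdd (rcell 4) (RMul (rcell2 2 13 14) (rcell2 1 12 14)))))
             (RAssign 3 c0 (cell 13) (rcell 4)))))
  (Seq (rassign 4 (RConst 0))
  (Seq (For 13 em (rassign 4 (RAdd (rcell 4) (RMul (rcell2 1 12 13) (rrow0 3 13)))))
  (Seq (rassign 5 (RMul (rcell 5) (rcell 4)))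
       (For 13 em (For 14 em
         (RAssign 2 (cell 13) (cell 14)
           (RSub (rcell2 2 13 14) (RDiv (RMul (rrow0 3 13) (rrow0 3 14)) (rcell 4))))))))).

(** Inequality with the skipped index is tested by adding the two truncated differences. The value m
    in cell 7 means that no slot is skipped. *)
Definition Eliminate : prog :=
  Seq (For 13 em (For 14 em (RAssign 2 (cell 13) (cell 14) (rcell2 0 13 14))))
  (Seq (rassign 5 (RConst 1))
       (For 12 em
         (IfPos (row0 4 12)
           (IfPos (IAdd (ISub (cell 12) (cell 7)) (ISub (cell 7) (cell 12))) Pivot)))).

Definition draw_time m : nat :=
  seq_time 1 (for_time (m + 7) (seq_time 1 (if_time 1 1))).

Definition pivot_time m : nat :=
  seq_time (for_time m (seq_time 1 (seq_time (for_time m 1) 1)))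
    (seq_time 1 (seq_time (for_time m 1) (seq_time 1 (for_time m (for_time m 1))))).

Definition eliminate_time m : nat :=
  seq_time (for_time m (for_time m 1))
    (seq_time 1 (for_time m (if_time (if_time (pivot_time m) 1) 1))).

(** * Correctness of drawing and elimination *)

Section Subroutines.
Variables (R : realType) (m : nat).
Implicit Types (s : state R) (Q : state R -> Prop).

Local Notation l := (m + 7)%N.
Local Notation bv := (@basis_vec R m).

Lemma wp_draw Q s : imem s 0 0 0 = m -> (l <= size (coins s))%N ->
  (forall s', frame [:: 8; 15] [:: 6] l s s' ->
     rmem s' 6 0 0 = draw R (take l (coins s)) -> Q s') ->
  wp Draw (draw_time m) Q s.
Proof.
move=> sm sz hQ; apply: wp_seq; apply: wp_rassign.
set s0 := rset _ _ _ _ _.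
have f0 : frame [:: 8; 15] [:: 6] 0 s s0 by apply: frame_rset => //; apply: frame_refl.
apply: (@wp_forF _ 15 _ _ _ _ [:: 8; 15] [:: 6] id (fun i s' =>
  rmem s' 6 0 0 = draw R (take i (coins s)))) => //.
- by move=> s' k fr; rewrite /= (frameI fr) //= sm.
- by rewrite /= take0.
- move=> i s' lil fr vi xi; have ci : coins s' = drop i (coins s) := frameC fr.
  have li : (i < size (coins s))%N by apply: leq_trans sz.
  apply: wp_seq; apply: wp_flip.
  rewrite ci (drop_nth false li) /=; set s1 := State _ _ _.
  have f1 : frame [:: 8; 15] [:: 6] i.+1 s0 s1.
    case: fr => f1 f2 f3; split=> // a an; rewrite /= -f1 // /update.
    by have /negPf -> : a != 8 by apply: contraNneq an => ->.
  have e1 : imem s1 8 0 0 = nth false (coins s) i by [].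
  have x1 : rmem s1 6 0 0 = draw R (take i (coins s)) by [].
  have dr : draw R (take i.+1 (coins s)) = if nth false (coins s) i then
      (draw R (take i (coins s)) + draw R (take i (coins s)) + 1)%R
      else (draw R (take i (coins s)) + draw R (take i (coins s)) - 1)%R.
    by rewrite (take_nth false li) /draw foldl_rcons.
  apply: wp_if; rewrite /= /update /= => hb; apply: wp_rassign; split=> //;
    try (by apply: frame_rset); rewrite dr /= /update /= xi; move: hb; by case: nth.
- move=> s' fr x'; apply: hQ => //.
  by rewrite -[l]add0n; apply: frame_trans f0 fr _ _.
Qed.

Definition mat_at (a : nat) s (W : 'M[R]_m) : Prop :=
  forall i j : 'I_m, rmem s a i j = W i j.

Definition uvec s (a : nat) : 'cV[R]_m := (\col_(j < m) rmem s 1 a j)%R.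

Lemma wp_pivot W a Q s : imem s 0 0 0 = m -> imem s 12 0 0 = a -> (W^T = W)%R ->
  mat_at 2 s W ->
  (forall s', frame [:: 13; 14] [:: 2; 3; 4; 5] 0 s s' ->
     mat_at 2 s' (elim W (uvec s a)) ->
     rmem s' 5 0 0 = (rmem s 5 0 0 * bil W (uvec s a) (uvec s a))%R -> Q s') ->
  wp Pivot (pivot_time m) Q s.
Proof.
move=> sm sa sW Ws hQ; set u := uvec s a.
have yE (i : 'I_m) : ((W *m u) i 0 = \sum_(j < m) rmem s 2 i j * rmem s 1 a j)%R.
  by rewrite mxE; apply: eq_bigr => j _; rewrite mxE Ws.
apply: wp_seq.
apply: (@wp_forF _ 13 _ _ m _ [:: 13; 14] [:: 3; 4] (fun=> 0%N) (fun k s' =>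
  forall i : 'I_m, (i < k)%N -> rmem s' 3 0 i = (W *m u)%R i 0%R)) => //.
- by move=> s' k fr; rewrite /= (frameI fr).
- move=> i s' li fr vi Ji; apply: wp_seq; apply: wp_rassign; set s0 := rset _ _ _ _ _.
  have f0 : frame [:: 13; 14] [:: 3; 4] 0 s s0 by apply: frame_rset.
  have sub k s1 : frame [:: 14] [:: 4] k s0 s1 -> frame [:: 13; 14] [:: 3; 4] k s s1.
    by move=> f1; rewrite -[k]add0n; apply: frame_trans f0 f1 _ _.
  apply: wp_seq; apply: (@wp_sum _ 14 4 _ _ m _ (fun j => rmem s 2 i j * rmem s 1 a j)%R).
  + by move=> s1 k /sub fr1; rewrite /= (frameI fr1).
  + move=> j s1 lj f1 vj; apply: wp_rassign.
    have fs := sub _ _ f1.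
    have v13 : imem s1 13 0 0 = i by rewrite (frameI f1).
    have v12 : imem s1 12 0 0 = a by rewrite (frameI fs).
    have r2 : rmem s1 2 = rmem s 2 by rewrite (frameR fs).
    have r1 : rmem s1 1 = rmem s 1 by rewrite (frameR fs).
    rewrite /= vj v13 v12 r2 r1; split=> //.
    by apply: frame_rset => //; apply: frame_refl.
  + move=> s1 f1 e1; apply: wp_rassign.
    have v1 : imem s1 13 0 0 = i by rewrite (frameI f1).
    split=> //; first by apply: frame_rset => //; exact: sub f1.
    move=> i' li'; rewrite /= /update /= v1; case: eqVneq => [ii|ii].
      by rewrite e1 /= /update /= add0r yE ii.
    rewrite (frameR f1) //= /update /= Ji //; lia.
- move=> s1 f1 y1.
  have {}y1 (i : 'I_m) : rmem s1 3 0 i = (W *m u)%R i 0%R by apply: y1.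
  apply: wp_seq; apply: wp_rassign; set s2 := rset _ _ _ _ _.
  have f2 : frame [:: 13; 14] [:: 3; 4] 0 s s2 by apply: frame_rset.
  have y2 (i : 'I_m) : rmem s2 3 0 i = (W *m u)%R i 0%R by exact: y1.
  have sub2 k s' : frame [:: 13] [:: 4] k s2 s' -> frame [:: 13; 14] [:: 3; 4] k s s'.
    by move=> f'; rewrite -[k]add0n; apply: frame_trans f2 f' _ _.
  apply: wp_seq; apply: (@wp_sum _ 13 4 _ _ m _ (fun j => rmem s 1 a j * rmem s2 3 0 j)%R).
  + by move=> s' k /sub2 f'; rewrite /= (frameI f').
  + move=> j s' lj f' vj; apply: wp_rassign; have fs := sub2 _ _ f'.
    have v12 : imem s' 12 0 0 = a by rewrite (frameI fs).
    have r1 : rmem s' 1 = rmem s 1 by rewrite (frameR fs).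
    have r3 : rmem s' 3 = rmem s2 3 by rewrite (frameR f').
    rewrite /= vj v12 r1 r3; split=> //.
    by apply: frame_rset => //; apply: frame_refl.
  move=> s3 f3 e3; have fs3 := sub2 _ _ f3.
  have {}e3 : rmem s3 4 0 0 = bil W u u.
    rewrite e3 /= /update /= add0r /bil -mulmxA mxE; apply: eq_bigr => j _.
    by rewrite -y1 !mxE.
  have y3 (i : 'I_m) : rmem s3 3 0 i = (W *m u)%R i 0%R by rewrite (frameR f3) // y2.
  apply: wp_seq; apply: wp_rassign; set s4 := rset _ _ _ _ _.
  have f4 : frame [:: 13; 14] [:: 3; 4; 5] 0 s s4.
    apply: frame_rset => //; rewrite -[0%N]addn0.
    by apply: frame_trans (frame_refl _ _ _) fs3 _ _.
  have v4 : rmem s4 5 0 0 = (rmem s 5 0 0 * bil W u u)%R.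
    by rewrite /= /update /= e3 (frameR fs3).
  apply: (@wp_rfill2 _ 13 14 2 _ _ _ m m _ (fun i j =>
     rmem s 2 i j - rmem s3 3 0 i * rmem s3 3 0 j / rmem s3 4 0 0)%R) => //.
  + by move=> s' k f'; rewrite /= (frameI f') //= (frameI fs3).
  + by move=> s' k f'; rewrite /= (frameI f') //= (frameI fs3).
  + move=> i j s' li lj f' vi vj Wij; apply: wp_rassign.
    have r3 : rmem s' 3 = rmem s3 3 by rewrite (frameR f').
    have r4 : rmem s' 4 = rmem s3 4 by rewrite (frameR f').
    have r2 : rmem s4 2 = rmem s 2 by rewrite -(frameR fs3).
    by rewrite /= vi vj Wij r3 r4 r2.
  + move=> s' f' W'; apply: hQ.
    * rewrite -[0%N]addn0; apply: (frame_trans (k1 := 0)) f' _ _ => //.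
      by rewrite -[0%N]addn0; apply: frame_trans (frame_refl _ _ _) f4 _ _.
    * move=> i j; rewrite W' // Ws y3 y3 e3 /elim !mxE big_ord1 !mxE.
      by rewrite [X in _ = (_ - X)%R]mulrC.
    * by rewrite (frameR f').
Qed.

Lemma take_enum_ord (i : 'I_m) : take i.+1 (enum 'I_m) = rcons (take i (enum 'I_m)) i.
Proof. by rewrite (take_nth i) ?size_enum_ord // nth_ord_enum. Qed.

Lemma drop_enum_ord (i : 'I_m) : drop i (enum 'I_m) = i :: drop i.+1 (enum 'I_m).
Proof. by rewrite (drop_nth i) ?size_enum_ord // nth_ord_enum. Qed.

Definition reads_set (a : nat) s (S : {set 'I_m}) : Prop :=
  forall j : 'I_m, (0 < imem s a 0 j) = (j \in S).

Lemma wp_eliminate L (S0 : {set 'I_m}) k Q s : psd L -> imem s 0 0 0 = m -> mat_at 0 s L ->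
  reads_set 4 s S0 -> imem s 7 0 0 = k ->
  (forall s', frame [:: 12; 13; 14] [:: 2; 3; 4; 5] 0 s s' ->
     let us := [seq uvec s (a : 'I_m) | a <- enum 'I_m & (a \in S0) && (val a != k)] in
     mat_at 2 s' (foldl (@elim R m) L us) -> rmem s' 5 0 0 = vol L us -> Q s') ->
  wp Eliminate (eliminate_time m) Q s.
Proof.
move=> pL sm Ls S0s sk hQ.
apply: wp_seq; apply: (@wp_rfill2 _ 13 14 2 _ _ _ m m _ (fun i j => rmem s 0 i j)) => //.
- by move=> s' n f'; rewrite /= (frameI f').
- by move=> s' n f'; rewrite /= (frameI f').
- by move=> i j s' li lj f' vi vj _; apply: wp_rassign; rewrite /= vi vj (frameR f').
move=> s1 f1 W1; apply: wp_seq; apply: wp_rassign; set s2 := rset _ _ _ _ _.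
have f2 : frame [:: 12; 13; 14] [:: 2; 3; 4; 5] 0 s s2.
  apply: frame_rset => //; rewrite -[0]addn0.
  by apply: frame_trans (frame_refl _ _ _) f1 _ _.
have sub n s' : frame [:: 12; 13; 14] [:: 2; 3; 4; 5] n s2 s' ->
    frame [:: 12; 13; 14] [:: 2; 3; 4; 5] n s s'.
  by move=> f'; rewrite -[n]add0n; apply: frame_trans f2 f' _ _.
pose us i := [seq uvec s (a : 'I_m) | a <- take i (enum 'I_m) & (a \in S0) && (val a != k)].
apply: (@wp_forF _ 12 _ _ m _ [:: 12; 13; 14] [:: 2; 3; 4; 5] (fun=> 0) (fun i s' =>
  mat_at 2 s' (foldl (@elim R m) L (us i)) /\ rmem s' 5 0 0 = vol L (us i))) => //.
- by move=> s' n /sub f'; rewrite /= (frameI f').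
- split; last by rewrite /us take0.
  by move=> i j; rewrite /us take0 /= /update /= W1.
- move=> i s' li fr vi [Wi vali]; have fs := sub _ _ fr.
  pose a := Ordinal li.
  have usS : us i.+1 = if (a \in S0) && (i != k) then rcons (us i) (uvec s i) else us i.
    rewrite /us (take_enum_ord a) filter_rcons /=.
    by case: ifP => // _; rewrite map_rcons.
  have i4 : imem s' 4 0 i = imem s 4 0 a by rewrite (frameI fs).
  have i7 : imem s' 7 0 0 = k by rewrite (frameI fs).
  have skip s3 : us i.+1 = us i -> s3 = s' ->
      [/\ frame [:: 12; 13; 14] [:: 2; 3; 4; 5] 0 s2 s3, imem s3 12 0 0 = i
       & mat_at 2 s3 (foldl (@elim R m) L (us i.+1)) /\ rmem s3 5 0 0 = vol L (us i.+1)].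
    by move=> -> ->.
  apply: wp_if; rewrite /= vi i4 S0s => aS; last first.
    by apply: wp_skip; apply: skip; rewrite // usS (negPf aS).
  apply: wp_if; rewrite /= vi i7 => ak; last first.
    apply: wp_skip; apply: skip; rewrite // usS.
    have /eqP -> : i == k by lia.
    by rewrite eqxx andbF.
  have {}usS : us i.+1 = rcons (us i) (uvec s i).
    rewrite usS aS; have -> // : i != k by lia.
  have uE : uvec s' i = uvec s i by apply/matrixP => j z; rewrite !mxE (frameR fs).
  have pW : psd (foldl (@elim R m) L (us i)) by apply: psd_foldl.
  apply: (wp_pivot (a := i)) Wi _ => //; [by rewrite (frameI fs)|by case: pW|].
  move=> s3 f3 W3 v3; split.
  + by rewrite -[0]addn0; apply: frame_trans fr f3 _ _.
  + by rewrite (frameI f3).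
  + rewrite usS foldl_rcons -uE; split=> //.
    by rewrite v3 vali -cats1 vol_cat /= mulr1 uE.
- move=> s' fr [W' v']; have fs := sub _ _ fr.
  by apply: hQ => //; move: W' v'; rewrite /us take_oversize // size_enum_ord.
Qed.

End Subroutines.

(** * Drawing the slot vectors and rounding one slot *)

Definition Sample : prog :=
  For 11 em (IfPos (row0 4 11)
    (For 13 em (Seq Draw
      (If (ILe (IConst 1) (icell2 5 11 13))
        (RAssign 1 (cell 11) (cell 13) (rcell 6))
        (RAssign 1 (cell 11) (cell 13) (RConst 0)))))).

Definition IfHeavy (p : prog) : prog :=
  IfPos (icell2 5 11 13)
    (If (RLe (rcell 8) (RMul (rcell 7) (rcell2 2 13 13))) p Skip).

(** One step of [rounds]. Rows of earlier slots already hold basis vectors and rows of later slots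
    still hold drawn ones, so eliminating along all rows but the slot's own produces [residual]. *)
Definition Stage : prog :=
  Seq (IAssign 7 c0 c0 (cell 11))
  (Seq Eliminate
  (Seq Draw
  (Seq (rassign 8 (RConst 0))
  (Seq (For 13 em (IfPos (icell2 5 11 13) (rassign 8 (RAdd (rcell 8) (rcell2 2 13 13)))))
  (Seq (rassign 9 (RConst 0))
  (Seq (For 13 em (IfHeavy (rassign 9 (RAdd (rcell 9) (rcell2 2 13 13)))))
  (Seq (rassign 10 (RConst 0))
  (Seq (IAssign 6 c0 (cell 11) (cell 11))
  (Seq (For 13 em (IfHeavy
         (Seq (If (RLe (RMul (RMul (RConst 2) (rcell 7)) (rcell 10))
                       (RMul (RSub (RAdd (rcell 6) (rcell 7)) (RConst 1)) (rcell 9)))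
                  (IAssign 6 c0 (cell 11) (cell 13)) Skip)
              (rassign 10 (RAdd (rcell 10) (rcell2 2 13 13))))))
  (Seq (For 13 em (RAssign 1 (cell 11) (cell 13) (RConst 0)))
       (RAssign 1 (cell 11) (row0 6 11) (RConst 1)))))))))))).

Definition sample_time m : nat :=
  for_time m (if_time (for_time m (seq_time (draw_time m) (if_time 1 1))) 1).

Definition heavy_time B : nat := if_time (if_time B 1) 1.

Definition stage_time m : nat :=
  seq_time 1 (seq_time (eliminate_time m) (seq_time (draw_time m)
  (seq_time 1 (seq_time (for_time m (if_time 1 1))
  (seq_time 1 (seq_time (for_time m (heavy_time 1))
  (seq_time 1 (seq_time 1
  (seq_time (for_time m (heavy_time (seq_time (if_time 1 1) 1)))
  (seq_time (for_time m 1) 1)))))))))).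

Section Stages.
Variables (R : realType) (m : nat) (L : 'M[R]_m) (S0 : {set 'I_m}) (pt : 'I_m -> {set 'I_m}).
Implicit Types (s : state R) (Q : state R -> Prop).

Local Notation l := (m + 7)%N.
Local Notation bv := (@basis_vec R m).

Lemma rvec_entry k P (js : seq 'I_m) w j : uniq js -> j \in js ->
  (rvec R k P js w) j 0%R =
    if j \in P then draw R (take k (drop (index j js * k) w)) else 0%R.
Proof.
have out js' w' : j \notin js' -> (rvec R k P js' w') j 0%R = 0%R.
  elim: js' w' => [|i js' IH] w' /=; first by rewrite mxE.
  rewrite inE negb_or => /andP [ji jn]; rewrite !mxE IH // (negPf ji) /= mulr0 addr0 //.
elim: js w => //= i js IH w /andP [ni un]; rewrite inE !mxE eq_sym.
case: (eqVneq i j) => [ij _|ij /= jjs].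
  have jn : j \notin js by rewrite -ij.
  by rewrite out // ij eqxx mulr1 addr0 mul0n drop0.
by rewrite IH // mulr0 add0r drop_drop mulSn addnC.
Qed.

Lemma rvec_enum k P w (j : 'I_m) :
  (rvec R k P (enum 'I_m) w) j 0%R = if j \in P then draw R (take k (drop (j * k) w)) else 0%R.
Proof. by rewrite rvec_entry ?enum_uniq ?mem_enum // index_enum_ord. Qed.

Lemma take_drop_take (T : Type) a b n (w : seq T) : b + a <= n ->
  take a (drop b (take n w)) = take a (drop b w).
Proof. by move=> h; rewrite !take_drop take_takel // addnC. Qed.

Lemma xvecs_take k (sl : seq 'I_m) n w : size sl * (m * k) <= n ->
  xvecs R k pt sl (take n w) = xvecs R k pt sl w.
Proof.
elim: sl n w => //= a sl IH n w; rewrite mulSn => h; congr (_ :: _).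
  by rewrite take_takel //; lia.
have -> : drop (m * k) (take n w) = take (n - m * k) (drop (m * k) w).
  by rewrite take_drop subnK //; lia.
by apply: IH; lia.
Qed.

Lemma xvecs_rcons k (sl : seq 'I_m) a w :
  xvecs R k pt (rcons sl a) w = rcons (xvecs R k pt sl w)
    (rvec R k (pt a) (enum 'I_m) (take (m * k) (drop (size sl * (m * k)) w))).
Proof.
elim: sl w => [|b sl IH] w /=; first by rewrite mul0n drop0.
by rewrite IH drop_drop mulSn addnC.
Qed.

Definition reads_rel s : Prop := forall a j : 'I_m, (0 < imem s 5 a j) = (j \in pt a).

Definition slots_below i : seq 'I_m := [seq a <- take i (enum 'I_m) | a \in S0].

Lemma upto_S (a : 'I_m) : slots_below a.+1 = if a \in S0 then rcons (slots_below a) a else slots_below a.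
Proof. by rewrite /slots_below take_enum_ord filter_rcons. Qed.

Lemma mem_upto i (b : 'I_m) : b \in slots_below i -> b < i.
Proof.
rewrite mem_filter => /andP [_ /(nthP b) [k]]; rewrite size_take size_enum_ord => lk.
have ki : k < i by move: lk; case: (ltnP i m) => ? ?; lia.
have km : k < m by move: lk; case: (ltnP i m) => ? ?; lia.
by rewrite nth_take // => <-; rewrite nth_enum_ord.
Qed.

Lemma wp_sample_row (a : 'I_m) Q s : imem s 0 0 0 = m -> imem s 11 0 0 = a -> reads_rel s ->
  m * l <= size (coins s) ->
  (forall s', frame [:: 8; 13; 15] [:: 1; 6] (m * l) s s' ->
     uvec m s' a = rvec R l (pt a) (enum 'I_m) (take (m * l) (coins s)) ->
     (forall b : nat, b != a -> uvec m s' b = uvec m s b) -> Q s') ->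
  wp (For 13 em (Seq Draw
      (If (ILe (IConst 1) (icell2 5 11 13))
        (RAssign 1 (cell 11) (cell 13) (rcell 6))
        (RAssign 1 (cell 11) (cell 13) (RConst 0)))))
    (for_time m (seq_time (draw_time m) (if_time 1 1))) Q s.
Proof.
move=> sm sa srel sz hQ.
pose F j := if 0 < imem s 5 a j then draw R (take l (drop (j * l) (coins s))) else 0%R.
apply: (@wp_forF _ 13 _ _ m _ [:: 8; 13; 15] [:: 1; 6] (fun i => i * l) (fun i s' =>
  (forall j, j < i -> rmem s' 1 a j = F j) /\
  (forall b j, b != a :> nat -> rmem s' 1 b j = rmem s 1 b j))) => //.
- by move=> s' n f'; rewrite /= (frameI f').
- move=> i s' li fr vi [Ji Jo]; apply: wp_seq.
  have cs := frameC fr.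
  apply: wp_draw; [by rewrite (frameI fr)|by rewrite cs size_drop; nia|].
  move=> s1 f1 x1.
  have fs : frame [:: 8; 13; 15] [:: 1; 6] (i.+1 * l) s s1.
    by rewrite mulSn addnC; apply: frame_trans fr f1 _ _.
  have v13 : imem s1 13 0 0 = i by rewrite (frameI f1).
  have v11 : imem s1 11 0 0 = a by rewrite (frameI fs).
  have i5 : imem s1 5 = imem s 5 by rewrite (frameI fs).
  have r1 : rmem s1 1 = rmem s' 1 by rewrite (frameR f1).
  apply: wp_if; rewrite /= v11 v13 i5 => hb; apply: wp_rassign; rewrite /= v11 v13;
    (split=> //; [by apply: frame_rset | split=> [j|b j ba] /=]).
  + rewrite ltnS leq_eqVlt /update /= r1 eqxx /=; case: eqVneq => [-> _|_ /Ji //].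
    by rewrite x1 /F hb cs.
  + by rewrite /update /= (negPf ba) /= r1 Jo.
  + rewrite ltnS leq_eqVlt /update /= r1 eqxx /=; case: eqVneq => [-> _|_ /Ji //].
    by rewrite /F (negPf hb).
  + by rewrite /update /= (negPf ba) /= r1 Jo.
- move=> s' fr [Jm Jo]; apply: hQ => //.
  + apply/matrixP => j z; rewrite (ord1 z) mxE rvec_enum Jm // /F srel.
    by rewrite take_drop_take //; have := ltn_ord j; nia.
  + by move=> b ba; apply/matrixP => j z; rewrite !mxE Jo.
Qed.

Lemma wp_sample Q s : imem s 0 0 0 = m -> reads_set 4 s S0 -> reads_rel s ->
  size (slots_below m) * (m * l) <= size (coins s) ->
  (forall s', frame [:: 8; 11; 13; 15] [:: 1; 6] (size (slots_below m) * (m * l)) s s' ->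
     [seq uvec m s' (a : 'I_m) | a <- slots_below m] = xvecs R l pt (slots_below m) (coins s) -> Q s') ->
  wp Sample (sample_time m) Q s.
Proof.
move=> sm S0s srel sz hQ.
apply: (@wp_forF _ 11 _ _ m _ [:: 8; 11; 13; 15] [:: 1; 6]
  (fun i => size (slots_below i) * (m * l)) (fun i s' =>
  [seq uvec m s' (a : 'I_m) | a <- slots_below i] = xvecs R l pt (slots_below i) (coins s))) => //.
- by rewrite /slots_below take0.
- by move=> s' n f'; rewrite /= (frameI f').
- by rewrite /slots_below take0.
- move=> i s' li fr vi Ji; pose a := Ordinal li.
  have i4 : imem s' 4 0 i = imem s 4 0 a by rewrite (frameI fr).
  apply: wp_if; rewrite /= vi i4 S0s => aS; last first.
    by apply: wp_skip; rewrite (upto_S a) (negPf aS).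
  have le_upto : size (slots_below i.+1) <= size (slots_below m).
    rewrite {2}/slots_below take_oversize ?size_enum_ord // -(cat_take_drop i.+1 (enum 'I_m)).
    by rewrite filter_cat size_cat leq_addr.
  have usz : size (slots_below i.+1) = (size (slots_below i)).+1 by rewrite (upto_S a) aS size_rcons.
  have cs := frameC fr.
  apply: (wp_sample_row (a := a)) => //.
  + by rewrite (frameI fr).
  + by move=> b j; rewrite (frameI fr).
  + by rewrite cs size_drop; nia.
  move=> s1 f1 ua uo; split.
  + by rewrite usz mulSn addnC; apply: frame_trans fr f1 _ _.
  + by rewrite (frameI f1).
  + rewrite (upto_S a) aS map_rcons xvecs_rcons -cs ua -Ji; congr rcons.
    apply/eq_in_map => b /mem_upto bi; apply: uo; rewrite neq_ltn bi //.
Qed.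

Lemma wp_if_heavy W (a j : 'I_m) p B Q s :
  imem s 11 0 0 = a -> imem s 13 0 0 = j -> reads_rel s ->
  rmem s 8 0 0 = tot W (pt a) -> rmem s 7 0 0 = (2 ^ l)%:R%R -> rmem s 2 j j = W j j ->
  (heavy l W (pt a) j -> wp p B Q s) -> (~~ heavy l W (pt a) j -> Q s) ->
  wp (IfHeavy p) (heavy_time B) Q s.
Proof.
move=> va vj srel sT sQ sW hp hn.
apply: wp_if; rewrite /= va vj srel => jP; last first.
  by apply: wp_skip; apply: hn; rewrite /heavy (negPf jP).
apply: wp_if; rewrite /= vj sT sQ sW => hT; first by apply: hp; rewrite /heavy jP.
by apply: wp_skip; apply: hn; rewrite /heavy jP.
Qed.

Hypothesis pL : psd L.

Lemma wp_stage (a : 'I_m) W j Q s : imem s 0 0 0 = m -> mat_at 0 s L -> reads_set 4 s S0 ->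
  reads_rel s -> imem s 11 0 0 = a -> rmem s 7 0 0 = (2 ^ l)%:R%R -> l <= size (coins s) ->
  W = foldl (@elim R m) L
        [seq uvec m s (b : 'I_m) | b <- enum 'I_m & (b \in S0) && (val b != a)] ->
  j = pick l W (pt a) (draw R (take l (coins s))) a ->
  (forall s',
     frame [:: 6; 7; 8; 12; 13; 14; 15] [:: 1; 2; 3; 4; 5; 6; 8; 9; 10] l s s' ->
     imem s' 6 0 a = j -> (forall b : nat, b != a -> imem s' 6 0 b = imem s 6 0 b) ->
     uvec m s' a = bv j -> (forall b : nat, b != a -> uvec m s' b = uvec m s b) -> Q s') ->
  wp Stage (stage_time m) Q s.
Proof.
move=> sm Ls S0s srel sa sQ sz WE jE hQ.
set x := draw R _ in jE.
pose ia := [:: 6; 7; 8; 12; 13; 14; 15]; pose ra := [:: 1; 2; 3; 4; 5; 6; 8; 9; 10].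
apply: wp_seq; apply: wp_iassign; set s1 := iset _ _ _ _ _.
have f1 : frame ia ra 0 s s1 by apply: frame_iset => //; apply: frame_refl.
apply: wp_seq; apply: (@wp_eliminate _ _ L S0 a) => //.
move=> s2 f12 /= W2 _.
have f2 : frame ia ra 0 s s2 by rewrite -[0]addn0; apply: frame_trans f1 f12 _ _.
have {}W2 : mat_at 2 s2 W by rewrite WE.
have r12 : rmem s2 1 = rmem s 1 by rewrite (frameR f12).
have i62 : imem s2 6 = imem s 6 by rewrite (frameI f12).
have c2 : coins s2 = coins s by rewrite (frameC f2) drop0.
apply: wp_seq; apply: wp_draw; [by rewrite (frameI f2)|by rewrite c2|].
move=> s3 f23 x3.
have {}x3 : rmem s3 6 0 0 = x by rewrite x3 c2.
have f3 : frame ia ra l s s3 by rewrite -[l]add0n; apply: frame_trans f2 f23 _ _.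
have W3 : mat_at 2 s3 W by move=> i k; rewrite (frameR f23).
have r13 : rmem s3 1 = rmem s 1 by rewrite (frameR f23).
have i63 : imem s3 6 = imem s 6 by rewrite (frameI f23).
apply: wp_seq; apply: wp_rassign; set s4 := rset _ _ _ _ _.
have f4 : frame ia ra l s s4 by apply: frame_rset.
have sub4 k s' : frame [:: 13] [:: 8] k s4 s' -> frame ia ra (l + k) s s'.
  by move=> f'; apply: frame_trans f4 f' _ _.
apply: wp_seq; apply: (@wp_sum _ 13 8 _ _ m _
  (fun i => if 0 < imem s 5 a i then rmem s3 2 i i else 0%R)).
- by move=> s' k /sub4 f'; rewrite /= (frameI f').
- move=> i s' li f' vi; have fs := sub4 _ _ f'.
  have v11 : imem s' 11 0 0 = a by rewrite (frameI fs).
  have i5 : imem s' 5 = imem s 5 by rewrite (frameI fs).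
  have r2 : rmem s' 2 = rmem s3 2 by rewrite (frameR f').
  apply: wp_if; rewrite /= v11 vi i5 => hb.
    apply: wp_rassign; rewrite /= vi r2 hb; split=> //.
    by apply: frame_rset => //; apply: frame_refl.
  by apply: wp_skip; rewrite (negPf hb) addr0; split=> //; apply: frame_refl.
move=> s5 f45; rewrite /= /update /= add0r => T5.
have {}T5 : rmem s5 8 0 0 = tot W (pt a).
  rewrite T5 /tot [in RHS]big_mkcond; apply: eq_bigr => i _.
  by rewrite srel W3.
have f5 : frame ia ra l s s5 by rewrite -[l]addn0; apply: sub4 f45.
have W5 : mat_at 2 s5 W by move=> i k; rewrite (frameR f45) // -[RHS]W3.
have x5 : rmem s5 6 0 0 = x by rewrite (frameR f45).
have r15 : rmem s5 1 = rmem s 1 by rewrite (frameR f45).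
have i65 : imem s5 6 = imem s 6 by rewrite (frameI f45).
apply: wp_seq; apply: wp_rassign; set s6 := rset _ _ _ _ _.
have f6 : frame ia ra l s s6 by apply: frame_rset.
have sub6 k s' : frame [:: 13] [:: 9] k s6 s' -> frame ia ra (l + k) s s'.
  by move=> f'; apply: frame_trans f6 f' _ _.
apply: wp_seq; apply: (@wp_sum _ 13 9 _ _ m _
  (fun i => if insub i is Some i' then (if heavy l W (pt a) i' then W i' i' else 0) else 0)%R).
- by move=> s' k /sub6 f'; rewrite /= (frameI f').
- move=> i s' li f' vi; have fs := sub6 _ _ f'.
  have r2 : rmem s' 2 = rmem s5 2 by rewrite (frameR f').
  rewrite insubT /=.
  apply: (@wp_if_heavy W a (Ordinal li)) => //.
  + by rewrite (frameI fs).
  + by move=> b k; rewrite (frameI fs).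
  + by rewrite (frameR f').
  + by rewrite (frameR fs).
  + by rewrite r2 W5.
  + move=> ->; apply: wp_rassign; rewrite /= vi r2 -(W5 (Ordinal li)) /=; split=> //.
    by apply: frame_rset => //; apply: frame_refl.
  + by move=> /negPf ->; rewrite addr0; split=> //; apply: frame_refl.
move=> s7 f67; rewrite /= /update /= add0r => T7.
have {}T7 : rmem s7 9 0 0 = tot2 l W (pt a).
  rewrite T7 /tot2 [in RHS]big_mkcond; apply: eq_bigr => i _.
  by rewrite valK.
have f7 : frame ia ra l s s7 by rewrite -[l]addn0; apply: sub6 f67.
have W7 : mat_at 2 s7 W by move=> i k; rewrite (frameR f67) // -[RHS]W5.
have x7 : rmem s7 6 0 0 = x by rewrite (frameR f67).
have T7' : rmem s7 8 0 0 = tot W (pt a) by rewrite (frameR f67).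
have r17 : rmem s7 1 = rmem s 1 by rewrite (frameR f67).
have i67 : imem s7 6 = imem s 6 by rewrite (frameI f67).
have v7 : imem s7 11 0 0 = a by rewrite (frameI f7).
apply: wp_seq; apply: wp_rassign; set s8 := rset _ _ _ _ _.
have v8 : ieval s8 (cell 11) = a by exact: v7.
apply: wp_seq; apply: wp_iassign; rewrite v8 [ieval s8 c0]/=.
set s9 := iset _ _ _ _ _.
have f79 : frame [:: 6; 13] [:: 10] 0 s7 s9.
  by apply: frame_iset => //; apply: frame_rset => //; apply: frame_refl.
have sub9 k s' : frame [:: 6; 13] [:: 10] k s9 s' -> frame [:: 6; 13] [:: 10] k s7 s'.
  by move=> f'; rewrite -[k]add0n; apply: frame_trans f79 f' _ _.
have sub9' k s' : frame [:: 6; 13] [:: 10] k s9 s' -> frame ia ra (l + k) s s'.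
  by move=> /sub9 f'; apply: frame_trans f7 f' _ _.
(* The invariant speaks of the remaining computation: [pickf] on the indices not yet treated,
   started from the current weight and candidate, still returns [j]. *)
apply: wp_seq; apply: (@wp_forF _ 13 _ _ m _ [:: 6; 13] [:: 10] (fun=> 0) (fun i s' =>
  (forall b : nat, b != a -> imem s' 6 0 b = imem s 6 0 b) /\
  exists2 d : 'I_m, imem s' 6 0 a = d &
    pickf l W (pt a) x (drop i (enum 'I_m)) (rmem s' 10 0 0) d = j)) => //.
- by move=> s' k /sub9' f'; rewrite /= (frameI f').
- split=> [b ba|]; first by rewrite /= /update /= (negPf ba) i67.
  exists a; first by rewrite /= /update /= eqxx.
  by rewrite drop0 jE.
- move=> i s' li f' vi [Jo [d d6 dj]]; have fs := sub9' _ _ f'; have f7' := sub9 _ _ f'.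
  have v11 : imem s' 11 0 0 = a by rewrite (frameI fs).
  have r2 : rmem s' 2 i i = W (Ordinal li) (Ordinal li) by rewrite (frameR f7') // -W7.
  have rx : rmem s' 6 0 0 = x by rewrite (frameR f7').
  have r7 : rmem s' 7 0 0 = (2 ^ l)%:R%R by rewrite (frameR fs).
  have r9 : rmem s' 9 0 0 = tot2 l W (pt a) by rewrite (frameR f7').
  move: dj; rewrite (drop_enum_ord (Ordinal li)) /= => dj.
  apply: (@wp_if_heavy W a (Ordinal li)) => //.
  + by move=> b k; rewrite (frameI fs).
  + by rewrite (frameR f7').
  + move=> hv; rewrite hv in dj; apply: wp_seq.
    apply: wp_if; rewrite /= r7 rx r9 => hb.
      apply: wp_iassign; apply: wp_rassign; rewrite /= v11 vi /=.
      split=> //; first by apply: frame_rset => //; apply: frame_iset.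
      split=> [b ba|]; first by rewrite /= /update /= (negPf ba) Jo.
      exists (Ordinal li); first by rewrite /= /update /= eqxx.
      by rewrite /= /update /= vi r2; move: dj; rewrite hb.
    apply: wp_skip; apply: wp_rassign; rewrite /= vi /=.
    split=> //; first by apply: frame_rset.
    split=> //; exists d => //.
    by rewrite /= /update /= r2; move: dj; rewrite (negPf hb).
  + move=> hv; split=> //; split=> //; exists d => //.
    by move: dj; rewrite (negPf hv).
move=> s10 f910 [Jo [d d6 dj]]; have f10 := sub9' _ _ f910; rewrite addn0 in f10.
rewrite drop_oversize ?size_enum_ord //= in dj; rewrite {}dj in d6.
have r110 : rmem s10 1 = rmem s 1 by rewrite (frameR (sub9 _ _ f910)).
have v10 : imem s10 11 0 0 = a by rewrite (frameI f10).
apply: wp_seq; apply: (@wp_rfill _ 13 1 a _ _ m _ (fun=> 0%R)).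
- by move=> s' k f'; rewrite /= (frameI f') // (frameI f10).
- by move=> i s' li f' vi _; apply: wp_rassign; rewrite /= vi (frameI f') // v10.
move=> s11 f11 U11.
have v11 : imem s11 11 0 0 = a by rewrite (frameI f11).
have i11 : imem s11 6 = imem s10 6 by rewrite (frameI f11).
apply: wp_rassign; rewrite /= v11 i11 d6; apply: hQ.
- apply: frame_rset => //; rewrite -[l]addn0.
  by apply: frame_trans f10 f11 _ _.
- by rewrite /= i11.
- by move=> b ba; rewrite /= i11 Jo.
- apply/matrixP => i z; rewrite !mxE (ord1 z) /= /update /= eqxx /= U11 eqxx ltn_ord /=.
  by rewrite -val_eqE /= andbT; case: eqP.
- move=> b ba; apply/matrixP => i z; rewrite !mxE /= /update /= (negPf ba) /= U11 (negPf ba) /=.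
  by rewrite r110.
Qed.

End Stages.

(** The outcome is evaluated by an elimination that skips nothing. The best value starts at 0 and is
    replaced only by a strictly larger one, so outcomes with repeated picks are never stored. *)
Definition Trial : prog :=
  Seq Sample
  (Seq (For 11 em (IfPos (row0 4 11) Stage))
  (Seq (IAssign 7 c0 c0 em)
  (Seq Eliminate
    (If (RLe (rcell 5) (rcell 11)) Skip
      (Seq (rassign 11 (rcell 5))
      (Seq (For 13 em (IAssign 3 c0 (cell 13) (IConst 0)))
           (For 13 em (IfPos (row0 4 13) (IAssign 3 c0 (row0 6 13) (IConst 1)))))))))).

Definition trial_time m : nat :=
  seq_time (sample_time m) (seq_time (for_time m (if_time (stage_time m) 1))
    (seq_time 1 (seq_time (eliminate_time m)
    (if_time 1 (seq_time 1 (seq_time (for_time m 1) (for_time m (if_time 1 1)))))))).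

Section TrialCorrect.
Variables (R : realType) (m : nat) (L : 'M[R]_m) (S0 : {set 'I_m}) (pt : 'I_m -> {set 'I_m}).
Implicit Types (s : state R) (Q : state R -> Prop).
Hypothesis pL : psd L.

Local Notation l := (m + 7)%N.
Local Notation bv := (@basis_vec R m).
Local Notation upto := (slots_below S0).

Definition from i : seq 'I_m := [seq a <- drop i (enum 'I_m) | a \in S0].

Lemma from_S (a : 'I_m) : from a = if a \in S0 then a :: from a.+1 else from a.+1.
Proof. by rewrite /from drop_enum_ord. Qed.

Lemma upto_all : upto m = [seq a <- enum 'I_m | a \in S0].
Proof. by rewrite /slots_below take_oversize // size_enum_ord. Qed.

Lemma from0 : from 0 = upto m.
Proof. by rewrite upto_all /from drop0. Qed.

Lemma skip_filter (a : 'I_m) :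
  [seq b <- enum 'I_m | (b \in S0) && (val b != a)] = upto a ++ from a.+1.
Proof.
have E := cat_take_drop a (enum 'I_m); rewrite drop_enum_ord in E.
have := enum_uniq 'I_m; rewrite -E cat_uniq /= negb_or => /and4P [_ /andP [na _] na' _].
have ne (bs : seq 'I_m) b : a \notin bs -> b \in bs -> val b != a.
  by move=> an bbs; apply: contraNneq an => /val_inj <-.
rewrite filter_cat /= eqxx andbF; congr (_ ++ _); apply: eq_in_filter => b hb.
  by rewrite (ne _ _ na hb) andbT.
by rewrite (ne _ _ na' hb) andbT.
Qed.

Lemma rounds_take k D (sl : seq 'I_m) xs n w : size sl * k <= n ->
  rounds L k pt D sl xs (take n w) = rounds L k pt D sl xs w.
Proof.
elim: sl D xs n w => [|a sl IH] D [|x xs] n w //=; rewrite mulSn => h.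
rewrite take_takel; last by lia.
have -> : drop k (take n w) = take (n - k) (drop k w) by rewrite take_drop subnK //; lia.
by apply: IH; lia.
Qed.

Lemma rounds_mem k D (sl1 sl : seq 'I_m) xs w : (forall a, a \in pt a) -> size xs = size sl ->
  all2 (fun a j => j \in pt a) sl1 D ->
  all2 (fun a j => j \in pt a) (sl1 ++ sl) (rounds L k pt D sl xs w).
Proof.
move=> apt; elim: sl D sl1 xs w => [|a sl IH] D sl1 [|x xs] w //= => [_|[sz]] h.
  by rewrite cats0.
rewrite -cat_rcons; apply: IH => //.
move: h; rewrite !all2E !size_rcons => /andP [/eqP sD h].
by rewrite sD eqxx zip_rcons // all_rcons h /= andbT; apply: pick_mem.
Qed.

Lemma wp_trial Q s : imem s 0 0 0 = m -> mat_at 0 s L -> reads_set 4 s S0 -> reads_rel pt s ->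
  rmem s 7 0 0 = (2 ^ l)%:R%R -> trial_coins l (upto m) <= size (coins s) ->
  (forall s' D, D = trial L l pt (upto m) (take (trial_coins l (upto m)) (coins s)) ->
     frame [:: 3; 6; 7; 8; 11; 12; 13; 14; 15] [:: 1; 2; 3; 4; 5; 6; 8; 9; 10; 11]
       (trial_coins l (upto m)) s s' ->
     ((mvol L D [::] <= rmem s 11 0 0)%R /\ imem s' 3 = imem s 3 /\ rmem s' 11 = rmem s 11) \/
     ((rmem s 11 0 0 < mvol L D [::])%R /\ rmem s' 11 0 0 = mvol L D [::] /\
        forall j : 'I_m, (0 < imem s' 3 0 j) = (j \in D)) -> Q s') ->
  wp Trial (trial_time m) Q s.
Proof.
move=> sm Ls S0s srel sQ sz hQ.
pose ia := [:: 3; 6; 7; 8; 11; 12; 13; 14; 15].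
pose ra := [:: 1; 2; 3; 4; 5; 6; 8; 9; 10; 11].
pose n1 := size (upto m) * (m * l).
have n1K : n1 <= trial_coins l (upto m) by rewrite leq_addr.
set D0 := trial _ _ _ _ _ in hQ.
apply: wp_seq; apply: (wp_sample (S0 := S0) (pt := pt)) => //; first by apply: leq_trans sz.
move=> s1 f01 u1; rewrite -/n1 in f01.
have f1 : frame ia ra n1 s s1.
  by rewrite -[n1]add0n; apply: frame_trans (frame_refl _ _ _) f01 _ _.
have c1 := frameC f1.
have D0E : D0 = rounds L l pt [::] (from 0) [seq uvec m s1 (a : 'I_m) | a <- from 0] (coins s1).
  rewrite from0 u1 c1 /D0 /trial -/n1 take_takel // xvecs_take //.
  have -> : drop n1 (take (trial_coins l (upto m)) (coins s))
     = take (size (upto m) * l) (drop n1 (coins s)).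
    by rewrite take_drop; congr (drop _ (take _ _)); rewrite /trial_coins addnC.
  by rewrite rounds_take.
have le_upto i : size (upto i) <= size (upto m).
  rewrite upto_all -(cat_take_drop i (enum 'I_m)) filter_cat size_cat.
  exact: leq_addr.
(* [D] lists the picks made so far; running [rounds] from here on the remaining slots and the
   remaining coins still yields [D0]. *)
apply: wp_seq; apply: (@wp_forF _ 11 _ _ m _ [:: 6; 7; 8; 11; 12; 13; 14; 15]
  [:: 1; 2; 3; 4; 5; 6; 8; 9; 10] (fun i => size (upto i) * l) (fun i s' =>
  exists D : seq 'I_m, [/\ [seq uvec m s' (b : 'I_m) | b <- upto i] = map bv D,
    [seq imem s' 6 0 (b : 'I_m) | b <- upto i] = map val D &
    D0 = rounds L l pt D (from i) [seq uvec m s' (b : 'I_m) | b <- from i] (coins s')])) => //.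
- by rewrite /slots_below take0.
- by move=> s' k f'; rewrite /= (frameI f') // (frameI f1).
- by exists [::]; rewrite /slots_below take0.
- move=> i s' li f' vi [D [uD iD DE]]; pose a := Ordinal li.
  have fs : frame ia ra (n1 + size (upto i) * l) s s' by apply: frame_trans f1 f' _ _.
  have i4 : imem s' 4 0 i = imem s 4 0 a by rewrite (frameI fs).
  have cs := frameC f'.
  apply: wp_if; rewrite /= vi i4 S0s => aS; last first.
    apply: wp_skip; rewrite (upto_S _ a) (negPf aS); split=> //; exists D; split=> //.
    by rewrite DE (from_S a) (negPf aS).
  have usz : size (upto i.+1) = (size (upto i)).+1 by rewrite (upto_S _ a) aS size_rcons.
  have us : [seq uvec m s' (b : 'I_m) | b <- enum 'I_m & (b \in S0) && (val b != a)]
      = map bv D ++ [seq uvec m s' (b : 'I_m) | b <- from i.+1].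
    by rewrite skip_filter map_cat uD.
  apply: (@wp_stage _ _ L S0 pt pL a _ _ _ _ _ _ _ _ _ _ _ erefl erefl) => //.
  + by rewrite (frameI fs).
  + by move=> b k; rewrite (frameR fs) //.
  + by move=> b; rewrite (frameI fs).
  + by move=> b k; rewrite (frameI fs).
  + by rewrite (frameR fs).
  + rewrite cs c1 !size_drop; have := le_upto i.+1; rewrite usz.
    by move: sz; rewrite /trial_coins /n1; nia.
  rewrite us; move=> s2 f2 p2 po u2 uo; split.
  + by rewrite usz mulSn addnC; apply: frame_trans f' f2 _ _.
  + by rewrite (frameI f2).
  set j := pick _ _ _ _ _ in p2 u2.
  have before_a b : b \in upto i -> val b != a.
    by move/mem_upto => bi; rewrite neq_ltn bi.
  have after_a b : b \in from i.+1 -> val b != a.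
    have : uniq (from i) by rewrite filter_uniq // drop_uniq // enum_uniq.
    rewrite (from_S a) aS /= => /andP [an _] bf.
    apply: contraNneq an => ba; have -> // : a = b by apply/val_inj; symmetry.
  exists (rcons D j); rewrite (upto_S _ a) aS !map_rcons p2 u2 -uD -iD; split.
  + by congr rcons; apply/eq_in_map => b /before_a; apply: uo.
  + by congr rcons; apply/eq_in_map => b /before_a; apply: po.
  + rewrite DE (from_S a) aS /= (frameC f2).
    have -> // : [seq uvec m s2 (b : 'I_m) | b <- from i.+1] = [seq uvec m s' (b : 'I_m) | b <- from i.+1].
    by apply/eq_in_map => b /after_a; apply: uo.
move=> s2 f12 [D [uD iD DE]].
have {}DE : D0 = D by rewrite DE /from drop_oversize // size_enum_ord.
rewrite -{}DE {D} in uD iD.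
have f2 : frame ia ra (trial_coins l (upto m)) s s2.
  by apply: frame_trans f1 f12 _ _.
apply: wp_seq; apply: wp_iassign.
have -> : ieval s2 em = m by rewrite /= (frameI f2).
rewrite [ieval s2 c0]/=; set s3 := iset _ _ _ _ _.
have f3 : frame ia ra (trial_coins l (upto m)) s s3 by apply: frame_iset.
apply: wp_seq; apply: (@wp_eliminate _ _ L S0 m) => //.
- by rewrite (frameI f3).
- by move=> i k; rewrite (frameR f3).
- by move=> i; rewrite (frameI f3).
move=> s4 f34 /= _ v4.
have us : [seq uvec m s3 (b : 'I_m) | b <- enum 'I_m & (b \in S0) && (val b != m)] = map bv D0.
  rewrite -uD upto_all; apply: congr1; apply: eq_filter => b.
  by rewrite neq_ltn (ltn_ord b) andbT.
have {us}v4 : rmem s4 5 0 0 = mvol L D0 [::] by rewrite v4 us /mvol cats0.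
have f4 : frame ia ra (trial_coins l (upto m)) s s4.
  by rewrite -[trial_coins _ _]addn0; apply: frame_trans f3 f34 _ _.
have r11 : rmem s4 11 = rmem s 11 by rewrite (frameR f34) // (frameR f12) // (frameR f01).
have i3 : imem s4 3 = imem s 3.
  have -> : imem s4 3 = imem s2 3 by rewrite (frameI f34).
  by rewrite (frameI f12) // (frameI f01).
have i6 : imem s4 6 = imem s2 6 by rewrite (frameI f34).
apply: wp_if => /= hb.
  by apply: wp_skip; apply: (hQ _ D0) => //; left; rewrite -r11 -v4.
move: hb; rewrite -ltNge v4 r11 => hb.
apply: wp_seq; apply: wp_rassign; set s5 := rset _ _ _ _ _.
have f5 : frame ia ra (trial_coins l (upto m)) s s5 by apply: frame_rset.
have sub5 k s' : frame [:: 3; 13] [::] k s5 s' -> frame ia ra (trial_coins l (upto m) + k) s s'.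
  by move=> f'; apply: frame_trans f5 f' _ _.
apply: wp_seq; apply: (@wp_forF _ 13 _ _ m _ [:: 3; 13] [::] (fun=> 0) (fun k s' =>
  forall j, j < k -> imem s' 3 0 j = 0)) => //.
- by move=> s' k /sub5 f'; rewrite /= (frameI f').
- move=> i s' li f' vi Ji; apply: wp_iassign; split=> //; first by apply: frame_iset.
  move=> j; rewrite ltnS leq_eqVlt /= /update /= vi; case: eqVneq => //= _; exact: Ji.
move=> s6 f56 z6; have f6 := sub5 _ _ f56; rewrite addn0 in f6.
have i66 : imem s6 6 = imem s2 6 by rewrite (frameI f56).
apply: (@wp_forF _ 13 _ _ m _ [:: 3; 13] [::] (fun=> 0) (fun k s' =>
  forall j : 'I_m, (0 < imem s' 3 0 j) =
     (val j \in [seq imem s2 6 0 (b : 'I_m) | b <- upto k]))) => //.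
- by move=> s' k f'; rewrite /= (frameI f') // (frameI f6).
- by move=> j; rewrite /slots_below take0 z6.
- move=> i s' li f' vi Ji; pose a := Ordinal li.
  have i4 : imem s' 4 0 i = imem s 4 0 a by rewrite (frameI f') // (frameI f6).
  have i6' : imem s' 6 = imem s2 6 by rewrite (frameI f').
  apply: wp_if; rewrite /= vi i4 S0s => aS; last first.
    by apply: wp_skip; split=> // j; rewrite (upto_S _ a) (negPf aS).
  apply: wp_iassign; split=> //; first by apply: frame_iset.
  move=> j; rewrite (upto_S _ a) aS map_rcons mem_rcons inE /= /update /= vi i6'.
  by case: eqVneq => //= _; apply: Ji.
move=> s7 f67 o7; apply: (hQ _ D0) => //.
  by rewrite -[trial_coins _ _]addn0; apply: frame_trans f6 f67 _ _.
right; split=> //; split.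
  by rewrite (frameR f67) // (frameR f56) //= /update /= v4.
by move=> j; rewrite o7 iD mem_map //; apply: val_inj.
Qed.

End TrialCorrect.

(** * Preparation: grid size, parts and slots *)

Definition GridSize : prog :=
  Seq (rassign 7 (RConst 1))
    (For 13 (IAdd em (IConst 7)) (rassign 7 (RAdd (rcell 7) (rcell 7)))).

Definition SamePart : prog :=
  For 11 et (For 13 em (IfPos (icell2 1 11 13)
    (For 14 em (IfPos (icell2 1 11 14) (IAssign 5 (cell 13) (cell 14) (IConst 1)))))).

(** The first b_i members of each part serve as names of its slots. They are also written to the
    output array, which therefore holds a member of the family even if no trial ever succeeds. *)
Definition Slots : prog :=
  For 11 et
    (Seq (IAssign 9 c0 c0 (ICell 2 (cell 11) c0))
      (For 13 em (IfPos (icell2 1 11 13) (IfPos (cell 9)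
        (Seq (IAssign 4 c0 (cell 13) (IConst 1))
        (Seq (IAssign 3 c0 (cell 13) (IConst 1))
             (IAssign 9 c0 c0 (ISub (cell 9) (IConst 1))))))))).

Definition grid_time m : nat := seq_time 1 (for_time (m + 7) 1).
Definition same_time m t : nat :=
  for_time t (for_time m (if_time (for_time m (if_time 1 1)) 1)).
Definition slots_time m t : nat :=
  for_time t (seq_time 1 (for_time m (if_time (if_time (seq_time 1 (seq_time 1 1)) 1) 1))).

Section SetupCorrect.
Variables (R : realType) (m t : nat) (M : 'I_t -> {set 'I_m}) (b : 'I_t -> nat).
Implicit Types (s : state R) (Q : state R -> Prop).

Local Notation l := (m + 7)%N.

Definition part_of (a : 'I_m) : {set 'I_m} := [set j | [exists i, (a \in M i) && (j \in M i)]].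

Definition reads_parts s : Prop := forall i (j : 'I_m), (0 < imem s 1 (i : 'I_t) j) = (j \in M i).

Lemma wp_grid Q s : imem s 0 0 0 = m ->
  (forall s', frame [:: 13] [:: 7] 0 s s' -> rmem s' 7 0 0 = (2 ^ l)%:R%R -> Q s') ->
  wp GridSize (grid_time m) Q s.
Proof.
move=> sm hQ; apply: wp_seq; apply: wp_rassign; set s0 := rset _ _ _ _ _.
have f0 : frame [:: 13] [:: 7] 0 s s0 by apply: frame_rset => //; apply: frame_refl.
have sub k s' : frame [:: 13] [:: 7] k s0 s' -> frame [:: 13] [:: 7] k s s'.
  by move=> f'; rewrite -[k]add0n; apply: frame_trans f0 f' _ _.
apply: (@wp_forF _ 13 _ _ _ _ [:: 13] [:: 7] (fun=> 0) (fun i s' =>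
  rmem s' 7 0 0 = (2 ^ i)%:R%R)) => //.
- by move=> s' k /sub f'; rewrite /= (frameI f') // sm.
- move=> i s' li f' vi Ji; apply: wp_rassign; split=> //; first by apply: frame_rset.
  by rewrite /= /update /= Ji expnS mul2n -addnn natrD.
- by move=> s' /sub f' e'; apply: hQ.
Qed.

Lemma wp_same Q s : imem s 0 0 0 = m -> imem s 0 0 1 = t -> reads_parts s ->
  (forall i j, imem s 5 i j = 0) ->
  (forall s', frame [:: 5; 11; 13; 14] [::] 0 s s' -> reads_rel part_of s' -> Q s') ->
  wp SamePart (same_time m t) Q s.
Proof.
move=> sm st sp z5 hQ.
pose P i (a j : 'I_m) := [exists i' : 'I_t, [&& i' < i, a \in M i' & j \in M i']].
apply: (@wp_forF _ 11 _ _ t _ [:: 5; 11; 13; 14] [::] (fun=> 0) (fun i s' =>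
  forall a j : 'I_m, (0 < imem s' 5 a j) = P i a j)) => //.
- by move=> s' k f'; rewrite /= (frameI f').
- by move=> a j; rewrite z5; apply/esym/negbTE/existsP => -[i'].
- move=> i s1 li f1 vi Ji; pose io := Ordinal li.
  have PS a j : P i.+1 a j = P i a j || ((a \in M io) && (j \in M io)).
    apply/existsP/orP => [[i' /and3P [h1 h2 h3]]|[/existsP [i' /and3P [h1 h2 h3]]|/andP [h2 h3]]].
    - move: h1; rewrite ltnS leq_eqVlt => /orP [/eqP h|h].
        by right; have -> : io = i' by [apply/val_inj]; rewrite h2 h3.
      by left; apply/existsP; exists i'; rewrite h h2 h3.
    - by exists i'; rewrite h2 h3 (leq_trans h1).
    - by exists io; rewrite h2 h3 /= ltnS leqnn.
  apply: (@wp_forF _ 13 _ _ m _ [:: 5; 13; 14] [::] (fun=> 0) (fun k s' =>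
    forall a j : 'I_m, (0 < imem s' 5 a j) =
      P i a j || [&& a < k, a \in M io & j \in M io])) => //.
  + by move=> s' k f'; rewrite /= (frameI f') // (frameI f1).
  + by move=> a j; rewrite Ji orbF.
  + move=> k s2 lk f2 vk Jk; pose ko := Ordinal lk.
    have v11 : imem s2 11 0 0 = i by rewrite (frameI f2).
    have i1 : imem s2 1 = imem s 1 by rewrite (frameI f2) // (frameI f1).
    have stepk (a : 'I_m) : (a < k.+1) = (a == ko) || (a < k) by rewrite ltnS leq_eqVlt.
    apply: wp_if; rewrite /= v11 vk i1 (sp io ko) => kM; last first.
      apply: wp_skip; split=> // a j; rewrite Jk stepk.
      by case: (eqVneq a ko) => [->|_]; rewrite ?(negPf kM) ?andbF.
    apply: (@wp_forF _ 14 _ _ m _ [:: 5; 14] [::] (fun=> 0) (fun q s' =>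
      forall a j : 'I_m, (0 < imem s' 5 a j) =
        [|| P i a j, [&& a < k, a \in M io & j \in M io] | [&& a == ko, j < q & j \in M io]])) => //.
    * by move=> s' n f'; rewrite /= (frameI f') // (frameI f2) // (frameI f1).
    * by move=> a j; rewrite Jk andbF orbF.
    * move=> q s3 lq f3 vq Jq; pose qo := Ordinal lq.
      have v11' : imem s3 11 0 0 = i by rewrite (frameI f3).
      have v13 : imem s3 13 0 0 = k by rewrite (frameI f3).
      have i1' : imem s3 1 = imem s 1 by rewrite (frameI f3).
      have stepq (j : 'I_m) : (j < q.+1) = (j == qo) || (j < q) by rewrite ltnS leq_eqVlt.
      apply: wp_if; rewrite /= v11' vq i1' (sp io qo) => qM; last first.
        apply: wp_skip; split=> // a j; rewrite Jq stepq.
        by case: (eqVneq j qo) => [->|_]; rewrite ?(negPf qM) ?andbF.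
      apply: wp_iassign; split=> //; first by apply: frame_iset.
      move=> a j; rewrite /= /update /= v13 vq stepq.
      rewrite -[k]/(val ko) -[q]/(val qo) !val_eqE.
      case: (eqVneq a ko) => [->|ak] /=; last by rewrite Jq (negPf ak).
      case: (eqVneq j qo) => [->|jq] /=; first by rewrite qM !orbT.
      by have /= -> := Jq ko j; rewrite eqxx.
    * move=> s3 f3 J3; split.
      - by rewrite -[0]addn0; apply: frame_trans f2 f3 _ _.
      - by rewrite (frameI f3).
      - move=> a j; rewrite J3 stepk ltn_ord /=.
        by case: (eqVneq a ko) => [->|] //=; rewrite ?kM ?orbF ?ltnn.
  + move=> s2 f2 J2; split.
    * by rewrite -[0]addn0; apply: frame_trans f1 f2 _ _.
    * by rewrite (frameI f2).
    * by move=> a j; rewrite J2 PS ltn_ord.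
- move=> s' f' J'; apply: hQ => // a j; rewrite J' inE.
  by apply: eq_existsb => i; rewrite ltn_ord.
Qed.

Hypothesis pM : is_partition M.
Hypothesis bM : forall i, b i <= #|M i|.

Definition slots_of i : {set 'I_m} :=
  [set j in M i | #|M i :&: [set k : 'I_m | k < j]| < b i].

Definition slots : {set 'I_m} := \bigcup_i slots_of i.

Lemma wp_slots Q s : imem s 0 0 0 = m -> imem s 0 0 1 = t -> reads_parts s ->
  (forall i : 'I_t, imem s 2 i 0 = b i) ->
  (forall j, imem s 3 0 j = 0) -> (forall j, imem s 4 0 j = 0) ->
  (forall s', frame [:: 3; 4; 9; 11; 13] [::] 0 s s' -> slots \in partition_family M b ->
     reads_set 4 s' slots -> reads_set 3 s' slots -> Q s') ->
  wp Slots (slots_time m t) Q s.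
Proof.
move=> sm st sp sb z3 z4 hQ; have [_ dM cM] := pM.
apply: (@wp_forF _ 11 _ _ t _ [:: 3; 4; 9; 11; 13] [::] (fun=> 0) (fun i s' =>
  exists S : {set 'I_m}, [/\ reads_set 4 s' S, reads_set 3 s' S,
      forall i' : 'I_t, i' < i -> S :&: M i' = slots_of i'
    & forall i' : 'I_t, #|S :&: M i'| = if i' < i then b i' else 0])) => //.
- by move=> s' k f'; rewrite /= (frameI f').
- exists set0; split=> // [j|j|i']; first by rewrite z4 inE.
    by rewrite z3 inE.
  by rewrite set0I cards0.
- move=> i s1 li f1 vi [S [S4 S3 SE SM]]; pose io := Ordinal li.
  apply: wp_seq; apply: wp_iassign; rewrite /= vi.
  have -> : imem s1 2 i 0 = b io by rewrite (frameI f1) // -sb.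
  set s2 := iset _ _ _ _ _.
  have f2 : frame [:: 3; 4; 9; 11; 13] [::] 0 s s2 by apply: frame_iset.
  have S0 : S :&: M io = set0.
    by apply/eqP; rewrite -cards_eq0 SM /= ltnn.
  pose first k := M io :&: [set j : 'I_m | j < k].
  have firstE (ko : 'I_m) : first ko.+1 = if ko \in M io then ko |: first ko else first ko.
    apply/setP => j; rewrite /first !inE ltnS leq_eqVlt val_eqE.
    case: (boolP (ko \in M io)) => kM; rewrite !inE; case: (eqVneq j ko) => [->|] //=.
      by rewrite kM.
    by rewrite (negPf kM).
  have firstS (ko : 'I_m) : #|first ko.+1| = (ko \in M io) + #|first ko|.
    rewrite firstE.
    case: ifP => kM //; rewrite cardsU1 /first !inE ltnn andbF //.
  (* Among the members of the part below [k], exactly those with fewer than [b io] predecessors in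
     the part are taken; array 9 holds the demand still open. *)
  apply: (@wp_forF _ 13 _ _ m _ [:: 3; 4; 9; 13] [::] (fun=> 0) (fun k s' =>
    exists S' : {set 'I_m}, [/\ reads_set 4 s' S', reads_set 3 s' S',
      forall i', i' != io -> S' :&: M i' = S :&: M i',
      S' :&: M io = [set j in first k | #|first (j : 'I_m)| < b io]
      & #|S' :&: M io| = minn (b io) #|first k| /\ imem s' 9 0 0 = b io - #|S' :&: M io|])) => //.
  + by move=> s' k f'; rewrite /= (frameI f') // (frameI f2).
  + have first0 : first 0 = set0 by apply/setP => j; rewrite !inE andbF.
    exists S; split=> //; rewrite S0 first0 ?cards0 ?subn0 ?minn0 //.
    by apply/setP => j; rewrite !inE.
  + move=> k s3 lk f3 vk [S' [S4' S3' So Sf [Sc Sn]]]; pose ko := Ordinal lk.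
    have v11 : imem s3 11 0 0 = i by rewrite (frameI f3).
    have i1 : imem s3 1 = imem s 1 by rewrite (frameI f3) // (frameI f2).
    have fS := firstS ko; have fE := firstE ko; rewrite /= in fS fE.
    apply: wp_if; rewrite /= v11 vk i1 (sp io ko) => kM; last first.
      rewrite (negPf kM) in fE.
      by apply: wp_skip; split=> //; exists S'; split=> //; rewrite fE.
    rewrite kM in fE; rewrite kM add1n in fS.
    apply: wp_if; rewrite /= Sn => hc; last first.
      apply: wp_skip; split=> //; exists S'; split=> //.
        rewrite Sf fE; apply/setP => j; rewrite [LHS]inE [RHS]inE in_setU1.
        case: (eqVneq j ko) => [->|_] //=; rewrite /first !inE ltnn andbF /=.
        apply/esym/negbTE; rewrite -leqNgt -/(first k); move: hc Sc.
        by move: #|S' :&: M io| #|first k| (b io) => x f bb; lia.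
      rewrite fS; split=> //; move: hc Sc; move: #|S' :&: M io| #|first k| (b io) => x f bb; lia.
    have kS : ko \notin S'.
      apply/negP => kS; have : ko \in S' :&: M io by rewrite inE kS.
      by rewrite Sf !inE ltnn andbF.
    apply: wp_seq; apply: wp_iassign; apply: wp_seq; apply: wp_iassign; apply: wp_iassign.
    split=> //; first by do 3 apply: frame_iset => //.
    have SU : (ko |: S') :&: M io = ko |: (S' :&: M io).
      by apply/setP => j; rewrite !inE; case: eqVneq => [->|].
    have SUc : #|(ko |: S') :&: M io| = #|S' :&: M io|.+1.
      by rewrite SU cardsU1 inE (negPf kS).
    exists (ko |: S'); split.
    * move=> j; rewrite /= /update /= vk -[k]/(val ko) val_eqE !inE.
      by case: eqVneq => //= _; apply: S4'.
    * move=> j; rewrite /= /update /= vk -[k]/(val ko) val_eqE !inE.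
      by case: eqVneq => //= _; apply: S3'.
    * move=> i' ii; rewrite -So //; apply/setP => j; rewrite !inE.
      case: eqVneq => [->|_] //=; rewrite (negPf kS) /=.
      by apply/negP => kM'; have := disjointFr (dM _ _ ii) kM'; rewrite kM.
    * rewrite SU Sf fE; apply/setP => j; rewrite in_setU1 [in LHS]inE [RHS]inE in_setU1.
      case: (eqVneq j ko) => [->|_] //=; apply/esym; move: hc Sc.
      rewrite -[k]/(val ko).
      by move: #|S' :&: M io| #|first ko| (b io) => x f bb; lia.
    * rewrite SUc fS /= /update /= Sn; split; first by move: hc Sc; move: #|S' :&: M io| #|first k| (b io) => x f bb; lia.
      by move: #|S' :&: M io| => x; rewrite subn1 subnS.
  + move=> s3 f3 [S' [S4' S3' So Sf [Sc Sn]]]; split.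
    * by rewrite -[0]addn0; apply: frame_trans f2 f3 _ _.
    * by rewrite (frameI f3).
    have firstm : first m = M io by apply/setP => j; rewrite !inE ltn_ord andbT.
    exists S'; split=> // i'; rewrite ltnS leq_eqVlt.
      case: (eqVneq i' io) => [-> _|ii].
        by rewrite Sf firstm.
      rewrite (_ : (val i' == i) = false) /=; last by apply/negbTE; apply: contraNneq ii => h; apply/eqP/val_inj.
      by move=> /SE <-; apply: So.
    case: (eqVneq i' io) => [->|ii].
      by rewrite Sc /= eqxx; apply/minn_idPl; rewrite firstm.
    by rewrite So // SM (_ : (val i' == i) = false) //; apply/negbTE; apply: contraNneq ii => h; apply/eqP/val_inj.
- move=> s' f' [S [S4 S3 SE SM]].
  have E : S = slots.
    rewrite -[S]setIT -cM big_distrr /=; apply: eq_bigr => i _.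
    by rewrite SE.
  apply: hQ; rewrite -?E //.
  by rewrite inE; apply/forallP => i; rewrite SM ltn_ord.
Qed.

End SetupCorrect.

(** Indices cannot be multiplied, so 9 c m is written as 9 c additions of m. The 9 is chosen so that
    (23/25)^9 <= 1/2. *)
Definition trials (c : nat) : iexp := iter (9 * c) (IAdd em) (IConst 0).

Definition Main (c : nat) : prog :=
  Seq GridSize (Seq SamePart (Seq Slots (For 10 (trials c) Trial))).

Definition main_time c m t : nat :=
  seq_time (grid_time m) (seq_time (same_time m t) (seq_time (slots_time m t)
    (for_time (9 * c * m) (trial_time m)))).

Section MainCorrect.
Variables (R : realType) (c m t : nat) (L : 'M[R]_m) (M : 'I_t -> {set 'I_m}) (b : 'I_t -> nat).
Implicit Types (s : state R) (D : seq 'I_m).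
Hypothesis pL : psd L.
Hypothesis pM : is_partition M.
Hypothesis F0 : partition_family M b != set0.

Local Notation l := (m + 7)%N.
Local Notation bv := (@basis_vec R m).
Local Notation pt := (part_of M).

Definition slot_seq : seq 'I_m := enum (slots M b).
Local Notation K := (trial_coins l slot_seq).

Lemma slot_seqE : slots_below (slots M b) m = slot_seq.
Proof. by rewrite upto_all enumT. Qed.

Lemma b_le_card i : b i <= #|M i|.
Proof.
have [S] := set0Pn _ F0; rewrite inE => /forallP /(_ i) /eqP <-.
by rewrite subset_leq_card // subsetIr.
Qed.

Lemma part_of_eq a i : a \in M i -> pt a = M i.
Proof.
move=> aM; have [_ dM _] := pM; apply/setP => j; rewrite inE; apply/existsP/idP => [[i' /andP [a' j']]|jM].
  case: (eqVneq i' i) => [<- //|ii].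
  by have := disjointFr (dM _ _ ii) a'; rewrite aM.
by exists i; rewrite aM.
Qed.

Lemma part_of_ex a : exists i, a \in M i.
Proof.
have [_ _ cM] := pM; have : a \in \bigcup_i M i by rewrite cM inE.
by case/bigcupP => i _ aM; exists i.
Qed.

Lemma mem_part_of a : a \in pt a.
Proof. by have [i aM] := part_of_ex a; rewrite (part_of_eq aM). Qed.

Lemma part_of_mem a j i : j \in pt a -> (j \in M i) = (a \in M i).
Proof.
have [_ dM _] := pM; have [i' aM] := part_of_ex a; rewrite (part_of_eq aM) => jM.
case: (eqVneq i' i) => [<-|ii]; first by rewrite jM aM.
by rewrite (disjointFr (dM _ _ ii) jM) (disjointFr (dM _ _ ii) aM).
Qed.

Lemma basis_vec_inj : injective bv.
Proof.
move=> i j /matrixP /(_ i 0%R); rewrite !mxE !eqxx andbT; case: eqVneq => // _ /eqP.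
by rewrite oner_eq0.
Qed.

Lemma card_uniq_set D (A : {set 'I_m}) : uniq D -> #|[set j in D] :&: A| = count [in A] D.
Proof.
move=> uD; rewrite -size_filter; have /card_uniqP <- : uniq [seq j <- D | j \in A].
  by rewrite filter_uniq.
by apply: eq_card => j; rewrite !inE mem_filter andbC.
Qed.

(** Each pick shares the part of its slot, so both lists meet every part equally often; without
    repetitions these counts are cardinalities. *)
Lemma family_of_picks (sl D : seq 'I_m) :
  all2 (fun a j => j \in pt a) sl D -> uniq sl -> uniq D ->
  ([set j in D] \in partition_family M b) = ([set j in sl] \in partition_family M b).
Proof.
move=> al us uD; rewrite !inE; apply: eq_forallb => i; rewrite !card_uniq_set //.
congr (_ == _); elim: sl D al {us uD} => [|a sl IH] [|j D] //= /andP [ja al].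
by rewrite (part_of_mem _ ja) IH.
Qed.

Lemma mvol_det D : uniq D -> mvol L D [::] = (\det (principal_submx L [set j in D]))%R.
Proof.
move=> uD; rewrite -vol_principal // /mvol cats0; apply: vol_perm => //.
by apply: perm_map; apply: uniq_perm; rewrite ?enum_uniq // => j; rewrite mem_enum inE.
Qed.

Lemma det_psd_ge0 (S : {set 'I_m}) : (0 <= \det (principal_submx L S))%R.
Proof. by rewrite -vol_principal // vol_ge0. Qed.

Lemma wp_main w : 9 * c * m * K <= size w ->
  wp (Main c) (main_time c m t) (fun s' => exists S : {set 'I_m},
    [/\ S \in partition_family M b, reads_set 3 s' S, slots M b \in partition_family M b
      & forall n, n < 9 * c * m ->
        (mvol L (trial L l pt slot_seq (take K (drop (n * K) w))) [::]
           <= \det (principal_submx L S))%R]) (input L M b w).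
Proof.
move=> sz; set s := input _ _ _ _.
have sm : imem s 0 0 0 = m.
  by rewrite /= /extend; case: insubP => //= i _ _; case: insubP => //= k _ /= k0;
     rewrite -val_eqE /= k0.
have st : imem s 0 0 1 = t.
  by rewrite /= /extend; case: insubP => //= i _ _; case: insubP => //= k _ /= k0;
     rewrite -val_eqE /= k0.
have sp : reads_parts M s by move=> i j; rewrite /= /extend !valK; case: (_ \in _).
have sb i : imem s 2 (i : 'I_t) 0 = b i.
  by rewrite /= /extend valK; case: insubP.
have sL : mat_at 0 s L by move=> i j; rewrite /= /extend !valK.
apply: wp_seq; apply: wp_grid => // s1 f1 q1.
apply: wp_seq; apply: (wp_same (M := M)).
- by rewrite (frameI f1).
- by rewrite (frameI f1).
- by move=> i j; rewrite (frameI f1).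
- by move=> i j; rewrite (frameI f1).
move=> s2 f12 rel2.
have f2 : frame [:: 5; 11; 13; 14] [:: 7] 0 s s2.
  rewrite -[0]addn0; apply: (frame_trans (k1 := 0)) f12 _ _ => //.
  by rewrite -[0]addn0; apply: frame_trans (frame_refl _ _ _) f1 _ _.
apply: wp_seq; apply: (wp_slots pM b_le_card).
- by rewrite (frameI f2).
- by rewrite (frameI f2).
- by move=> i j; rewrite (frameI f2).
- by move=> i; rewrite (frameI f2).
- by move=> j; rewrite (frameI f2).
- by move=> j; rewrite (frameI f2).
move=> s3 f23 SF S4 S3.
have f3 : frame [:: 3; 4; 5; 9; 11; 13; 14] [:: 7] 0 s s3.
  rewrite -[0]addn0; apply: (frame_trans (k1 := 0)) f23 _ _ => //.
  by rewrite -[0]addn0; apply: frame_trans (frame_refl _ _ _) f2 _ _.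
have c3 : coins s3 = w by rewrite (frameC f3) drop0.
have r7 : rmem s3 7 0 0 = (2 ^ l)%:R%R by rewrite (frameR f23) // (frameR f12).
have rel3 : reads_rel pt s3 by move=> a j; rewrite (frameI f23).
have r11 : rmem s3 11 0 0 = 0%R by rewrite (frameR f3).
pose ia := [:: 3; 6; 7; 8; 10; 11; 12; 13; 14; 15].
pose ra := [:: 1; 2; 3; 4; 5; 6; 8; 9; 10; 11].
(* The best value is only a lower bound for the minor of the stored set: at the start it is 0, while
   the minor of the initial slots may be positive. *)
apply: (@wp_forF _ 10 _ _ (9 * c * m) _ ia ra (fun n => n * K) (fun n s' =>
  exists S : {set 'I_m}, [/\ S \in partition_family M b, reads_set 3 s' S,
    (0 <= rmem s' 11 0 0 <= \det (principal_submx L S))%R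
    & forall n', n' < n ->
        (mvol L (trial L l pt slot_seq (take K (drop (n' * K) w))) [::] <= rmem s' 11 0 0)%R])) => //.
- move=> s' k f'; rewrite /trials; elim: (9 * c) => [|n IH] //=.
  by rewrite IH (frameI f') // (frameI f3) // sm mulSn.
- by exists (slots M b); split=> //; rewrite r11 lexx det_psd_ge0.
- move=> n s' ln f' vn [S [SF' S3' best seen]].
  have c' : coins s' = drop (n * K) w by rewrite (frameC f') c3.
  apply: (@wp_trial _ _ L (slots M b) pt pL).
  + by rewrite (frameI f') // (frameI f3).
  + by move=> i j; rewrite (frameR f') // (frameR f3).
  + by move=> j; rewrite (frameI f').
  + by move=> i j; rewrite (frameI f').
  + by rewrite (frameR f').
  + by rewrite slot_seqE c' size_drop; move: sz; nia.
  rewrite slot_seqE c' => s4 D DE f4 h; split.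
  + by rewrite mulSn addnC; apply: frame_trans f' f4 _ _.
  + by rewrite (frameI f4).
  case: h => [[vle [i3 r4]]|[vgt [r4 i3]]].
    exists S; rewrite /reads_set i3 r4; split=> // n'; rewrite ltnS leq_eqVlt => /orP [/eqP ->|/seen //].
    by rewrite -DE.
  have /andP [b0 _] := best.
  (* A value exceeding the nonnegative best one is nonzero, which excludes repeated picks. *)
  have uD : uniq D.
    apply/negPn/negP => nu; move: vgt; rewrite /mvol cats0 vol_nuniq //.
      by rewrite ltNge b0.
    by rewrite map_inj_uniq //; apply: basis_vec_inj.
  have al : all2 (fun a j => j \in pt a) slot_seq D.
    rewrite DE; apply: (@rounds_mem _ _ L pt l [::] [::]) => //; first exact: mem_part_of.
    by rewrite size_xvecs.
  exists [set j in D]; split.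
  + rewrite (family_of_picks al) ?enum_uniq //.
    by have -> : [set j in slot_seq] = slots M b by apply/setP => j; rewrite inE mem_enum.
  + by move=> j; rewrite i3 inE.
  + by rewrite r4 mvol_det // lexx det_psd_ge0.
  + move=> n'; rewrite ltnS leq_eqVlt r4 => /orP [/eqP ->|/seen h]; first by rewrite -DE.
    exact: le_trans h (ltW vgt).
- move=> s' f' [S [SF' S3' /andP [_ best] seen]]; exists S; split=> // n ln.
  exact: le_trans (seen n ln) best.
Qed.

End MainCorrect.

(** * Running time and success probability *)

(** With base m + 2 >= 2, raising the exponent absorbs constants and sums, also for m = 0 and m =
    1. *)
Definition poly_bounded (f : nat -> nat) : Prop := exists k, forall m, f m <= (m + 2) ^ k.

Lemma poly_cst n : poly_bounded (fun=> n).
Proof.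
exists n => m; apply: leq_trans (ltnW (ltn_expl n (ltnSn 1))) _.
by case: n => // n; rewrite leq_exp2r // addnC.
Qed.

Lemma poly_id : poly_bounded id.
Proof. by exists 1 => m; rewrite expn1 leq_addr. Qed.

Lemma poly_add f g : poly_bounded f -> poly_bounded g -> poly_bounded (fun m => f m + g m).
Proof.
move=> [k1 h1] [k2 h2]; exists (maxn k1 k2).+1 => m.
have e k : k <= maxn k1 k2 -> (m + 2) ^ k <= (m + 2) ^ maxn k1 k2.
  by move=> h; rewrite leq_pexp2l // addn2.
have := e k1 (leq_maxl _ _); have := e k2 (leq_maxr _ _); have := h1 m; have := h2 m.
rewrite expnS; nia.
Qed.

Lemma poly_mul f g : poly_bounded f -> poly_bounded g -> poly_bounded (fun m => f m * g m).
Proof.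
by move=> [k1 h1] [k2 h2]; exists (k1 + k2) => m; rewrite expnD leq_mul.
Qed.

Lemma poly_le f g : (forall m, f m <= g m) -> poly_bounded g -> poly_bounded f.
Proof. by move=> fg [k h]; exists k => m; apply: leq_trans (fg m) (h m). Qed.

Lemma poly_seq f g : poly_bounded f -> poly_bounded g -> poly_bounded (fun m => seq_time (f m) (g m)).
Proof.
move=> pf pg; apply: (@poly_le _ (fun m => (f m + g m) + 1)); last exact/poly_add/poly_cst/poly_add.
by move=> m; rewrite /seq_time addn1.
Qed.

Lemma poly_if f g : poly_bounded f -> poly_bounded g -> poly_bounded (fun m => if_time (f m) (g m)).
Proof.
move=> pf pg; apply: (@poly_le _ (fun m => (f m + g m) + 1)); last exact/poly_add/poly_cst/poly_add.
by move=> m; rewrite /if_time addn1 ltnS geq_max leq_addr leq_addl.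
Qed.

Lemma poly_for f g : poly_bounded f -> poly_bounded g -> poly_bounded (fun m => for_time (f m) (g m)).
Proof.
move=> pf pg; rewrite /for_time; apply: poly_add (poly_cst _).
by apply: poly_mul => //; apply: poly_add (poly_cst _).
Qed.

(** For m >= 1 one has m + 2 <= 3m, so 3^k can serve both as coefficient and as exponent; for m = 0
    the additive constant suffices. *)
Lemma poly_bounded_bound f : poly_bounded f -> exists k, forall m, f m <= k * m ^ k + k.
Proof.
move=> [k h]; exists (3 ^ k) => m; apply: leq_trans (h m) _.
case: m => [|m]; first by apply: leq_trans (leq_addl _ _); rewrite add0n; case: (k) => // n; rewrite leq_exp2r.
apply: leq_trans (leq_addr _ _).
apply: (@leq_trans ((3 * m.+1) ^ k)).
  by case: (k) => // n; rewrite leq_exp2r //; lia.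
by rewrite expnMn leq_mul2l; apply/orP; right; rewrite leq_pexp2l // ltnW // ltn_expl.
Qed.

(** Added to the time bound because the tape is as long as the running time and must contain the
    blocks of all trials; a trial has at most m slots. *)
Definition coin_bound c m : nat := 9 * c * m * (m * (m * (m + 7)) + m * (m + 7)).

Lemma poly_main c : poly_bounded (fun m => main_time c m m + coin_bound c m).
Proof.
do ?[exact: poly_cst | exact: poly_id | apply: poly_add | apply: poly_mul
  | apply: poly_seq | apply: poly_if | apply: poly_for].
Qed.

Lemma main_time_mono c m t : t <= m -> main_time c m t <= main_time c m m.
Proof.
move=> tm; have mono B : for_time t B <= for_time m B by rewrite leq_add2r leq_mul2r tm orbT.
by rewrite /main_time /seq_time !ltnS leq_add2l ltnS leq_add ?mono // ltnS leq_add ?mono.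
Qed.

Lemma run_wp (R : realType) p B (Q : state R -> Prop) s time : wp p B Q s -> B <= time ->
  exists2 s', run time p s = ([::], s') & Q s'.
Proof.
move=> [s' [n [nB st q]]] Bt; exists s' => //.
rewrite /run -(subnK (leq_trans nB Bt)) iterD st.
by elim: (_ - _) => //= k ->.
Qed.

Local Open Scope ring_scope.

(** Independence of the trials: they read disjoint blocks of the tape. *)
Lemma EE_blocks (R : realType) K rest N (f : seq bool -> R) :
  EE (N * K + rest) (fun w => \prod_(n < N) f (take K (drop (n * K) w))) = EE K f ^+ N.
Proof.
elim: N => [|N IH].
  by rewrite expr0 -[RHS](EE_cst (0 * K + rest) 1); apply: eq_EE => w _; rewrite big_ord0.
rewrite mulSn -addnA EE_cat exprS -IH -EEZr; apply: eq_EE => w1 sw1.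
rewrite -EEZ; apply: eq_EE => w2 _; rewrite big_ord_recl mul0n drop0 take_size_cat //.
congr (_ * _); apply: eq_bigr => n _; congr (f (take _ _)).
by rewrite mulSn addnC -drop_drop drop_size_cat.
Qed.

(** From e^x >= 1 + x at x = 1/8. The resulting e >= 2.55 suffices, as 1.1^5 * 16 <= 4 e^2 requires
    only about 2.54. *)
Lemma expR1_ge (R : realType) : (9 / 8) ^+ 8 <= expR 1 :> R.
Proof.
rewrite (_ : expR 1 = expR (8^-1) ^+ 8); last by rewrite -expRM_natl mulfV ?pnatr_eq0.
have -> : 9 / 8 = 1 + 8^-1 :> R by field.
by apply: lerXn2r; rewrite ?nnegrE ?expR_ge0 ?expR_ge1Dx // addr_ge0 ?invr_ge0.
Qed.

Section SuccessProbability.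
Variables (R : realType) (m t : nat) (L : 'M[R]_m) (M : 'I_t -> {set 'I_m}) (b : 'I_t -> nat).
Hypothesis pL : psd L.
Hypothesis pM : is_partition M.
Hypothesis b0 : forall i, (0 < b i)%N.
Hypothesis slotsF : slots M b \in partition_family M b.

Local Notation l := (m + 7)%N.
Local Notation sl := (slot_seq M b).
Local Notation pt := (part_of M).
Local Notation K := (trial_coins l sl).

(** Choosing one element from each part is injective. This permits a time bound in m alone. *)
Lemma parts_le : (t <= m)%N.
Proof.
have [ne dM _] := pM.
have /fin_all_exists [f fM] : forall i, exists j, j \in M i by move=> i; apply/set0Pn.
have := @leq_card _ _ f; rewrite !card_ord; apply => i j fij; apply/eqP.
by apply/negPn/negP => ij; have := disjointFr (dM _ _ ij) (fM i); rewrite fij fM.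
Qed.

Lemma slots_big (T : Type) (idx : T) (op : Monoid.com_law idx) (F : 'I_m -> T) :
  \big[op/idx]_(a <- sl) F a = \big[op/idx]_i \big[op/idx]_(a in slots M b :&: M i) F a.
Proof.
have /fin_all_exists [g gM] := part_of_ex pM.
rewrite big_enum /= (partition_big g predT) //=; apply: eq_bigr => i _.
apply: eq_bigl => a; rewrite inE; congr (_ && _); have [_ dM _] := pM.
apply/eqP/idP => [<-|aM]; first exact: gM.
apply/eqP/negPn/negP => gi; have := disjointFr (dM _ _ gi) (gM a); by rewrite aM.
Qed.

Lemma card_slots i : #|slots M b :&: M i| = b i.
Proof. by move: slotsF; rewrite inE => /forallP /(_ i) /eqP. Qed.

Lemma size_slots : size sl = (\sum_i b i)%N.
Proof.
rewrite -sum1_size slots_big; apply: eq_bigr => i _.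
by rewrite sum1_card card_slots.
Qed.

Lemma prod_slots : \prod_(a <- sl) #|pt a|%:R = \prod_i #|M i|%:R ^+ b i :> R.
Proof.
rewrite slots_big; apply: eq_bigr => i _.
rewrite -(card_slots i) -prodr_const; apply: eq_bigr => a; rewrite inE => /andP [_ aM].
by rewrite (part_of_eq pM aM).
Qed.

(** Greedy matching. It aligns an optimal solution with the slots, so that its k-th element lies in
    the part from which the k-th vector is drawn. *)
Lemma match_parts (s1 s2 : seq 'I_m) :
  (forall i, count [in M i] s1 = count [in M i] s2) ->
  exists2 ss, perm_eq ss s2 & all2 (fun a s => s \in pt a) s1 ss.
Proof.
elim: s1 s2 => [|a s1 IH] s2 h.
  exists [::] => //; case: s2 h => // j s2 h.
  by have [i jM] := part_of_ex pM j; have := h i; rewrite /= jM.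
have [i aM] := part_of_ex pM a.
have : has [in M i] s2 by rewrite has_count -h /= aM.
case/hasP => j js jM; have ja : j \in pt a by rewrite (part_of_eq pM aM).
have [|ss p al] := IH (rem j s2).
  move=> i'; have := h i'; rewrite (permP (perm_to_rem js)) /= -(part_of_mem pM i' ja).
  by move/addnI.
exists (j :: ss); last by rewrite /= ja.
by rewrite perm_sym (perm_trans (perm_to_rem js)) // perm_cons perm_sym.
Qed.

Lemma match_slots (S : {set 'I_m}) : S \in partition_family M b ->
  exists2 ss, all2 (fun a s => s \in pt a) sl ss & mvol L ss [::] = \det (principal_submx L S).
Proof.
rewrite inE => /forallP SF; have [|ss p al] := @match_parts sl (enum S).
  move=> i; rewrite -!card_uniq_set ?enum_uniq //.
  have E (A : {set 'I_m}) : [set j in enum A] = A by apply/setP => j; rewrite inE mem_enum.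
  by rewrite !E card_slots (eqP (SF i)).
by exists ss => //; rewrite -vol_principal // /mvol cats0; apply: vol_perm => //; apply: perm_map.
Qed.

Lemma opt_attained : opt L (partition_family M b) = 0 \/
  exists2 S, S \in partition_family M b & opt L (partition_family M b) = \det (principal_submx L S).
Proof.
rewrite /opt; elim/big_ind: _ => [|x y hx hy|S SF]; [by left| |by right; exists S].
by rewrite /Num.max; case: ifP.
Qed.

Lemma cost_ge0 ss w : 0 <= cost L l pt sl ss w.
Proof.
rewrite /cost addr_ge0 ?bads_ge0 // !divr_ge0 // ?addr_ge0 //.
- by rewrite mulr_ge0 // divr_ge0 ?kprod_ge0 // exprn_ge0 // divr_ge0 // sqrtr_ge0.
- rewrite !divr_ge0 ?mvol_ge0 // prodr_ge0 // => a _; by rewrite mulr_ge0 // exprn_ge0.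
Qed.

Lemma grid_large (a : 'I_m) : (#|pt a| * 2 <= 2 ^ l)%N.
Proof.
have h : (#|pt a| <= m)%N by rewrite -[X in (_ <= X)%N]card_ord max_card.
have := ltn_expl m (ltnSn 1); rewrite expnD; move: (2 ^ m)%N => x.
by rewrite (_ : 2 ^ 7 = 128)%N //; lia.
Qed.

(** Markov's inequality for the cost: 10/11 + 1/128 < 23/25. *)
Lemma EE_fail ss : all2 (fun a s => s \in pt a) sl ss ->
  EE K (fun w => (1 <= cost L l pt sl ss w)%R%:R) <= 23 / 25 :> R.
Proof.
move=> al; apply: (@le_trans _ _ (EE K (cost L l pt sl ss))).
  apply: le_EE => w _; case: (leP 1 (cost L l pt sl ss w)) => //= _; exact: cost_ge0.
apply: (le_trans (EE_cost pL grid_large al)).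
suff : (size sl)%:R / (2 ^ l)%:R <= 128^-1 :> R by lra.
rewrite ler_pdivrMr ?ltr0n ?expn_gt0 // expnD natrM.
have -> : 128^-1 * ((2 ^ m)%:R * (2 ^ 7)%:R) = (2 ^ m)%:R :> R.
  by rewrite (_ : 2 ^ 7 = 128)%N //; field.
rewrite ler_nat; apply: leq_trans (ltnW (ltn_expl m (ltnSn 1))).
by rewrite /slot_seq -cardE -[X in (_ <= X)%N]card_ord max_card.
Qed.

(** (23/25)^9 <= 1/2 and 2^m >= m. For m = 0 and positive c the right-hand side is 0^-1 = 0, so that
    case is set apart. *)
Lemma fail_power c : (23 / 25 : R) ^+ (9 * c * m) <= (m%:R ^+ c)^-1 \/ m = 0%N.
Proof.
case: (posnP m) => [|m0]; first by right.
left; rewrite -mulnA exprM mulnC exprM -exprVn.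
apply: lerXn2r; rewrite ?nnegrE ?exprn_ge0 ?invr_ge0 ?divr_ge0 //.
apply: (@le_trans _ _ (2^-1 ^+ m)).
  by apply: lerXn2r; rewrite ?nnegrE ?exprn_ge0 ?invr_ge0 ?divr_ge0 //; lra.
rewrite exprVn lef_pV2 ?posrE ?exprn_gt0 ?ltr0n // -natrX ler_nat.
exact: ltnW (ltn_expl m (ltnSn 1)).
Qed.

(** The slack 1.1^5 occurs only once; since r > 0 it may be charged to each of the r factors, where
    1.1^5 * 16 <= (2e)^2. *)
Lemma approx_factor r : (0 < r)%N -> (11 / 10) ^+ 5 * 16 ^+ r <= (2 * expR 1) ^+ (2 * r) :> R.
Proof.
move=> r0; have e1 : (9 / 8) ^+ 8 <= expR 1 :> R := @expR1_ge R.
have {}e1 : 51 / 20 <= expR 1 :> R by apply: le_trans e1; lra.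
have A1 : 1 <= (11 / 10) ^+ 5 :> R by lra.
rewrite exprM; apply: (@le_trans _ _ (((11 / 10) ^+ 5 * 16) ^+ r)).
  set A := (11 / 10) ^+ 5 in A1 *.
  by rewrite [X in _ <= X]exprMn ler_wpM2r ?exprn_ge0 // -[X in X <= _]expr1 ler_weXn2l.
apply: lerXn2r; rewrite ?nnegrE; [lra|exact: sqr_ge0|].
by have := sqr_ge0 (expR 1 - 51 / 20 : R); rewrite exprMn; nra.
Qed.

Lemma trial_success r ss w (S : {set 'I_m}) : (\sum_(i < t) b i)%N = r -> (0 < m)%N ->
  all2 (fun a s => s \in pt a) sl ss -> size w = K ->
  0 < mvol L ss [::] -> cost L l pt sl ss w < 1 ->
  mvol L (trial L l pt sl w) [::] <= \det (principal_submx L S) ->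
  mvol L ss [::] * (2 * expR 1) ^- (2 * r) * \prod_(i < t) (1 / #|M i|%:R) ^+ b i
    <= \det (principal_submx L S).
Proof.
move=> br m0 al sw V0 c1 vS.
have sr : size sl = r by rewrite size_slots br.
have r0 : (0 < r)%N.
  have [i iM] := part_of_ex pM (Ordinal m0).
  by rewrite -br (bigD1 i) //= ltn_addr.
have := cost_good pL grid_large al sw V0 c1; rewrite prod_slots sr => h.
have P0 : 0 < \prod_i #|M i|%:R ^+ b i :> R.
  apply: prodr_gt0 => i _; rewrite exprn_gt0 // ltr0n card_gt0.
  by have [ne _ _] := pM.
have -> : \prod_(i < t) (1 / #|M i|%:R) ^+ b i = (\prod_i #|M i|%:R ^+ b i)^-1 :> R.
  by rewrite -prodfV; apply: eq_bigr => i _; rewrite div1r exprVn.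
set E := (2 * expR 1) ^+ (2 * r).
have E0 : 0 < E by rewrite exprn_gt0 // mulr_gt0 // expR_gt0.
rewrite ler_pdivrMr // ler_pdivrMr //.
apply: (le_trans h).
have v0 := mvol_ge0 pL (trial L l pt sl w) [::].
apply: (@le_trans _ _ (E * (\prod_i #|M i|%:R ^+ b i) * mvol L (trial L l pt sl w) [::])).
  by rewrite !ler_wpM2r // ?(ltW P0) // approx_factor.
rewrite -mulrA [X in _ <= X]mulrC ler_wpM2l ?(ltW E0) //.
by rewrite mulrC ler_wpM2r // ltW.
Qed.

End SuccessProbability.

Theorem theorem1p3 (R : realType) (c : nat) :
  exists (p : prog) (k : nat),
    forall (m t r : nat) (L : 'M[R]_m) (M : 'I_t -> {set 'I_m}) (b : 'I_t -> nat),
      psd L ->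
      is_partition M ->
      (forall i : 'I_t, (0 < b i)%N) ->
      (\sum_(i < t) b i)%N = r ->
      partition_family M b != set0 ->
      let time := (k * m ^ k + k)%N in
      let result (w : seq bool) := run time p (input L M b w) in
      let S (w : seq bool) := output m (result w) in
      (forall w : time.-tuple bool,
         halted (result w) /\ S w \in partition_family M b) /\
      1 - (m%:R ^+ c)^-1 <=
        coin_prob R (fun w : time.-tuple bool =>
          opt L (partition_family M b) * (2 * expR 1) ^- (2 * r)
            * \prod_(i < t) (1 / #|M i|%:R) ^+ b i
          <= \det (principal_submx L (S w))).
Proof.
have [k kb] := poly_bounded_bound (poly_main c).
exists (Main c), k => m t r L M b pL pM b0 br F0 time result S.
pose sl := slot_seq M b; pose K := trial_coins (m + 7) sl.
have tm := parts_le pM.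
have slm : (size sl <= m)%N.
  by rewrite /sl /slot_seq -cardE -[X in (_ <= X)%N]card_ord max_card.
have coins_le : (9 * c * m * K <= time)%N.
  apply: leq_trans (kb m); apply: leq_trans (leq_addl _ _).
  by rewrite leq_mul2l /K /trial_coins leq_add ?orbT // leq_mul2r slm orbT.
have time_le : (main_time c m t <= time)%N.
  apply: leq_trans (main_time_mono c tm) _; apply: leq_trans (kb m); exact: leq_addr.
have key (w : time.-tuple bool) : [/\ halted (result w), S w \in partition_family M b,
   slots M b \in partition_family M b & forall n, (n < 9 * c * m)%N ->
     mvol L (trial L (m + 7) (part_of M) sl (take K (drop (n * K) w))) [::]
       <= \det (principal_submx L (S w))].
  have [|s' rE [S' [SF S3 sF h]]] := run_wp (@wp_main R c m t L M b pL pM F0 w _) time_le.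
    by rewrite size_tuple.
  have SE : S w = S'.
    by apply/setP => j; rewrite inE /result rE /= -lt0n S3.
  by rewrite SE /result rE.
split=> [w|]; first by case: (key w).
(* That the slots form a member of the family is a by-product of running the program; any tape will
   do. *)
have [_ _ slotsF _] := key [tuple of nseq time false].
set good := (fun w : time.-tuple bool => _).
have all_good : (forall w, good w) -> 1 - (m%:R ^+ c)^-1 <= coin_prob R good.
  move=> h; rewrite coin_probE (eq_bigr (fun=> 1)) => [|w _]; last by rewrite h.
  rewrite sumr_const card_tuple card_bool divff ?pnatr_eq0 ?expn_eq0 //.
  by rewrite lerBlDr lerDl invr_ge0 exprn_ge0.
have [o0|[Sopt SoptF oE]] := opt_attained L M b.
  by apply: all_good => w; rewrite /good o0 !mul0r det_psd_ge0.
(* For m = 0 and c > 0 success is required with probability 1; there is only the empty set, and all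
   factors are 1. *)
case: (posnP m) => [m0|m0].
  apply: all_good => w; rewrite /good.
  have -> : S w = Sopt by apply/setP => j; have := ltn_ord j; lia.
  have t0 : t = 0%N by move: tm; rewrite m0; lia.
  have -> : r = 0%N by rewrite -br big1 // => i; have := ltn_ord i; lia.
  rewrite big1 => [|i _]; last by have := ltn_ord i; lia.
  by rewrite oE muln0 expr0 invr1 !mulr1.
have [ss al ssE] := match_slots pL pM slotsF SoptF.
have V0 := mvol_ge0 pL ss [::].
case: (eqVneq (mvol L ss [::]) 0) => [Vz|Vnz].
  by apply: all_good => w; rewrite /good oE -ssE Vz !mul0r det_psd_ge0.
have {V0 Vnz}V0 : 0 < mvol L ss [::] by rewrite lt0r Vnz.
pose f w : R := (1 <= cost L (m + 7) (part_of M) sl ss w)%R%:R.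
pose N := (9 * c * m)%N.
(* The product is 1 when every trial has cost at least 1 and 0 otherwise; a single cheap trial makes
   the whole run good, because the output is at least as good as each trial. *)
have fail (w : time.-tuple bool) :
    1 - \prod_(n < N) f (take K (drop (n * K) w)) <= (good w)%:R.
  have [gw|ngw] := boolP (good w).
    by rewrite lerBlDr lerDl prodr_ge0 // => n _; rewrite ler0n.
  rewrite big1 ?subrr // => n _; rewrite /f; case: leP => // c1; exfalso.
  move/negP: ngw; apply; rewrite /good oE -ssE.
  apply: (trial_success pL pM b0 slotsF br m0 al _ V0 c1).
    rewrite size_takel // size_drop size_tuple.
    by have := ltn_ord n; rewrite /N; move: coins_le; nia.
  by have [_ _ _] := key w; apply; rewrite ltn_ord.
rewrite coin_probE; apply: (@le_trans _ _
  (EE time (fun w => 1 - \prod_(n < N) f (take K (drop (n * K) w))))); last first.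
  by rewrite EE_tuple ler_wpM2r ?invr_ge0 // ler_sum.
rewrite EED EE_cst lerD2l.
rewrite (eq_EE (g := fun w => -1 * \prod_(n < N) f (take K (drop (n * K) w)))); last first.
  by move=> w _; rewrite mulN1r.
(* The tape is cut into [N] blocks of [K] coins and a remainder that no trial reads. *)
rewrite EEZ mulN1r lerN2 -(subnKC coins_le) EE_blocks.
have [h|m00] := fail_power R m c; last by move: m0; rewrite m00.
apply: le_trans h; apply: lerXn2r; rewrite ?nnegrE ?divr_ge0 //.
  by apply: EE_ge0 => w _; rewrite ler0n.
exact: EE_fail.
Qed.
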